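(* Let $\alpha>0$ and let $f\in E^{\infty}_{\tanh(2\alpha)}$, i.e. $f\in L^2(\mathbb{R})$ and there is a constant $C_0>0$ such that $|f(x)|\le C_0 e^{-\tanh(2\alpha)\pi|x|^2}$ for almost every $x\in\mathbb{R}$ and $|\widehat f(\xi)|\le C_0 e^{-\tanh(2\alpha)\pi|\xi|^2}$ for almost every $\xi\in\mathbb{R}$. Let $\Phi_f$ be the solution of $$ i\,\partial_t\Phi_f(x,t)=\left(\frac{\partial^2}{\partial x^2}-4\pi^2x^2\right)\Phi_f(x,t),\qquad \Phi_f(x,0)=f(x). $$ Then there exists a constant $C>0$, independent of $x$ and $t$, such that $$ |\Phi_f(x,t)|\le C e^{-\tanh(\alpha)\pi|x|^2}\qquad\text{for all } x\in\mathbb{R} \text{ and all } t\in\mathbb{R}. $$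
   Context: For $a>0$, $E^\infty_a=\{f\in L^2(\mathbb{R}): |f(x)|\ll e^{-a\pi|x|^2},\ |\widehat f(\xi)|\ll e^{-a\pi|\xi|^2}\}$, where $\ll$ means $\le$ up to a positive multiplicative constant independent of $x$ and $\xi$ (bounds understood almost everywhere). The Fourier transform is normalized as $\widehat f(\xi)=\int_{\mathbb{R}} f(x)e^{-2\pi i x\xi}\,dx$. Hermite functions: $h_n(x)=\dfrac{e^{-x^2/2}H_n(x)}{\sqrt{2^n\pi^{1/2}n!}}$ for $n\ge 0$, where $H_n(x)=(-1)^ne^{x^2}\frac{d^n}{dx^n}e^{-x^2}$. Every $f\in L^2(\mathbb{R})$ has an expansion $f(x)=\sum_{n\ge0}c_nh_n(\sqrt{2\pi}x)$ converging in $L^2$, and the solution of the harmonic oscillator equation $i\,\partial_t\Phi_f(x,t)=\left(\frac{\partial^2}{\partial x^2}-4\pi^2x^2\right)\Phi_f(x,t)$ with initial datum $\Phi_f(x,0)=f(x)$ is the function $\Phi_f(x,t)=\sum_{n\ge0}e^{2(2n+1)\pi i t}c_nh_n(\sqrt{2\pi}x)$. For $f\in E^\infty_{\tanh(2\alpha)}$, $\Phi_f(x,t)$ for every $x$ and $t$ denotes the pointwise sum of this series. *)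

(* Defs.v *)
(* MathComp-Analysis, with complex numbers [R[i]] from mathcomp-real-closed. *)
From HB Require Import structures.
From mathcomp Require Export all_boot all_order all_algebra.
From mathcomp Require Export complex.
From mathcomp Require Export all_classical all_reals all_analysis.
Export Order.TTheory GRing.Theory Num.Theory.
Export numFieldNormedType.Exports.

Set Implicit Arguments.
Unset Strict Implicit.
Unset Printing Implicit Defensive.

Local Open Scope classical_set_scope.
Local Open Scope ring_scope.
Local Open Scope complex_scope.

Section Defs.
Context {R : realType}.
Implicit Types (f : R -> R[i]) (c : nat -> R[i]) (x t xi : R) (n : nat).

Local Notation mu := (@lebesgue_measure R).

Definition tanh x : R := (expR x - expR (- x)) / (expR x + expR (- x)).

(* The modulus as an element of [R]: [`|z|] lives in [R[i]]. *)
Definition cmod (z : R[i]) : R := ComplexField.Normc.normc z.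

(* The complex exponential e^{i theta}. *)
Definition expi (theta : R) : R[i] := cos theta +i* sin theta.

Definition cintegral f : R[i] :=
  (\int[mu]_x complex.Re (f x))%R +i* (\int[mu]_x complex.Im (f x))%R.

Definition L2norm f : \bar R := Lnorm mu 2%:E (fun x => (cmod (f x))%:E).

(* Elements of L^2 are given by Borel representatives. *)
Definition inL2 f : Prop :=
  [/\ measurable_fun [set: R] (fun x => complex.Re (f x)),
      measurable_fun [set: R] (fun x => complex.Im (f x))
    & (L2norm f < +oo)%E].

(* The integral converges absolutely as soon as [f] is integrable, which in
   [E_infty a], a > 0, is forced by the Gaussian bound on f; no extension of the
   transform from L^1 to L^2 is therefore needed. *)
Definition fourier f xi : R[i] :=
  cintegral (fun x => f x * expi (- (2 * pi * x * xi))).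

Definition E_infty (a : R) : set (R -> R[i]) := [set f | inL2 f /\
  exists C0 : R, [/\ 0 < C0,
    {ae mu, forall x, cmod (f x) <= C0 * expR (- (a * pi * `|x| ^+ 2))}
  & {ae mu, forall xi,
      cmod (fourier f xi) <= C0 * expR (- (a * pi * `|xi| ^+ 2))}]].

Definition hermite_poly n x : R :=
  (-1) ^+ n * expR (x ^+ 2) * derive1n n (fun y : R => expR (- y ^+ 2)) x.

Definition hermite_fun n x : R :=
  expR (- (x ^+ 2 / 2)) * hermite_poly n x /
  Num.sqrt (2 ^+ n * Num.sqrt pi * (n`!)%:R).

Definition scaled_hermite n x : R[i] :=
  (hermite_fun n (Num.sqrt (2 * pi) * x))%:C.

(* [f = \sum_n c n * h_n (sqrt (2 pi) x)], with convergence in L^2. *)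
Definition hermite_expansion f c : Prop :=
  L2norm (fun x => f x - \sum_(n < N) c n * scaled_hermite n x)
    @[N --> \oo] --> 0%E.

Definition oscillator_term c x t n : R[i] :=
  expi (2 * (2 * n%:R + 1) * pi * t) * c n * scaled_hermite n x.

(* [R[i]^o] carries the topology of the modulus. *)
Definition oscillator_series c x t : nat -> R[i]^o :=
  series (oscillator_term c x t).

(* The solution, in terms of the Hermite coefficients [c] of the initial datum;
   [limn] is meaningful only when the series converges at [(x, t)]. *)
Definition oscillator_sol c x t : R[i] := limn (oscillator_series c x t).

End Defs.

(* Main.v *)
(* Let F(z) be the Bargmann transform of f, whose Taylor coefficients are the Hermite
   coefficients of f up to explicit factors, so that the evolution by the oscillator
   becomes a rotation of the variable z.  Put rho = exp(-2 alpha).  The Gaussian bound on f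
   gives |F(u + iv)| <= C exp(pi/2 (rho^2 u^2 + v^2)) and the one on its Fourier transform gives
   the same with u and v exchanged.  On the lines v = rho u and u = rho v one of these bounds
   reads C exp(pi rho u v), the modulus of a nonvanishing entire function, so
   Phragmen-Lindelof in the sector between the two lines (of opening < pi/2, for order 2)
   yields |F(z)| <= C exp(pi/2 rho |z|^2) on the whole plane, a bound invariant under rotation.
   Inverting the transform along the vertical line of abscissa 2x/(1+rho) gives the decay
   exp(-pi x^2 (1-rho)/(1+rho)) = exp(-pi x^2 tanh alpha). *)

(* The origin of rho: tanh (2 alpha) = (1 - rho^2)/(1 + rho^2) =: a, and completing the square
   against the Bargmann kernel produces 1/(1 + a) = (1 + rho^2)/2. Neither of the two bounds on F is
   invariant under rotation; only their combination is.

   Complex analysis is reduced to two finite averages: over four points for the maximum principle,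
   over roots of unity for Cauchy's estimate.

   The expansion of f converges in L^2 only, while pointwise convergence of the evolved series has
   to be proved. Pairing with the kernel turns L^2 convergence into convergence of the power series
   of F at every z. The inversion formula is exact for each partial sum and on every vertical line,
   so passing to the limit only requires an integrable majorant of the partial sums. Cauchy's
   estimate gives one with a larger exponent, which costs nothing: the final bound is read off the
   limit F itself. As the abscissa u is free, it may depend on x, and it is taken where pi/2 (1 +
   rho) u^2 - 2 pi x u is least. *)
Require Import Defs.
From mathcomp Require Import measurable_realfun.
From mathcomp Require Import ring lra.

Set Implicit Arguments.
Unset Strict Implicit.
Unset Printing Implicit Defensive.

Local Open Scope classical_set_scope.
Local Open Scope ring_scope.
Local Open Scope complex_scope.

(** * Modulus, exponential and convergence of complex numbers *)

Section Modulus.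
Context {R : realType}.
Implicit Types (z w s : R[i]).

Lemma cmod0 : cmod (0 : R[i]) = 0.
Proof. exact: ComplexField.Normc.normc0. Qed.

Lemma cmod1 : cmod (1 : R[i]) = 1.
Proof. exact: ComplexField.Normc.normc1. Qed.

Lemma cmodM z w : cmod (z * w) = cmod z * cmod w.
Proof. exact: ComplexField.Normc.normcM. Qed.

Lemma cmodD z w : cmod (z + w) <= cmod z + cmod w.
Proof. exact: (le_normcD z w). Qed.

Lemma cmodN z : cmod (- z) = cmod z.
Proof. exact: (normcN z). Qed.

Lemma cmodB z w : cmod (z - w) <= cmod z + cmod w.
Proof. by rewrite -(cmodN w) cmodD. Qed.

Lemma cmod_distC z w : cmod (z - w) = cmod (w - z).
Proof. by rewrite -cmodN opprB. Qed.

Lemma cmodE z : cmod z = Num.sqrt (complex.Re z ^+ 2 + complex.Im z ^+ 2).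
Proof. by case: z. Qed.

Lemma cmod_ge0 z : 0 <= cmod z.
Proof. by rewrite cmodE sqrtr_ge0. Qed.

Lemma cmod_eq0 z : cmod z = 0 -> z = 0.
Proof. exact: ComplexField.Normc.eq0_normc. Qed.

Lemma cmod_sqr z : cmod z ^+ 2 = complex.Re z ^+ 2 + complex.Im z ^+ 2.
Proof. by rewrite cmodE sqr_sqrtr// addr_ge0 ?sqr_ge0. Qed.

Lemma cmod_real (x : R) : cmod x%:C = `|x|.
Proof. by rewrite cmodE/= expr0n addr0 sqrtr_sqr. Qed.

Lemma cmod_pos (x : R) : 0 <= x -> cmod x%:C = x.
Proof. by move=> x0; rewrite cmod_real ger0_norm. Qed.

Lemma cmodX z n : cmod (z ^+ n) = cmod z ^+ n.
Proof.
by elim: n => [|n IH]; rewrite ?expr0 ?cmod1// !exprS cmodM IH.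
Qed.

Lemma Re_le_cmod z : `|complex.Re z| <= cmod z.
Proof. by rewrite cmodE -sqrtr_sqr ler_wsqrtr// lerDl sqr_ge0. Qed.

Lemma Im_le_cmod z : `|complex.Im z| <= cmod z.
Proof. by rewrite cmodE -sqrtr_sqr ler_wsqrtr// lerDr sqr_ge0. Qed.

Lemma cmod_le_ReIm z : cmod z <= `|complex.Re z| + `|complex.Im z|.
Proof.
rewrite -(@ler_pXn2r _ 2) ?nnegrE ?cmod_ge0 ?addr_ge0// cmod_sqr sqrrD.
by rewrite !real_normK ?num_real// [leRHS]addrAC lerDl mulrn_wge0// mulr_ge0.
Qed.

Lemma cmod_sum (I : Type) (r : seq I) (P : pred I) (F : I -> R[i]) :
  cmod (\sum_(i <- r | P i) F i) <= \sum_(i <- r | P i) cmod (F i).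
Proof.
elim/big_ind2 : _ => //; first by rewrite cmod0.
by move=> x a y b xa yb; rewrite (le_trans (cmodD _ _))// lerD.
Qed.

Lemma ReM z w : complex.Re (z * w) =
  complex.Re z * complex.Re w - complex.Im z * complex.Im w.
Proof. by case: z w => [? ?] []. Qed.

Lemma ImM z w : complex.Im (z * w) =
  complex.Re z * complex.Im w + complex.Im z * complex.Re w.
Proof. by case: z w => [? ?] []. Qed.

Lemma complex_ext z w : complex.Re z = complex.Re w ->
  complex.Im z = complex.Im w -> z = w.
Proof. by case: z w => [a b] [c d] /= -> ->. Qed.

Lemma ReD z w : complex.Re (z + w) = complex.Re z + complex.Re w.
Proof. by case: z w => [? ?] []. Qed.
Lemma ImD z w : complex.Im (z + w) = complex.Im z + complex.Im w.
Proof. by case: z w => [? ?] []. Qed.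
Lemma ReN z : complex.Re (- z) = - complex.Re z.
Proof. by case: z. Qed.
Lemma ImN z : complex.Im (- z) = - complex.Im z.
Proof. by case: z. Qed.

End Modulus.

Section Cexp.
Context {R : realType}.
Implicit Types (z w s : R[i]).

Definition cexp z : R[i] := (expR (complex.Re z))%:C * expi (complex.Im z).

Lemma expiD (x y : R) : expi (x + y) = expi x * expi y.
Proof.
by rewrite /expi cosD sinD; apply: complex_ext => /=; rewrite ?ReM ?ImM/=; ring.
Qed.

Lemma expi0 : expi (0 : R) = 1.
Proof. by rewrite /expi cos0 sin0. Qed.

Lemma cmod_expi (x : R) : cmod (expi x) = 1.
Proof. by rewrite cmodE/= cos2Dsin2 sqrtr1. Qed.

Lemma cexpD z w : cexp (z + w) = cexp z * cexp w.
Proof. by rewrite /cexp ReD ImD expRD expiD rmorphM/= mulrACA. Qed.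

Lemma cexp0 : cexp 0 = 1 :> R[i].
Proof. by rewrite /cexp/= expR0 expi0 mulr1. Qed.

Lemma cmod_cexp z : cmod (cexp z) = expR (complex.Re z).
Proof. by rewrite cmodM cmod_expi mulr1 cmod_pos// expR_ge0. Qed.

Lemma cexp_real (x : R) : cexp x%:C = (expR x)%:C.
Proof. by rewrite /cexp/= expi0 mulr1. Qed.

End Cexp.

(** Convergence is phrased through the real sequence of distances, so that squeezing and real limits
    apply directly. [ccvg_cvg] returns to the topology of [R[i]^o], where the solution is
    defined. *)
Definition ccvg {R : realType} (u : nat -> R[i]) (l : R[i]) : Prop :=
  (fun n => cmod (u n - l)) @ \oo --> (0 : R).

Section Ccvg.
Context {R : realType}.
Implicit Types (u v : nat -> R[i]) (l m : R[i]).

Lemma ccvg_cst l : ccvg (fun=> l) l.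
Proof. by rewrite /ccvg subrr cmod0; exact: cvg_cst. Qed.

Lemma ccvg_squeeze u l (e : R^nat) : (forall n, cmod (u n - l) <= e n) ->
  e @ \oo --> (0 : R) -> ccvg u l.
Proof.
move=> ue e0; apply: (squeeze_cvgr _ (cvg_cst 0) e0).
by apply: nearW => n; rewrite cmod_ge0 ue.
Qed.

Lemma ccvgD u v l m : ccvg u l -> ccvg v m -> ccvg (fun n => u n + v n) (l + m).
Proof.
move=> ul vm; apply: (@ccvg_squeeze _ _ (fun n => cmod (u n - l) + cmod (v n - m))).
  by move=> n; rewrite opprD addrACA cmodD.
by rewrite -[0]addr0; apply: cvgD.
Qed.

Lemma ccvgZ a u l : ccvg u l -> ccvg (fun n => a * u n) (a * l).
Proof.
move=> ul; apply: (@ccvg_squeeze _ _ (fun n => cmod a * cmod (u n - l))).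
  by move=> n; rewrite -mulrBr cmodM.
by rewrite -(mulr0 (cmod a)); apply: cvgMr.
Qed.

Lemma ccvg_ReIm u l : (fun n => complex.Re (u n)) @ \oo --> complex.Re l ->
  (fun n => complex.Im (u n)) @ \oo --> complex.Im l -> ccvg u l.
Proof.
move=> uR uI; apply: (@ccvg_squeeze _ _ (fun n => `|complex.Re (u n) - complex.Re l| +
  `|complex.Im (u n) - complex.Im l|)).
  by move=> n; rewrite (le_trans (cmod_le_ReIm _))// ReD ReN ImD ImN.
by rewrite -[0]addr0; apply: cvgD;
  apply/norm_cvg0P/subr_cvg0.
Qed.

Lemma ccvg_Re u l : ccvg u l -> (fun n => complex.Re (u n)) @ \oo --> complex.Re l.
Proof.
move=> ul; apply/subr_cvg0; apply/norm_cvg0P.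
apply: (squeeze_cvgr _ (cvg_cst 0) ul); apply: nearW => n /=.
by rewrite normr_ge0 -ReN -ReD Re_le_cmod.
Qed.

Lemma ccvg_Im u l : ccvg u l -> (fun n => complex.Im (u n)) @ \oo --> complex.Im l.
Proof.
move=> ul; apply/subr_cvg0; apply/norm_cvg0P.
apply: (squeeze_cvgr _ (cvg_cst 0) ul); apply: nearW => n /=.
by rewrite normr_ge0 -ImN -ImD Im_le_cmod.
Qed.

Lemma ccvg_cmod u l : ccvg u l -> (fun n => cmod (u n)) @ \oo --> cmod l.
Proof.
move=> ul; apply/subr_cvg0; apply/norm_cvg0P.
apply: (squeeze_cvgr _ (cvg_cst 0) ul); apply: nearW => n /=.
rewrite normr_ge0/= ler_norml; apply/andP; split.
  rewrite lerNl opprB lerBlDr cmod_distC -[X in cmod X <= _](subrK (u n)).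
  exact: cmodD.
by rewrite lerBlDr -[X in cmod X <= _](subrK l) cmodD.
Qed.

Lemma ccvg_le u l (M : R) : ccvg u l -> (forall n, cmod (u n) <= M) -> cmod l <= M.
Proof.
move=> /ccvg_cmod ul uM; rewrite -(cvg_lim _ ul)//.
by apply: limr_le; [apply/cvg_ex; exists (cmod l)|exact: nearW].
Qed.

Lemma ccvg_bounded u l : ccvg u l -> exists2 K, 0 <= K & forall n, cmod (u n) <= K.
Proof.
move=> /ccvg_cmod /cvgP /cvg_seq_bounded[M [_ hM]].
have h : forall n, cmod (u n) <= `|M| + 1.
  move=> n; have /= := hM (`|M| + 1) _ n I; rewrite (ger0_norm (cmod_ge0 _)); apply.
  by rewrite (le_lt_trans (ler_norm M))// ltrDl.
by exists (`|M| + 1) => //; rewrite addr_ge0.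
Qed.

Lemma ccvg_cvg (u : nat -> R[i]^o) l : ccvg u l -> u @ \oo --> (l : R[i]^o).
Proof.
move=> /cvgrPdist_lt ul; apply/cvgrPdist_lt => -[e f]; rewrite ltcE/= => /andP[/eqP -> e0].
near=> n.
have : `|0 - cmod (u n - l)| < e by near: n; exact: ul.
rewrite sub0r normrN ger0_norm ?cmod_ge0// => h.
by rewrite distrC normc_def/= -cmodE ltcR.
Unshelve. all: by end_near.
Qed.

End Ccvg.

(** * The maximum principle *)

Section BigO.
Context {R : realType}.
Implicit Types (f g : R[i] -> R[i]) (z w s : R[i]) (j k : nat).

(** This is f(s) = O(|s|^k) at 0. The point s = 0 is included, so a positive order forces f 0 = 0;
    this identifies the constant term of an expansion. *)
Definition isO k f : Prop := exists K d : R, [/\ 0 <= K, 0 < d &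
  forall s, cmod s <= d -> cmod (f s) <= K * cmod s ^+ k].

Lemma isO_ext k f g : f =1 g -> isO k f -> isO k g.
Proof.
move=> fg [K [d [K0 d0 h]]]; exists K, d; split => // s sd.
by rewrite -fg; exact: h.
Qed.

Lemma isOD k f g : isO k f -> isO k g -> isO k (fun s => f s + g s).
Proof.
move=> [K [d [K0 d0 h]]] [K' [d' [K0' d0' h']]].
exists (K + K'), (Num.min d d'); split; first by rewrite addr_ge0.
  by rewrite lt_min d0.
move=> s; rewrite le_min => /andP[sd sd'].
by rewrite (le_trans (cmodD _ _))// mulrDl lerD ?h ?h'.
Qed.

Lemma isOM j k f g : isO j f -> isO k g -> isO (j + k) (fun s => f s * g s).
Proof.
move=> [K [d [K0 d0 h]]] [K' [d' [K0' d0' h']]].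
exists (K * K'), (Num.min d d'); split; first by rewrite mulr_ge0.
  by rewrite lt_min d0.
move=> s; rewrite le_min => /andP[sd sd'].
by rewrite cmodM exprD mulrACA ler_pM ?cmod_ge0 ?h ?h'.
Qed.

Lemma isO_mono j k a : (k <= j)%N -> isO k (fun s => a * s ^+ j).
Proof.
move=> kj; exists (cmod a), 1; split => //; first exact: cmod_ge0.
move=> s s1; rewrite cmodM cmodX ler_wpM2l ?cmod_ge0//.
by rewrite ler_wiXn2l ?cmod_ge0.
Qed.

Lemma isO_weak j k f : (k <= j)%N -> isO j f -> isO k f.
Proof.
move=> kj [K [d [K0 d0 h]]]; exists K, (Num.min d 1); split => //.
  by rewrite lt_min d0 ltr01.
move=> s; rewrite le_min => /andP[sd s1].
rewrite (le_trans (h _ sd))// ler_wpM2l//.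
by rewrite ler_wiXn2l ?cmod_ge0.
Qed.

Lemma isO_comp f g k : isO k f -> isO 1 g -> isO k (f \o g).
Proof.
move=> [K [d [K0 d0 h]]] [L [e [L0 e0 h']]].
(* The radius d / (L + 1) keeps g s within the disc where f is controlled; the 1 covers L = 0. *)
exists (K * L ^+ k), (Num.min e (d / (L + 1))); split.
- by rewrite mulr_ge0// exprn_ge0.
- by rewrite lt_min e0 divr_gt0// ltr_wpDl.
move=> s; rewrite le_min => /andP[se sd] /=.
have gs : cmod (g s) <= L * cmod s by rewrite -[X in _ * X]expr1 h'.
have gd : cmod (g s) <= d.
  rewrite (le_trans gs)// (@le_trans _ _ ((L + 1) * (d / (L + 1))))//.
    by rewrite ler_pM ?cmod_ge0// lerDl.
  by rewrite mulrCA divff ?mulr1// gt_eqF// ltr_wpDl.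
rewrite (le_trans (h _ gd))// -mulrA -exprMn ler_wpM2l//.
by apply: lerXn2r; rewrite ?nnegrE ?mulr_ge0 ?cmod_ge0.
Qed.

End BigO.

Section T2.
Context {R : realType}.
Implicit Types (f g : R[i] -> R[i]) (z w s : R[i]) (j k : nat).

(* [f] has a complex Taylor expansion of order 2 at [w]; for the maximum
   principle this replaces holomorphy. *)
Definition taylor2 f w : Prop := exists A B D : R[i],
  isO 3 (fun s => f (w + s) - (A + B * s + D * s ^+ 2)).

Lemma isO3_0 f : isO 3 f -> f 0 = 0.
Proof.
move=> [K [d [K0 d0 h]]]; apply: cmod_eq0; apply/eqP.
have := h 0; rewrite cmod0 => /(_ (ltW d0)); rewrite expr0n/= mulr0 => h0.
by rewrite eq_le h0 cmod_ge0.
Qed.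

Lemma taylor2_val f w A B D :
  isO 3 (fun s => f (w + s) - (A + B * s + D * s ^+ 2)) -> A = f w.
Proof.
move=> /isO3_0; rewrite addr0 expr0n/= !mulr0 !addr0 => /eqP.
by rewrite subr_eq0 => /eqP.
Qed.

Lemma taylor2_cst a w : taylor2 (fun=> a) w.
Proof.
exists a, 0, 0; apply: (isO_ext _ (isO_mono 0 (leqnn 3))) => s.
by rewrite !mul0r !addr0 subrr.
Qed.

Lemma taylor2_id w : taylor2 id w.
Proof.
exists w, 1, 0; apply: (isO_ext _ (isO_mono 0 (leqnn 3))) => s.
by rewrite mul1r !mul0r !addr0 subrr.
Qed.

Lemma taylor2M f g w : taylor2 f w -> taylor2 g w -> taylor2 (fun z => f z * g z) w.
Proof.
move=> [A [B [D h]]] [A' [B' [D' h']]].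
exists (A * A'), (A * B' + B * A'), (A * D' + B * B' + D * A').
set r := fun s => _ in h; set r' := fun s => _ in h'.
have c k (a : R[i]) : isO 0 (fun s => a * s ^+ k) by exact: isO_mono.
have P : isO 0 (fun s => A + B * s + D * s ^+ 2).
  by apply: isOD (c 2%N _); apply: isOD (c 1%N _);
    apply: isO_ext (c 0%N A) => s; rewrite mulr1.
have P' : isO 0 (fun s => A' + B' * s + D' * s ^+ 2).
  by apply: isOD (c 2%N _); apply: isOD (c 1%N _);
    apply: isO_ext (c 0%N A') => s; rewrite mulr1.
(* With f = P + r and g = P' + r', the remainder is P r' + P' r + r r' plus the terms of degree 3
   and 4 of P P'. *)
have e1 := isOM P h'.
have e2 := isOM P' h.
have e3 := isOM (isO_weak (leq0n 3) h) h'.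
have e4 : isO 3 (fun s => (B * D' + D * B') * s ^+ 3) by exact: isO_mono.
have e5 : isO 3 (fun s => (D * D') * s ^+ 4) by exact: isO_mono.
apply: isO_ext (isOD (isOD (isOD (isOD e1 e2) e3) e4) e5) => s.
by rewrite /r /r'; ring.
Qed.

Lemma taylor2D f g w : taylor2 f w -> taylor2 g w -> taylor2 (fun z => f z + g z) w.
Proof.
move=> [A [B [D h]]] [A' [B' [D' h']]].
exists (A + A'), (B + B'), (D + D').
by apply: isO_ext (isOD h h') => s; ring.
Qed.

Lemma taylor2_comp f g w : taylor2 f (g w) -> taylor2 g w -> taylor2 (f \o g) w.
Proof.
move=> [A [B [D h]]] [A' [B' [D' h']]].
have A'E := taylor2_val h'; rewrite {}A'E in h'.
exists A, (B * B'), (B * D' + D * B' ^+ 2).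
set r := fun s => _ in h; set r' := fun s => _ in h'.
have m1 (a : R[i]) k : isO k (fun s => a * s ^+ k) by exact: isO_mono.
pose t s : R[i] := D' * s ^+ 2 + r' s.
have ht : isO 2 t by apply: isOD; [exact: m1|apply: isO_weak h'].
pose e s : R[i] := B' * s + t s.
have he : isO 1 e.
  by apply: isOD; [exact: (m1 B' 1%N)|apply: isO_weak ht].
(* Writing g (w + s) = g w + e with e = B' s + t and t of order 2, the remainder of A + B e + D e^2
   + r(e) consists of r(e), B r', 2 D B' s t and D t^2. *)
have e1 := isO_comp h he.
have e2 := isOM (isO_mono B (leq0n 0)) h'.
have e3 := isOM (m1 (2 * D * B') 1%N) ht.
have e4 := isOM (isO_mono D (leq0n 0)) (isO_weak (isT : 3 <= 4)%N (isOM ht ht)).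
apply: isO_ext (isOD (isOD (isOD e1 e2) e3) e4) => s /=.
have -> : g (w + s) = g w + e s by rewrite /e /t /r'; ring.
have -> : r' s = e s - B' * s - D' * s ^+ 2 by rewrite /e /t; ring.
have -> : t s = e s - B' * s by rewrite /e; ring.
by rewrite /r; ring.
Qed.

Lemma taylor2_bound f w : taylor2 f w -> exists K d : R, [/\ 0 <= K, 0 < d &
  forall s, cmod s <= d -> cmod (f (w + s) - f w) <= K * cmod s].
Proof.
move=> [A [B [D h]]]; have AE := taylor2_val h; rewrite {}AE in h.
have := isOD (isO_weak (isT : 1 <= 3)%N h)
  (isOD (isO_mono B (leqnn 1)) (isO_mono D (isT : 1 <= 2)%N)).
move=> [K [d [K0 d0 hK]]]; exists K, d; split => // s sd.
have := hK s sd; rewrite expr1.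
by congr (cmod _ <= _); ring.
Qed.

End T2.

Section MaximumPrinciple.
Context {R : realType}.
Implicit Types (g : R[i] -> R[i]) (z w s : R[i]).

(** The four points are h times the fourth roots of unity, over which s, s^2 and |s|^2 s sum to
    zero. All cross terms cancel and the excess is 4 |B|^2 h^2 + 4 |D|^2 h^4: a discrete mean value
    inequality for |p|^2. *)
Lemma four_point_average (A B D : R[i]) (h : R) (p : R[i] -> R[i]) :
  (forall s, p s = A + B * s + D * s ^+ 2) ->
  4 * cmod A ^+ 2 <= cmod (p (h +i* 0)) ^+ 2 + cmod (p (- h +i* 0)) ^+ 2 +
    cmod (p (0 +i* h)) ^+ 2 + cmod (p (0 +i* - h)) ^+ 2.
Proof.
move=> pE; rewrite !pE !cmod_sqr {p pE}.
case: A => a a'; case: B => b b'; case: D => d d'; rewrite !expr2 /=.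
rewrite -subr_ge0.
set X := (X in 0 <= X).
suff -> : X = 4 * (b ^+ 2 + b' ^+ 2) * h ^+ 2 + 4 * (d ^+ 2 + d' ^+ 2) * h ^+ 4.
  have h4 : 0 <= h ^+ 4 by rewrite exprn_even_ge0.
  have h2 : 0 <= h ^+ 2 by exact: sqr_ge0.
  have hb : 0 <= b ^+ 2 + b' ^+ 2 by rewrite addr_ge0 ?sqr_ge0.
  have hd : 0 <= d ^+ 2 + d' ^+ 2 by rewrite addr_ge0 ?sqr_ge0.
  by rewrite addr_ge0// mulr_ge0// mulr_ge0.
by rewrite /X; ring.
Qed.

(** Averaging over four points at distance h, the term e |w|^2 gains exactly e h^2, while replacing
    g by its expansion loses O(h^3). For small h the average exceeds the value at the centre. *)
Lemma taylor2_no_strict_max g w (e : R) : 0 < e -> taylor2 g w ->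
  ~ (exists2 d : R, 0 < d & forall s, cmod s <= d ->
      cmod (g (w + s)) ^+ 2 + e * cmod (w + s) ^+ 2 <=
      cmod (g w) ^+ 2 + e * cmod w ^+ 2).
Proof.
move=> e0 [A [B [D H]]] [d d0 hd].
have AE := taylor2_val H.
have [K [d' [K0 d0' hK]]] := H.
pose M := cmod A + cmod B + cmod D.
have M0 : 0 <= M by rewrite !addr_ge0 ?cmod_ge0.
(* The loss at each point is at most 2 K M h^3; the last bound on h makes it smaller than e h^2. *)
pose h := Num.min (Num.min d d') (Num.min 1 (e / (2 * (K * M) + 1))).
have KM0 : 0 < 2 * (K * M) + 1 by rewrite ltr_wpDl// !mulr_ge0.
have h0 : 0 < h by rewrite !lt_min d0 d0' ltr01 divr_gt0.
have [hd1 hd2 h1 h2] : [/\ h <= d, h <= d', h <= 1 & h <= e / (2 * (K * M) + 1)].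
  by split; rewrite /h !ge_min lexx ?orbT.
pose p s := A + B * s + D * s ^+ 2.
have lowP s : cmod s = h ->
    cmod (p s) ^+ 2 - 2 * (K * M) * h ^+ 3 <= cmod (g (w + s)) ^+ 2.
  move=> sh; have := hK s; rewrite sh => /(_ hd2); rewrite -/(p s) => hh.
  have pM : cmod (p s) <= M.
    rewrite (le_trans (cmodD _ _))// lerD//.
      rewrite (le_trans (cmodD _ _))// lerD// cmodM sh.
      by rewrite ler_piMr ?cmod_ge0.
    by rewrite cmodM cmodX sh ler_piMr ?cmod_ge0// exprn_ile1 ?(ltW h0).
  have gp : cmod (p s) - K * h ^+ 3 <= cmod (g (w + s)).
    rewrite lerBlDr -[X in cmod X <= _](subrK (g (w + s))).
    by rewrite (le_trans (cmodD _ _))// addrC lerD// cmod_distC.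
  (* When p is smaller than the remainder, squaring the lower bound for g is not allowed, but then
     the left-hand side is already nonpositive. *)
  have [pK|pK] := leP (K * h ^+ 3) (cmod (p s)).
    apply: (@le_trans _ _ ((cmod (p s) - K * h ^+ 3) ^+ 2)); last first.
      by apply: lerXn2r; rewrite ?nnegrE ?cmod_ge0 ?subr_ge0.
    have : 0 <= (K * h ^+ 3) ^+ 2 by rewrite sqr_ge0.
    have : 2 * (cmod (p s) * (K * h ^+ 3)) <= 2 * (M * (K * h ^+ 3)).
      by rewrite ler_wpM2l// ler_wpM2r// mulr_ge0// exprn_ge0// ltW.
    by move=> ? ?; rewrite sqrrB; lra.
  apply: (@le_trans _ _ 0); last exact: sqr_ge0.
  rewrite subr_le0 expr2 (@le_trans _ _ (M * (K * h ^+ 3)))//.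
    by rewrite ler_pM ?cmod_ge0// ltW.
  have : 0 <= M * (K * h ^+ 3) by do 2 rewrite mulr_ge0//; exact: exprn_ge0 (ltW h0).
  by lra.
have c1 : cmod (h +i* 0) = h by rewrite cmodE/= expr0n/= addr0 sqrtr_sqr gtr0_norm.
have c2 : cmod (- h +i* 0) = h by rewrite cmodE/= expr0n/= addr0 sqrtr_sqr normrN gtr0_norm.
have c3 : cmod (0 +i* h) = h by rewrite cmodE/= expr0n/= add0r sqrtr_sqr gtr0_norm.
have c4 : cmod (0 +i* - h) = h by rewrite cmodE/= expr0n/= add0r sqrtr_sqr normrN gtr0_norm.
have := @four_point_average A B D h p (fun=> erefl); rewrite AE => avg.
have := lowP _ c1; have := lowP _ c2; have := lowP _ c3; have := lowP _ c4.
have := hd (h +i* 0); have := hd (- h +i* 0); have := hd (0 +i* h); have := hd (0 +i* - h).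
rewrite c1 c2 c3 c4 => /(_ hd1) u4 /(_ hd1) u3 /(_ hd1) u2 /(_ hd1) u1 l4 l3 l2 l1.
have wavg : cmod (w + (h +i* 0)) ^+ 2 + cmod (w + (- h +i* 0)) ^+ 2 +
   cmod (w + (0 +i* h)) ^+ 2 + cmod (w + (0 +i* - h)) ^+ 2 = 4 * cmod w ^+ 2 + 4 * h ^+ 2.
  by rewrite !cmod_sqr; case: (w) => a b /=; ring.
have : 4 * e * h ^+ 2 <= 4 * (2 * (K * M) * h ^+ 3).
  have : e * (cmod (w + (h +i* 0)) ^+ 2 + cmod (w + (- h +i* 0)) ^+ 2 +
   cmod (w + (0 +i* h)) ^+ 2 + cmod (w + (0 +i* - h)) ^+ 2) = e * (4 * cmod w ^+ 2 + 4 * h ^+ 2).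
    by rewrite wavg.
  by clearbody M; move=> ew; lra.
have -> : 4 * (2 * (K * M) * h ^+ 3) = 4 * (2 * (K * M) * h) * h ^+ 2 by ring.
rewrite ler_pM2r ?exprn_gt0// ler_pM2l// => eh.
have : h * (2 * (K * M) + 1) <= e by rewrite -ler_pdivlMr.
by rewrite mulrDr mulr1 => ?; lra.
Qed.

Definition rect (a b c d : R) : set (R * R) := `[a, b] `*` `[c, d].

(* Adding [e |w|^2] makes [|g|^2] strictly subharmonic, so its maximum over the rectangle
   cannot be interior. *)
Lemma maximum_principle g (a b c d M : R) : 0 <= M ->
  (forall w, taylor2 g w) ->
  (forall x y, a <= x <= b -> c <= y <= d ->
     x = a \/ x = b \/ y = c \/ y = d -> cmod (g (x +i* y)) <= M) ->
  forall x y, a <= x <= b -> c <= y <= d -> cmod (g (x +i* y)) <= M.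
Proof.
move=> M0 Tg bd x0 y0 x0ab y0cd; rewrite leNgt; apply/negP => Mg.
(* Q bounds |w|^2 on the rectangle, and e Q is half of the supposed excess of |g|^2 over M^2. Hence
   |g| > M still holds at a maximum of u, which keeps that maximum off the boundary. *)
pose Q := 1 + (`|a| + `|b|) ^+ 2 + (`|c| + `|d|) ^+ 2.
have Q0 : 0 < Q by rewrite /Q -addrA ltr_wpDr// addr_ge0 ?sqr_ge0.
pose e := (cmod (g (x0 +i* y0)) ^+ 2 - M ^+ 2) / (2 * Q).
have e0 : 0 < e.
  by rewrite divr_gt0 ?mulr_gt0// subr_gt0 ltr_pXn2r ?nnegrE ?cmod_ge0.
pose u (p : R * R) : R := cmod (g (p.1 +i* p.2)) ^+ 2 + e * cmod (p.1 +i* p.2) ^+ 2.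
have cg : continuous (fun p : R * R => cmod (g (p.1 +i* p.2))).
  move=> [x y]; apply/cvgrPdist_le => /= eps eps0.
  have [K [dd [K0 dd0 h]]] := taylor2_bound (Tg (x +i* y)).
  pose r := Num.min dd (eps / (K + 1)).
  have r0 : 0 < r by rewrite lt_min dd0 divr_gt0// ltr_wpDl.
  exists (ball x (r / 2), ball y (r / 2)) => /=.
    by split; apply: nbhsx_ballx; rewrite divr_gt0.
  move=> [x' y'] [] /=; rewrite /ball/= => xx yy.
  have -> : x' +i* y' = x +i* y + ((x' - x) +i* (y' - y)).
    by apply: complex_ext => /=; ring.
  set s := (x' - x) +i* (y' - y).
  have sr : cmod s <= r.
    rewrite (le_trans (cmod_le_ReIm _))//= (splitr r) lerD// ltW// distrC//.
  have := h s; rewrite (le_trans sr) ?ge_min ?lexx// => /(_ isT) hs.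
  apply: (@le_trans _ _ (cmod (g (x +i* y + s) - g (x +i* y)))).
    rewrite ler_norml; apply/andP; split.
      rewrite lerNl opprB lerBlDr -[X in cmod X <= _](subrK (g (x +i* y))).
      by rewrite (le_trans (cmodD _ _)).
    rewrite lerBlDr cmod_distC -[X in cmod X <= _](subrK (g (x +i* y + s))).
    by rewrite (le_trans (cmodD _ _)).
  rewrite (le_trans hs)// (@le_trans _ _ ((K + 1) * (eps / (K + 1))))//.
    rewrite ler_pM ?cmod_ge0// ?lerDl// (le_trans sr)// ge_min lexx orbT//.
  by rewrite mulrCA divff ?mulr1// gt_eqF// ltr_wpDl.
have cu : continuous u.
  move=> p; apply: cvgD.
    by rewrite expr2; under eq_fun do rewrite expr2; apply: cvgM; exact: cg.
  apply: cvgMr; rewrite [X in X @ _ --> _](_ : _ = (fun q : R * R => q.1 * q.1 + q.2 * q.2)); last first.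
    by apply/funext => q; rewrite cmod_sqr !expr2.
  rewrite cmod_sqr !expr2/=.
  by apply: cvgD; apply: cvgM; (exact: cvg_fst || exact: cvg_snd).
have [|||[x y] pin pmax] := @compact_EVT_max _ _ u (rect a b c d).
- by exists (x0, y0); rewrite /rect/= !in_itv.
- by apply: compact_setX; exact: segment_compact.
- exact: continuous_subspaceT.
have {}pin : a <= x <= b /\ c <= y <= d by move: pin; rewrite inE /rect/= !in_itv.
have {}pmax x' y' : a <= x' <= b -> c <= y' <= d -> u (x', y') <= u (x, y).
  by move=> h1 h2; apply: pmax; rewrite inE /rect/= !in_itv.
have sQ x' y' : a <= x' <= b -> c <= y' <= d -> cmod (x' +i* y') ^+ 2 <= Q.
  have aux (p q r : R) : p <= r <= q -> r ^+ 2 <= (`|p| + `|q|) ^+ 2.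
    move=> /andP[pr rq]; rewrite -[r ^+ 2]real_normK ?num_real//.
    apply: lerXn2r; rewrite ?nnegrE ?addr_ge0// ler_norml.
    have := ler_norm p; have := ler_norm (- p); have := ler_norm q; have := normr_ge0 q.
    have := normr_ge0 p.
    by rewrite normrN => ? ? ? ? ?; apply/andP; split; lra.
  move=> /aux h1 /aux h2; rewrite cmod_sqr /Q/=; lra.
have [xab ycd] := pin.
have gM : M < cmod (g (x +i* y)).
  have h := pmax _ _ x0ab y0cd.
  have h1 : e * cmod (x +i* y) ^+ 2 <= e * Q by rewrite ler_wpM2l ?sQ// ltW.
  have h2 : e * Q = (cmod (g (x0 +i* y0)) ^+ 2 - M ^+ 2) / 2.
    by rewrite /e; field; rewrite gt_eqF.
  have h3 : 0 <= e * cmod (x0 +i* y0) ^+ 2 by rewrite mulr_ge0 ?sqr_ge0// ltW.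
  have h4 : M ^+ 2 < cmod (g (x0 +i* y0)) ^+ 2 by rewrite ltr_pXn2r ?nnegrE ?cmod_ge0.
  rewrite -(@ltr_pXn2r _ 2) ?nnegrE ?cmod_ge0//.
  have {}h : cmod (g (x0 +i* y0)) ^+ 2 + e * cmod (x0 +i* y0) ^+ 2 <=
    cmod (g (x +i* y)) ^+ 2 + e * cmod (x +i* y) ^+ 2 by exact: h.
  lra.
have nb : ~ (x = a \/ x = b \/ y = c \/ y = d).
  by move=> /(bd x y xab ycd); rewrite leNgt gM.
have [ax xb cy yd] : [/\ a < x, x < b, c < y & y < d].
  move: xab ycd => /andP[] + + /andP[]; rewrite !le_eqVlt.
  move=> /orP[/eqP E|ax]; first by case: nb; left.
  move=> /orP[/eqP E|xb]; first by case: nb; right; left.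
  move=> /orP[/eqP E|cy]; first by case: nb; do 2 right; left.
  by move=> /orP[/eqP E|yd]; first by case: nb; do 3 right.
apply: (taylor2_no_strict_max e0 (Tg (x +i* y))).
exists (Num.min (Num.min (x - a) (b - x)) (Num.min (y - c) (d - y))).
  by rewrite !lt_min !subr_gt0 ax xb cy yd.
move=> [sx sy]; rewrite !le_min => /andP[/andP[sxa sxb] /andP[syc syd]].
have : `|sx| <= cmod (sx +i* sy) by exact: (Re_le_cmod (sx +i* sy)).
have : `|sy| <= cmod (sx +i* sy) by exact: (Im_le_cmod (sx +i* sy)).
rewrite !ler_norml => /andP[? ?] /andP[? ?].
by apply: (pmax (x + sx) (y + sy)); apply/andP; split; lra.
Qed.

End MaximumPrinciple.

(** * Entire functions *)

Section CexpTaylor.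
Context {R : realType}.

(** By the mean value theorem a bound of order k on f' gives one of order k + 1 on f, with the same
    constant. Three uses give each cubic remainder below. *)
Lemma derive_bound_power (f f' : R -> R) (K : R) (k : nat) : 0 <= K ->
  (forall t : R, is_derive t 1 f (f' t)) -> f 0 = 0 ->
  (forall t, `|t| <= 1 -> `|f' t| <= K * `|t| ^+ k) ->
  forall t, `|t| <= 1 -> `|f t| <= K * `|t| ^+ k.+1.
Proof.
move=> K0 df f0 hf' t t1.
have cf : continuous f.
  by move=> x; apply/differentiable_continuous/derivable1_diffP; case: (df x).
have key c : `|c| <= `|t| -> f t = f' c * t -> `|f t| <= K * `|t| ^+ k.+1.
  move=> ct ->; rewrite normrM exprSr mulrA ler_wpM2r//.
  rewrite (le_trans (hf' _ (le_trans ct t1)))// ler_wpM2l//.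
  by apply: lerXn2r; rewrite ?nnegrE.
have [t0|t0] := leP 0 t.
  have [|c cin] := MVT_segment t0 (fun x _ => df x).
    exact: continuous_subspaceT.
  rewrite f0 !subr0; apply: key; move: cin; rewrite in_itv/= => /andP[c0 ct].
  by rewrite !ger0_norm.
have [|c cin] := MVT_segment (ltW t0) (fun x _ => df x).
  exact: continuous_subspaceT.
rewrite f0 !sub0r mulrN => /oppr_inj.
apply: key; move: cin; rewrite in_itv/= => /andP[tc c0].
by rewrite !ler0_norm// ?lerN2// ltW.
Qed.

Lemma expR_taylor (t : R) : `|t| <= 1 ->
  `|expR t - (1 + t + t ^+ 2 / 2)| <= expR 1 * `|t| ^+ 3.
Proof.
apply: (@derive_bound_power (fun t => expR t - (1 + t + t ^+ 2 / 2)) (fun t => expR t - (1 + t))).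
- exact: expR_ge0.
- by move=> x; apply: is_derive_eq; rewrite /GRing.scale/=; field.
- by rewrite expR0; ring.
apply: (@derive_bound_power (fun t => expR t - (1 + t)) (fun t => expR t - 1)).
- exact: expR_ge0.
- by move=> x; apply: is_derive_eq; rewrite /GRing.scale/=; field.
- by rewrite expR0; ring.
apply: (@derive_bound_power (fun t => expR t - 1) (fun t => expR t)).
- exact: expR_ge0.
- by move=> x; apply: is_derive_eq; rewrite /GRing.scale/=; field.
- by rewrite expR0; ring.
move=> x x1; rewrite expr0 mulr1 ger0_norm ?expR_ge0// ler_expR.
by rewrite (le_trans (ler_norm _)).
Qed.

Lemma cos_taylor (t : R) : `|t| <= 1 ->
  `|cos t - (1 - t ^+ 2 / 2)| <= 1 * `|t| ^+ 3.
Proof.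
apply: (@derive_bound_power (fun t => cos t - (1 - t ^+ 2 / 2)) (fun t => - sin t + t)) ; first exact: ler01.
- by move=> x; apply: is_derive_eq; rewrite /GRing.scale/=; field.
- by rewrite cos0; ring.
apply: (@derive_bound_power (fun t => - sin t + t) (fun t => - cos t + 1)) ; first exact: ler01.
- by rewrite sin0; ring.
apply: (@derive_bound_power (fun t => - cos t + 1) (fun t => sin t)) ; first exact: ler01.
- by move=> x; apply: is_derive_eq; rewrite /GRing.scale/=; field.
- by rewrite cos0; ring.
by move=> x x1; rewrite expr0 mulr1 sin_max.
Qed.

Lemma sin_taylor (t : R) : `|t| <= 1 -> `|sin t - t| <= 1 * `|t| ^+ 3.
Proof.
apply: (@derive_bound_power (fun t => sin t - t) (fun t => cos t - 1)) ; first exact: ler01.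
- by rewrite sin0; ring.
apply: (@derive_bound_power (fun t => cos t - 1) (fun t => - sin t)) ; first exact: ler01.
- by move=> x; apply: is_derive_eq; rewrite /GRing.scale/=; field.
- by rewrite cos0; ring.
apply: (@derive_bound_power (fun t => - sin t) (fun t => - cos t)) ; first exact: ler01.
- by rewrite sin0; ring.
by move=> x x1; rewrite expr0 mulr1 normrN cos_max.
Qed.

Lemma isO_Re (h : R -> R) (K : R) k : 0 <= K ->
  (forall t, `|t| <= 1 -> `|h t| <= K * `|t| ^+ k) ->
  isO k (fun s : R[i] => (h (complex.Re s))%:C).
Proof.
move=> K0 hh; exists K, 1; split => // s s1.
have rs := Re_le_cmod s; rewrite cmod_real (le_trans (hh _ (le_trans rs s1)))//.
by rewrite ler_wpM2l//; apply: lerXn2r; rewrite ?nnegrE ?cmod_ge0.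
Qed.

Lemma isO_Im (h : R -> R) (K : R) k : 0 <= K ->
  (forall t, `|t| <= 1 -> `|h t| <= K * `|t| ^+ k) ->
  isO k (fun s : R[i] => (h (complex.Im s))%:C).
Proof.
move=> K0 hh; exists K, 1; split => // s s1.
have rs := Im_le_cmod s; rewrite cmod_real (le_trans (hh _ (le_trans rs s1)))//.
by rewrite ler_wpM2l//; apply: lerXn2r; rewrite ?nnegrE ?cmod_ge0.
Qed.

Lemma taylor2_cexp0 : isO 3 (fun s : R[i] => cexp s - (1 + s + s ^+ 2 / 2)).
Proof.
have hx : isO 1 (fun s : R[i] => (complex.Re s)%:C).
  by apply: (@isO_Re id 1) => // t _; rewrite mul1r.
have hy : isO 1 (fun s : R[i] => (complex.Im s)%:C).
  by apply: (@isO_Im id 1) => // t _; rewrite mul1r.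
have he := isO_Re (expR_ge0 1) expR_taylor.
have hc := isO_Im ler01 cos_taylor.
have hs := isO_Im ler01 sin_taylor.
have c (a : R[i]) : isO 0 (fun=> a).
  by apply: isO_ext (isO_mono a (leqnn 0)) => s; rewrite mulr1.
have ht := isOD hc (isOM (c 'i) hs).
have w1 j (f : R[i] -> R[i]) := @isO_weak R j.+1 0 f isT.
have hxx := isOM hx hx; have hyy := isOM hy hy.
have hp : isO 0 (fun s : R[i] => 1 + (complex.Re s)%:C + ((complex.Re s)%:C * (complex.Re s)%:C) * (1 / 2)).
  exact: isOD (isOD (c 1) (w1 _ _ hx)) (isOM (w1 _ _ hxx) (c (1 / 2))).
have hq : isO 0 (fun s : R[i] => 1 + (complex.Im s)%:C * 'i + ((complex.Im s)%:C * (complex.Im s)%:C) * (- 1 / 2)).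
  exact: isOD (isOD (c 1) (isOM (w1 _ _ hy) (c 'i))) (isOM (w1 _ _ hyy) (c (- 1 / 2))).
(* [cexp] is the product of the expansions p + he of the real exponential and q + ht of cos + i sin.
   The first three terms contain a remainder; the last three are what p q has beyond 1 + s + s^2 /
   2. *)
have k1 := isOM hp ht.
have k2 := isOM hq he.
have k3 := isOM (w1 _ _ he) ht.
have k4 := isOM (isOM hx hyy) (c (- 1 / 2)).
have k5 := isOM (isOM hxx hy) (c ('i / 2)).
have k6 := isO_weak (isT : 3 <= 4)%N (isOM (isOM hxx hyy) (c (- 1 / 4))).
apply: isO_ext (isOD (isOD (isOD (isOD (isOD k1 k2) k3) k4) k5) k6) => -[x y].
by apply: complex_ext; rewrite /cexp /expi /=; field.
Qed.

Lemma taylor2_cexp (w : R[i]) : taylor2 cexp w.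
Proof.
exists (cexp w), (cexp w), (cexp w / 2).
apply: isO_ext (isOM (isO_mono (cexp w) (leqnn 0)) taylor2_cexp0) => s /=.
by rewrite cexpD; field.
Qed.

End CexpTaylor.

Section PowerSeries.
Context {R : realType}.
Implicit Types (a : nat -> R[i]) (z w s : R[i]).

Definition psum a (N : nat) z : R[i] := \sum_(n < N) a n * z ^+ n.

(** An infinite radius of convergence, without any limit superior. *)
Definition entire_coeffs a : Prop :=
  forall r : R, 0 <= r -> exists K : R, forall n, cmod (a n) * r ^+ n <= K.

Lemma sum_geometric_le (t : R) N : 0 <= t -> t < 1 ->
  \sum_(n < N) t ^+ n <= (1 - t)^-1.
Proof.
move=> t0 t1; rewrite -[leRHS]mul1r ler_pdivlMr ?subr_gt0//.
have := subrX1 t N => /eqP; rewrite -eqr_opp opprB -mulNr opprB => /eqP h.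
by rewrite mulrC -h lerBlDr lerDl exprn_ge0.
Qed.

Lemma ccvg_series_geometric (u : nat -> R[i]) (K t : R) : 0 <= t -> t < 1 ->
  (forall n, cmod (u n) <= K * t ^+ n) ->
  exists l, ccvg (fun N => \sum_(n < N) u n) l.
Proof.
move=> t0 t1 ub.
have K0 : 0 <= K by have := ub 0%N; rewrite expr0 mulr1; apply: le_trans (cmod_ge0 _).
have aux (v : R^nat) : (forall n, `|v n| <= cmod (u n)) -> cvgn (series v).
  move=> vu; apply: normed_cvg.
  apply: (@series_le_cvg _ _ (geometric K t)).
  - by move=> n; exact: normr_ge0.
  - by move=> n; rewrite /geometric/= mulr_ge0 ?exprn_ge0.
  - by move=> n; rewrite /geometric/= (le_trans (vu n)).
  - by apply: is_cvg_geometric_series; rewrite ger0_norm.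
have cR := aux (fun n => complex.Re (u n)) (fun n => Re_le_cmod _).
have cI := aux (fun n => complex.Im (u n)) (fun n => Im_le_cmod _).
exists (limn (series (fun n => complex.Re (u n))) +i* limn (series (fun n => complex.Im (u n)))).
apply: ccvg_ReIm => /=.
  rewrite [X in X @ _ --> _](_ : _ = series (fun n => complex.Re (u n)))//.
  apply/funext => N; rewrite /series/= big_mkord.
  by elim/big_ind2 : _ => // x1 x2 y1 y2 <- <-; rewrite ReD.
rewrite [X in X @ _ --> _](_ : _ = series (fun n => complex.Im (u n)))//.
apply/funext => N; rewrite /series/= big_mkord.
by elim/big_ind2 : _ => // x1 x2 y1 y2 <- <-; rewrite ImD.
Qed.

(** The bound at radius 2 r yields ratio 1/2 at radius r. *)
Lemma entire_coeffs_geometric a r : entire_coeffs a -> 0 <= r ->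
  exists2 K, 0 <= K & forall n, cmod (a n) * r ^+ n <= K * 2^-1 ^+ n.
Proof.
move=> ea r0; have [|K hK] := ea (2 * r); first by rewrite mulr_ge0.
have K0 : 0 <= K by have := hK 0%N; apply: le_trans; rewrite expr0 mulr1 cmod_ge0.
exists K => // n; rewrite exprVn ler_pdivlMr ?exprn_gt0//.
by rewrite -mulrA -exprMn (mulrC r).
Qed.

Lemma ccvg_entire_coeffs a (F : R[i] -> R[i]) :
  (forall z, ccvg (psum a ^~ z) (F z)) -> entire_coeffs a.
Proof.
move=> aF r r0; have [K K0 hK] := ccvg_bounded (aF r%:C).
exists (K + K) => n.
have -> : cmod (a n) * r ^+ n = cmod (psum a n.+1 r%:C - psum a n r%:C).
  by rewrite /psum big_ord_recr/= addrAC subrr add0r cmodM cmodX cmod_pos.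
by rewrite (le_trans (cmodB _ _))// lerD.
Qed.

(** These are n z^(n-1) and binomial(n, 2) z^(n-2), the coefficients of s and s^2 in (z + s)^n. The
    recursion comes from (z + s)^(n+1) = (z + s) (z + s)^n and avoids truncated exponents. *)
Fixpoint dpow1 z n : R[i] := if n is m.+1 then z * dpow1 z m + z ^+ m else 0.
Fixpoint dpow2 z n : R[i] := if n is m.+1 then z * dpow2 z m + dpow1 z m else 0.

Lemma dpow1_bound z n : cmod (dpow1 z n) <= (cmod z + 1) ^+ n.
Proof.
elim: n => [|n IH]; first by rewrite (cmod0 : cmod 0 = 0) expr0.
have z0 := cmod_ge0 z.
rewrite [dpow1 _ _]/= (le_trans (cmodD _ _))// cmodM cmodX exprS mulrDl mul1r lerD//.
  by rewrite ler_wpM2l.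
by apply: lerXn2r; rewrite ?nnegrE ?addr_ge0// lerDl.
Qed.

Lemma dpow2_bound z n : cmod (dpow2 z n) <= (cmod z + 1) ^+ n.
Proof.
elim: n => [|n IH]; first by rewrite (cmod0 : cmod 0 = 0) expr0.
have z0 := cmod_ge0 z.
rewrite [dpow2 _ _]/= (le_trans (cmodD _ _))// cmodM exprS mulrDl mul1r lerD ?dpow1_bound//.
by rewrite ler_wpM2l.
Qed.

(** The remainder for n + 1 is (z + s) times the one for n, plus s^3 [dpow2] z n. The result is
    cubic in s and only geometric in n, hence summable against the coefficients of an entire
    series. *)
Lemma pow_taylor2 z s n : cmod s <= 1 ->
  cmod ((z + s) ^+ n - (z ^+ n + dpow1 z n * s + dpow2 z n * s ^+ 2)) <=
  cmod s ^+ 3 * (cmod z + 2) ^+ n.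
Proof.
move=> s1; have z0 := cmod_ge0 z; have s0 := cmod_ge0 s.
elim: n => [|n IH].
  by rewrite !expr0 !mul0r !addr0 subrr cmod0 mulr1 exprn_ge0.
rewrite [dpow1 _ _.+1]/= [dpow2 _ _.+1]/= [X in cmod X](_ : _ = (z + s) *
    ((z + s) ^+ n - (z ^+ n + dpow1 z n * s + dpow2 z n * s ^+ 2)) + s ^+ 3 * dpow2 z n); last first.
  by rewrite !exprS; ring.
rewrite (le_trans (cmodD _ _))// [cmod (s ^+ 3 * _)]cmodM cmodX cmodM.
have h1 : cmod (z + s) <= cmod z + 1 by rewrite (le_trans (cmodD _ _))// lerD2l.
have h2 : cmod (dpow2 z n) <= (cmod z + 2) ^+ n.
  rewrite (le_trans (dpow2_bound _ _))//.
  by apply: lerXn2r; rewrite ?nnegrE ?addr_ge0// lerD2l ler1n.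
have := ler_pM (cmod_ge0 _) (cmod_ge0 _) h1 IH.
have : cmod s ^+ 3 * cmod (dpow2 z n) <= cmod s ^+ 3 * (cmod z + 2) ^+ n.
  by rewrite ler_wpM2l ?exprn_ge0.
rewrite (exprS (cmod z + 2)); lra.
Qed.

(** Sums of entire power series satisfy the regularity that the maximum principle asks for: the
    expansions of the powers are summed term by term, with geometric convergence at radius |w| +
    2. *)
Lemma taylor2_psum a (F : R[i] -> R[i]) w :
  (forall z, ccvg (psum a ^~ z) (F z)) -> taylor2 F w.
Proof.
move=> aF; have ea := ccvg_entire_coeffs aF.
have w0 := cmod_ge0 w.
have [K K0 hK] := entire_coeffs_geometric ea (addr_ge0 w0 (ler0n _ 2)).
have half1 : (2^-1 : R) < 1 by rewrite invf_lt1// ltr1n.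
have hterm (b : nat -> R[i]) : (forall n, cmod (b n) <= (cmod w + 1) ^+ n) ->
    exists l, ccvg (fun N => \sum_(n < N) a n * b n) l.
  move=> hb; apply: (@ccvg_series_geometric (fun n => a n * b n) K 2^-1) => // n.
  rewrite (le_trans _ (hK n))// cmodM ler_wpM2l ?cmod_ge0// (le_trans (hb n))//.
  by apply: lerXn2r; rewrite ?nnegrE ?addr_ge0// lerD2l ler1n.
have [B hB] := hterm _ (dpow1_bound w).
have [D hD] := hterm _ (dpow2_bound w).
exists (F w), B, D, (2 * K), 1; split => //; first by rewrite mulr_ge0.
move=> s s1; have s0 := cmod_ge0 s.
apply: (@ccvg_le _ (fun N => \sum_(n < N) a n *
    ((w + s) ^+ n - (w ^+ n + dpow1 w n * s + dpow2 w n * s ^+ 2)))).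
  have -> : F (w + s) - (F w + B * s + D * s ^+ 2) =
    F (w + s) + -1 * (F w + s * B + s ^+ 2 * D) by ring.
  set u := fun N : nat => _.
  rewrite (_ : u = fun N => psum a N (w + s) + -1 * (psum a N w +
    s * \sum_(n < N) a n * dpow1 w n + s ^+ 2 * \sum_(n < N) a n * dpow2 w n)).
    exact: (ccvgD (aF (w + s)) (ccvgZ (-1) (ccvgD (ccvgD (aF w) (ccvgZ s hB))
      (ccvgZ (s ^+ 2) hD)))).
  apply/funext => N; rewrite /u /psum mulN1r !mulr_sumr -!big_split -sumrN -big_split/=.
  by apply: eq_bigr => n _; ring.
move=> N; rewrite (le_trans (cmod_sum _ _ _))//.
apply: (@le_trans _ _ (\sum_(n < N) (cmod s ^+ 3 * K) * 2^-1 ^+ n)).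
  apply: ler_sum => n _; rewrite cmodM.
  rewrite (le_trans (ler_wpM2l (cmod_ge0 _) (pow_taylor2 w n s1)))//.
  by rewrite mulrCA -mulrA ler_wpM2l ?exprn_ge0.
rewrite -mulr_sumr mulrC [leRHS](_ : _ = 2 * (cmod s ^+ 3 * K)); last by ring.
rewrite ler_wpM2r ?mulr_ge0 ?exprn_ge0// (le_trans (sum_geometric_le _ _ half1))//.
have -> : (1 - 2^-1 : R) = 2^-1 by field.
by rewrite invrK.
Qed.

Lemma psum_tail a (F : R[i] -> R[i]) z K N :
  ccvg (psum a ^~ z) (F z) ->
  (forall n, cmod (a n) * cmod z ^+ n <= K * 2^-1 ^+ n) ->
  cmod (psum a N z - F z) <= 2 * K * 2^-1 ^+ N.
Proof.
move=> aF hK.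
have K0 : 0 <= K.
  by have := hK 0%N; rewrite !expr0 !mulr1; apply: le_trans (cmod_ge0 _).
have half1 : (2^-1 : R) < 1 by rewrite invf_lt1// ltr1n.
have aFN : ccvg (fun M => psum a (N + M)%N z) (F z).
  have h := aF; rewrite /ccvg -(cvg_shiftn N) in h.
  by rewrite /ccvg; under eq_fun do rewrite addnC.
rewrite cmod_distC -mulN1r.
apply: (@ccvg_le _ (fun M => psum a (N + M)%N z + -1 * psum a N z)).
  exact: (ccvgD aFN (ccvgZ _ (ccvg_cst _))).
move=> M; rewrite /psum big_split_ord/= mulN1r addrAC subrr add0r.
rewrite (le_trans (cmod_sum _ _ _))//.
apply: (@le_trans _ _ (\sum_(n < M) (K * 2^-1 ^+ N) * 2^-1 ^+ n)).
  apply: ler_sum => n _; rewrite cmodM cmodX (le_trans (hK _))//.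
  by rewrite exprD mulrA.
rewrite -mulr_sumr mulrC [leRHS](_ : _ = 2 * (K * 2^-1 ^+ N)); last by rewrite mulrA.
rewrite ler_wpM2r ?mulr_ge0 ?exprn_ge0// (le_trans (sum_geometric_le _ _ half1))//.
have -> : (1 - 2^-1 : R) = 2^-1 by field.
by rewrite invrK.
Qed.

End PowerSeries.

(** * Cauchy's estimate by averaging over roots of unity *)

Section CauchyEstimate.
Context {R : realType}.
Implicit Types (a : nat -> R[i]) (z w s : R[i]).

Lemma expiX (x : R) n : expi x ^+ n = expi (n%:R * x).
Proof.
elim: n => [|n IH]; first by rewrite expr0 mul0r expi0.
by rewrite exprS IH -expiD; congr expi; rewrite -[n.+1%:R]natr1; ring.
Qed.

Lemma expi_2pi n : expi (2 * pi * n%:R : R) = 1.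
Proof.
elim: n => [|n IH]; first by rewrite mulr0 expi0.
rewrite -[n.+1%:R]natr1 mulrDr mulr1 expiD IH mul1r.
have -> : 2 * pi = pi *+ 2 :> R by rewrite mulr_natl.
by rewrite /expi cos2pi sin2pi.
Qed.

Lemma expi_neq1 (x : R) : 0 < x -> x < 2 * pi -> expi x != 1.
Proof.
move=> x0 x2; apply/eqP => /(congr1 (@complex.Re R)) /= c1.
have : 0 < sin (x / 2).
  by apply: sin_gt0_pi; rewrite divr_gt0//= ltr_pdivrMr// mulrC.
suff : sin (x / 2) = 0 by move=> ->; rewrite ltxx.
have : cos (x / 2 *+ 2) = 1 by rewrite -[_ *+ 2]mulr_natr divfK.
rewrite cos_mulr2n cos2sin2 => h; apply/eqP.
by rewrite -sqrf_eq0; apply/eqP; move: h; rewrite -mulr_natr; lra.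
Qed.

Lemma sum_roots_of_unity (N m n : nat) : (m < N)%N -> (n < N)%N ->
  \sum_(k < N) expi (2 * pi * (m%:R - n%:R) / N%:R) ^+ k =
  (if m == n then N%:R else 0) :> R[i].
Proof.
move=> mN nN; have N0 : 0 < N%:R :> R by rewrite ltr0n (leq_trans _ mN).
have [->|mn] := eqVneq m n.
  rewrite subrr mulr0 mul0r expi0; under eq_bigr do rewrite expr1n.
  by rewrite sumr_const card_ord.
set w := expi _.
have wN : w ^+ N = 1.
  rewrite expiX mulrC divfK ?gt_eqF//.
  have [nm|nm] := leqP n m; first by rewrite -natrB// expi_2pi.
  have := expi_2pi (n - m) => h; rewrite -[LHS]mulr1 -{1}h -expiD natrB ?(ltnW nm)//.
  by rewrite -[RHS](expi0); congr expi; ring.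
have w1 : w != 1.
  have [nm|nm] := ltnP n m.
    apply: expi_neq1.
      by rewrite divr_gt0// mulr_gt0 ?mulr_gt0 ?pi_gt0// subr_gt0 ltr_nat.
    rewrite ltr_pdivrMr// ltr_pM2l ?mulr_gt0 ?pi_gt0//.
    have : m%:R < N%:R :> R by rewrite ltr_nat.
    by have : 0 <= n%:R :> R by []; lra.
  have {mn}nm : (m < n)%N by rewrite ltn_neqAle mn nm.
  (* Here the angle of w is negative; w = 1 is excluded through its inverse, whose angle lies
     strictly between 0 and 2 pi. *)
  have h : expi (2 * pi * (n%:R - m%:R) / N%:R) != 1 :> R[i].
    apply: expi_neq1.
      by rewrite divr_gt0// mulr_gt0 ?mulr_gt0 ?pi_gt0// subr_gt0 ltr_nat.
    rewrite ltr_pdivrMr// ltr_pM2l ?mulr_gt0 ?pi_gt0//.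
    have : n%:R < N%:R :> R by rewrite ltr_nat.
    by have : 0 <= m%:R :> R by []; lra.
  apply: contra_neq h => we.
  by rewrite -[LHS]mulr1 -{1}we /w -expiD -[RHS]expi0; congr expi; ring.
have := subrX1 w N; rewrite wN subrr => /esym/eqP.
by rewrite mulf_eq0 subr_eq0 (negPf w1) => /eqP.
Qed.

(** A discrete Cauchy formula, exact for polynomials of degree below N: averaging P(r w) w^(-n) over
    the N-th roots of unity w isolates a_n r^n. *)
Lemma psum_coeff_bound a (N n : nat) (r M : R) : 0 <= r -> (n < N)%N ->
  (forall z, cmod z = r -> cmod (psum a N z) <= M) -> cmod (a n) * r ^+ n <= M.
Proof.
move=> r0 nN hM; have N0 : 0 < N%:R :> R by rewrite ltr0n (leq_trans _ nN).
pose th (k : nat) : R := 2 * pi / N%:R * k%:R.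
have E : N%:R * (a n * r%:C ^+ n) =
    \sum_(k < N) psum a N (r%:C * expi (th k)) * expi (- (n%:R * th k)).
  under eq_bigr do rewrite /psum mulr_suml.
  rewrite exchange_big/= [RHS](_ : _ = \sum_(m < N) a m * r%:C ^+ m *
      \sum_(k < N) expi (2 * pi * (m%:R - n%:R) / N%:R) ^+ k).
    under eq_bigr do rewrite sum_roots_of_unity//.
    rewrite (bigD1 (Ordinal nN))//= eqxx big1 ?addr0; first by rewrite mulrC.
    by move=> i /negPf; rewrite -val_eqE/= => ->; rewrite mulr0.
  apply: eq_bigr => m _; rewrite mulr_sumr; apply: eq_bigr => k _.
  rewrite exprMn -!mulrA; congr (_ * (_ * _)).
  by rewrite !expiX -expiD; congr expi; rewrite /th; ring.
have : cmod (N%:R * (a n * r%:C ^+ n)) <= N%:R * M.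
  rewrite E (le_trans (cmod_sum _ _ _))//.
  apply: (@le_trans _ _ (\sum_(k < N) M)); last first.
    by rewrite sumr_const card_ord mulr_natl.
  apply: ler_sum => k _; rewrite cmodM cmod_expi mulr1 hM//.
  by rewrite cmodM cmod_expi mulr1 cmod_pos.
rewrite !cmodM cmodX cmod_pos//.
have -> : cmod (N%:R : R[i]) = N%:R.
  by rewrite -(rmorph_nat (real_complex R)) cmod_pos.
by rewrite ler_pM2l.
Qed.

(** The discrete formula is applied to partial sums, which on the circle are within 2 K / 2^N of F;
    then N tends to infinity. *)
Lemma cauchy_estimate a (F : R[i] -> R[i]) (r M : R) n : 0 <= r ->
  (forall z, ccvg (psum a ^~ z) (F z)) ->
  (forall z, cmod z = r -> cmod (F z) <= M) -> cmod (a n) * r ^+ n <= M.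
Proof.
move=> r0 aF hM.
have [K K0 hK] := entire_coeffs_geometric (ccvg_entire_coeffs aF) r0.
have step N : (n < N)%N -> cmod (a n) * r ^+ n <= M + 2 * K * 2^-1 ^+ N.
  move=> nN; apply: (psum_coeff_bound r0 nN) => z zr.
  rewrite -[X in cmod X](subrK (F z)) (le_trans (cmodD _ _))// addrC lerD ?hM//.
  by apply: psum_tail => // m; rewrite zr.
have lim0 : (fun N => M + 2 * K * 2^-1 ^+ N) @ \oo --> M.
  rewrite -[X in _ --> X]addr0; apply: cvgD; first exact: cvg_cst.
  rewrite -[X in _ --> X](mulr0 (2 * K)); apply: cvgMr.
  by apply: cvg_expr; rewrite ger0_norm// invf_lt1// ltr1n.
rewrite -(cvg_lim _ lim0)//; apply: limr_ge; first by apply/cvg_ex; exists M.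
by exists n.+1 => // N /= nN; exact: step.
Qed.

(* Cauchy's estimate on the circle of radius [lam r] makes the bound for [F]
   survive, with a slightly worse exponent, for the series of moduli. *)
Lemma sum_cmod_gaussian a (F : R[i] -> R[i]) (C k lam : R) : 1 < lam ->
  (forall z, ccvg (psum a ^~ z) (F z)) ->
  (forall z, cmod (F z) <= C * expR (k * cmod z ^+ 2)) ->
  forall N z, \sum_(n < N) cmod (a n) * cmod z ^+ n <=
    C / (1 - lam^-1) * expR (k * lam ^+ 2 * cmod z ^+ 2).
Proof.
move=> lam1 aF hF N z; have lam0 : 0 < lam by rewrite (lt_trans _ lam1).
have z0 := cmod_ge0 z.
have C0 : 0 <= C.
  by have := le_trans (cmod_ge0 _) (hF 0); rewrite pmulr_lge0 ?expR_gt0.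
set E := expR _.
have hn n : cmod (a n) * cmod z ^+ n <= C * E * lam^-1 ^+ n.
  rewrite exprVn ler_pdivlMr ?exprn_gt0// -mulrA -exprMn mulrC.
  rewrite mulrC (mulrC (cmod z)).
  apply: (cauchy_estimate _ _ aF); first by rewrite mulr_ge0 ?(ltW lam0).
  move=> w wE; rewrite (le_trans (hF w))// wE /E exprMn mulrA//.
rewrite (le_trans (ler_sum _ (fun (n : 'I_N) _ => hn n)))//.
rewrite -mulr_sumr mulrAC ler_wpM2r ?expR_ge0// ler_wpM2l//.
by apply: sum_geometric_le; rewrite ?invr_ge0 ?(ltW lam0)// invf_lt1.
Qed.

End CauchyEstimate.

(** * The Phragmen-Lindelof principle in a sector *)

Section PhragmenLindelof.
Context {R : realType}.
Implicit Types (z w s : R[i]).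

(** Removes the damping factor of parameter e at the end of the argument. *)
Lemma le_of_le_mul_expR (A B X : R) : 0 <= B -> 0 < X ->
  (forall e, 0 < e -> A <= B * expR (e * X)) -> A <= B.
Proof.
move=> B0 X0 h; have lim0 : (fun n => B * expR (n.+1%:R^-1 * X)) @ \oo --> B.
  rewrite -[X in _ --> X]mulr1; apply: cvgMr.
  rewrite -[X in _ --> X]expR0; apply: continuous_cvg; first exact: continuous_expR.
  rewrite -[X in _ --> X](mul0r X); apply: cvgMl; exact: cvg_harmonic.
rewrite -(cvg_lim _ lim0)//; apply: limr_ge; first by apply/cvg_ex; exists B.
by apply: nearW => n; apply: h; rewrite invr_gt0.
Qed.

Variables (F : R[i] -> R[i]) (rho k C : R).
Hypotheses (rho0 : 0 < rho) (rho1 : rho < 1) (k0 : 0 < k) (C0 : 0 < C).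
Hypothesis TF : forall w, taylor2 F w.
Hypothesis F1 : forall u v : R,
  cmod (F (u +i* v)) <= C * expR (k * (rho ^+ 2 * u ^+ 2 + v ^+ 2)).
Hypothesis F2 : forall u v : R,
  cmod (F (u +i* v)) <= C * expR (k * (u ^+ 2 + rho ^+ 2 * v ^+ 2)).

(** The edges v = rho u and u = rho v have angles [th1] and [th2]; [del] is half the opening, around
    the axis pi/4. The exponent [beta] must exceed the growth order 2 and satisfy beta del < pi/2,
    so that the real part of the rotated power stays positive; the value chosen is the midpoint of 2
    and pi / (2 del). *)
Let th1 := atan rho.
Let th2 := pi / 2 - th1.
Let del := pi / 4 - th1.
Let beta := 1 + pi / (4 * del).

Let th1_gt0 : 0 < th1.
Proof. by rewrite /th1 -atan0; apply: lt_atan. Qed.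

Let th1_lt : th1 < pi / 4.
Proof. by rewrite /th1 -atan1; apply: lt_atan. Qed.

Let del_gt0 : 0 < del.
Proof. by rewrite subr_gt0. Qed.

Let beta_gt2 : 2 < beta.
Proof.
rewrite /beta -ltrBlDl (_ : 2 - 1 = 1); last by ring.
rewrite ltr_pdivlMr ?mulr_gt0// mul1r.
by have := th1_gt0; have := pi_gt0 R; rewrite /del; lra.
Qed.

Let betadel : beta * del < pi / 2.
Proof.
have -> : beta * del = del + pi / 4 by rewrite /beta; field; rewrite gt_eqF.
by have := th1_gt0; have := pi_gt0 R; rewrite /del; lra.
Qed.

Let c0 := cos (beta * del).

Let c0_gt0 : 0 < c0.
Proof.
apply: cos_gt0_pihalf; rewrite betadel andbT.
have b0 : 0 < beta by rewrite (lt_trans _ beta_gt2).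
have := mulr_gt0 b0 del_gt0; have := pi_gt0 R; lra.
Qed.

(** After the rotation centring the sector on its axis, the cosine is even and decreasing away from
    the axis, so it is least on the edges, where it equals [c0]. *)
Let cos_beta_ge (th : R) : th1 <= th <= th2 -> c0 <= cos (beta * (th - pi / 4)).
Proof.
move=> /andP[h1 h2]; have b0 : 0 < beta by rewrite (lt_trans _ beta_gt2).
rewrite -(cos_norm (beta * (th - pi / 4))) normrM (gtr0_norm b0) /c0.
have hd : `|th - pi / 4| <= del.
  by rewrite ler_norml; apply/andP; move: h1 h2; rewrite /th2 /del; split; lra.
have bd : beta * `|th - pi / 4| <= beta * del by rewrite ler_pM2l.
have p0 := pi_gt0 R; have := betadel => bp.
have b1 : 0 <= beta * `|th - pi / 4| by rewrite mulr_ge0// ltW.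
move: bd; rewrite le_eqVlt => /predU1P[->//|bd]; apply/ltW.
by rewrite ltr_cos// in_itv/=; apply/andP; split; lra.
Qed.

(* In the coordinate [w = log z] the sector becomes a strip and the fractional power
   [z ^ beta], with [2 < beta], which beats the growth of [F], becomes an exponential. *)
Let aux (e : R) (w : R[i]) : R[i] := F (cexp w) *
  cexp ((0 +i* (k * rho)) * cexp (2%:C * w)) *
  cexp ((- e)%:C * cexp (beta%:C * (w + (0 +i* - (pi / 4))))).

Let aux_taylor e w : taylor2 (aux e) w.
Proof.
have lin (c d : R[i]) x : taylor2 (fun z => c * (z + d)) x.
  by apply: taylor2M; [exact: taylor2_cst|apply: taylor2D; [exact: taylor2_id|exact: taylor2_cst]].
have lin0 (c : R[i]) x : taylor2 (fun z => c * z) x.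
  by apply: taylor2M; [exact: taylor2_cst|exact: taylor2_id].
apply: taylor2M; first apply: taylor2M.
- exact: (taylor2_comp (TF _) (taylor2_cexp _)).
- apply: (taylor2_comp (f := cexp) (taylor2_cexp _)).
  apply: taylor2M; first exact: taylor2_cst.
  exact: (taylor2_comp (f := cexp) (taylor2_cexp _)).
- apply: (taylor2_comp (f := cexp) (taylor2_cexp _)).
  apply: taylor2M; first exact: taylor2_cst.
  exact: (taylor2_comp (f := cexp) (taylor2_cexp _)).
Qed.

(** Since Re (i k rho z^2) = - 2 k rho u v, the second factor cancels exactly the bound available on
    each edge. *)
Let cmod_aux e (s th : R) : cmod (aux e (s +i* th)) =
  cmod (F ((expR s * cos th) +i* (expR s * sin th))) *
  expR (- (2 * k * rho * (expR s * cos th) * (expR s * sin th))) *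
  expR (- (e * (expR (beta * s) * cos (beta * (th - pi / 4))))).
Proof.
rewrite /aux 2!cmodM 2!cmod_cexp; congr (_ * _ * _).
- by congr (cmod (F _)); apply: complex_ext; rewrite /cexp/=; ring.
- congr expR; rewrite /cexp /= ?ReM ?ImM/=.
  rewrite !(mul0r, subr0, sub0r, addr0, add0r).
  have -> : expR (2 * s) = expR s * expR s by rewrite -expRD; congr expR; ring.
  have -> : sin (2 * th) = 2 * (cos th * sin th) by rewrite !mulr_natl sin_mulr2n.
  by ring.
- congr expR; rewrite /cexp /= ?ReM ?ImM/=.
  by rewrite !(mul0r, subr0, sub0r, addr0, add0r); ring.
Qed.

(** The maximum principle for [aux] on the rectangle [0, S] x [th1, th2] of the logarithm, then e
    tends to 0. The side s = 0 is the arc |z| = 1, where |F| is at most C e^k; this is the origin of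
    the factor [expR k]. *)
Let sector_bound_polar (s th : R) : 0 <= s -> th1 <= th <= th2 ->
  cmod (F ((expR s * cos th) +i* (expR s * sin th))) <=
  C * expR k * expR (2 * k * rho * (expR s * cos th) * (expR s * sin th)).
Proof.
move=> s0 hth; apply: (@le_of_le_mul_expR _ _ (expR (beta * s))).
- by rewrite mulr_ge0 ?expR_ge0// mulr_ge0 ?expR_ge0// ltW.
- exact: expR_gt0.
move=> e e0.
have cth : forall t, th1 <= t <= th2 -> 0 < cos t /\ 0 < sin t.
  move=> t /andP[h1 h2]; have p0 := pi_gt0 R; have t1 := th1_gt0; have t2 := th1_lt.
  split; first by apply: cos_gt0_pihalf; move: h2; rewrite /th2; lra.
  by apply: sin_gt0_pihalf; move: h2; rewrite /th2; lra.
have eta0 : 0 < beta - 2 by rewrite subr_gt0.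
(* S is large enough for the damping e c0 exp(beta S) to beat the growth k exp(2 S), by 1 + y <= exp
   y at y = (beta - 2) S; the maximum with s keeps the given point in the rectangle. *)
pose S := Num.max s (k / (e * c0 * (beta - 2))).
have S0 : 0 <= S by rewrite le_max s0.
have kS : k * expR (2 * S) <= e * (expR (beta * S) * c0).
  have -> : beta * S = 2 * S + (beta - 2) * S by ring.
  rewrite expRD -mulrA mulrCA (mulrC k) ler_pM2l ?expR_gt0//.
  have : k / (e * c0 * (beta - 2)) <= S by rewrite le_max lexx orbT.
  rewrite ler_pdivrMr ?mulr_gt0// => h; rewrite (le_trans h)//.
  have -> : S * (e * c0 * (beta - 2)) = (e * c0) * ((beta - 2) * S) by ring.
  have -> : e * (expR ((beta - 2) * S) * c0) = (e * c0) * expR ((beta - 2) * S) by ring.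
  rewrite ler_pM2l ?mulr_gt0//.
  by have := expR_ge1Dx ((beta - 2) * S); lra.
have bound (s' t : R) : 0 <= s' <= S -> th1 <= t <= th2 ->
    s' = 0 \/ s' = S \/ t = th1 \/ t = th2 -> cmod (aux e (s' +i* t)) <= C * expR k.
  move=> hs' ht hb; rewrite cmod_aux.
  have [ct st] := cth t ht.
  set u := expR s' * cos t; set v := expR s' * sin t.
  have u0 : 0 < u by rewrite mulr_gt0 ?expR_gt0.
  have v0 : 0 < v by rewrite mulr_gt0 ?expR_gt0.
  have uv2 : u ^+ 2 + v ^+ 2 = expR (2 * s').
    by rewrite /u /v !exprMn -mulrDr cos2Dsin2 mulr1 -expRM_natl.
  have E1 : expR (- (2 * k * rho * u * v)) <= 1.
    by rewrite -expR0 ler_expR oppr_le0 !mulr_ge0// ltW.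
  have cb := cos_beta_ge ht.
  have E2 : expR (- (e * (expR (beta * s') * cos (beta * (t - pi / 4))))) <= 1.
    rewrite -[leRHS]expR0 ler_expR oppr_le0; apply: mulr_ge0; first exact: ltW.
    apply: mulr_ge0; first exact: expR_ge0.
    exact: le_trans (ltW c0_gt0) cb.
  have Ck : C <= C * expR k.
    by rewrite ler_peMr ?(ltW C0)// -expR0 ler_expR ltW.
  have Fuv : cmod (F (u +i* v)) <= C * expR (k * (u ^+ 2 + v ^+ 2)).
    rewrite (le_trans (F1 _ _))// ler_pM2l// ler_expR ler_pM2l// lerD2r.
    rewrite ler_piMl ?sqr_ge0// expr_le1 ?ltW//.
  have three (X : R) : cmod (F (u +i* v)) * expR (- (2 * k * rho * u * v)) <= C ->
      X <= 1 -> cmod (F (u +i* v)) * expR (- (2 * k * rho * u * v)) * X <= C * expR k.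
    move=> h1 hX; rewrite (le_trans _ Ck)// (le_trans _ h1)//.
    by rewrite ler_piMr// mulr_ge0 ?cmod_ge0 ?expR_ge0.
  (* Inner arc: the crude bound on F. Outer arc: the damping factor. Lower edge: [F1], upper edge:
     [F2], each cancelled by the second factor. *)
  case: hb => [s'0|[s'S|[tE|tE]]].
  - have h1 : cmod (F (u +i* v)) <= C * expR k.
      by rewrite (le_trans Fuv)// uv2 s'0 mulr0 expR0 mulr1.
    rewrite -[leRHS]mulr1 ler_pM ?mulr_ge0 ?cmod_ge0 ?expR_ge0//.
    by rewrite -[leRHS]mulr1 ler_pM ?cmod_ge0 ?expR_ge0.
  - apply: le_trans Ck; rewrite mulrAC.
    apply: (@le_trans _ _ (cmod (F (u +i* v)) * expR (- (e * (expR (beta * s') * cos (beta * (t - pi / 4))))))).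
      by rewrite ler_piMr// mulr_ge0 ?cmod_ge0 ?expR_ge0.
    rewrite (le_trans (ler_wpM2r (expR_ge0 _) Fuv))// -mulrA -expRD.
    rewrite ler_piMr ?(ltW C0)// -[leRHS]expR0 ler_expR uv2 subr_le0 s'S.
    by rewrite (le_trans kS)// ler_pM2l// ler_pM2l ?expR_gt0//.
  - apply: three => //; rewrite (le_trans (ler_wpM2r (expR_ge0 _) (F1 u v)))//.
    have vu : v = rho * u.
      rewrite /v /u; have : sin t = rho * cos t.
        by rewrite -[rho]atanK /tan -/th1 tE divfK// -tE gt_eqF.
      by move=> ->; ring.
    rewrite -[leLHS]mulrA -expRD ler_piMr ?(ltW C0)// -[leRHS]expR0 ler_expR vu.
    by rewrite [leLHS](_ : _ = 0)//; ring.
  - apply: three => //; rewrite (le_trans (ler_wpM2r (expR_ge0 _) (F2 u v)))//.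
    have uv : u = rho * v.
      rewrite /v /u; have : cos t = rho * sin t.
        have c1 : cos th1 != 0.
          have := th1_gt0; have := th1_lt; have := pi_gt0 R => p0 t1 t2.
          by rewrite gt_eqF// cos_gt0_pihalf//; lra.
        have : sin th1 = rho * cos th1 by rewrite -[X in X * _]atanK /tan -/th1 divfK.
        rewrite tE /th2 addrC cosDpihalf sinDpihalf sinN cosN opprK//.
      by move=> ->; ring.
    rewrite -[leLHS]mulrA -expRD ler_piMr ?(ltW C0)// -[leRHS]expR0 ler_expR uv.
    by rewrite [leLHS](_ : _ = 0)//; ring.
have := @maximum_principle _ (aux e) 0 S th1 th2 (C * expR k) _ (aux_taylor e) bound s th.
rewrite s0 le_max lexx hth => /(_ _ isT isT).
rewrite mulr_ge0 ?expR_ge0 ?(ltW C0)// => /(_ isT).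
rewrite cmod_aux => h.
set u := expR s * cos th in h *; set v := expR s * sin th in h *.
set X := e * _ in h; set Y := 2 * k * rho * u * v in h *.
have Xle : X <= e * expR (beta * s).
  by rewrite ler_pM2l// ler_piMr ?expR_ge0// cos_le1.
rewrite -mulrA -expRD.
rewrite (le_trans (_ : _ <= C * expR k * expR (Y + X)))//.
  rewrite expRD mulrA -ler_pdivrMr ?expR_gt0// -ler_pdivrMr ?expR_gt0//.
  by rewrite -!expRN mulrAC.
by rewrite ler_pM2l ?mulr_gt0 ?expR_gt0// ler_expR lerD2l.
Qed.

(** Below the lower edge [F1] suffices, because the exponents differ by (1 - rho) (rho u^2 - v^2);
    above the upper edge [F2] does, by symmetry. Between the edges the unit disc is covered by the
    constant [expR k], and the rest by the polar bound together with 2 u v <= u^2 + v^2. *)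
Lemma sector_bound (u v : R) : 0 <= u -> 0 <= v ->
  cmod (F (u +i* v)) <= C * expR k * expR (k * rho * (u ^+ 2 + v ^+ 2)).
Proof.
move=> u0 v0.
have Ck : C <= C * expR k.
  by rewrite ler_peMr ?(ltW C0)// -expR0 ler_expR ltW.
have r2 : rho ^+ 2 <= rho by rewrite expr2 ler_piMl// ltW.
have low (a b : R) : 0 <= a -> 0 <= b -> b <= rho * a ->
    C * expR (k * (rho ^+ 2 * a ^+ 2 + b ^+ 2)) <=
    C * expR k * expR (k * rho * (a ^+ 2 + b ^+ 2)).
  move=> a0 b0 ba; rewrite ler_pM ?expR_ge0// ?(ltW C0)//.
  rewrite ler_expR -mulrA ler_pM2l// -subr_ge0.
  have h : b ^+ 2 <= (rho * a) ^+ 2.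
    by apply: lerXn2r; rewrite ?nnegrE ?mulr_ge0// ltW.
  have h2 : (rho * a) ^+ 2 <= rho * a ^+ 2 by rewrite exprMn ler_wpM2r ?sqr_ge0.
  have -> : rho * (a ^+ 2 + b ^+ 2) - (rho ^+ 2 * a ^+ 2 + b ^+ 2) =
    (1 - rho) * (rho * a ^+ 2 - b ^+ 2) by ring.
  by rewrite mulr_ge0// subr_ge0 ?(ltW rho1)// (le_trans h).
have [vu|vu] := leP v (rho * u).
  exact: le_trans (F1 _ _) (low _ _ u0 v0 vu).
have [uv|uv] := leP u (rho * v).
  rewrite (le_trans (F2 u v))// [u ^+ 2 + _]addrC [u ^+ 2 + v ^+ 2]addrC.
  exact: (low v u v0 u0 uv).
have {}v0 : 0 < v by rewrite (le_lt_trans _ vu)// mulr_ge0// ltW.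
have {}u0 : 0 < u by rewrite (lt_trans _ uv)// mulr_gt0.
pose r := Num.sqrt (u ^+ 2 + v ^+ 2).
have r2E : r ^+ 2 = u ^+ 2 + v ^+ 2 by rewrite sqr_sqrtr// addr_ge0 ?sqr_ge0.
have r0 : 0 < r by rewrite sqrtr_gt0 addr_gt0 ?exprn_gt0.
have [r1|r1] := leP r 1.
  apply: (@le_trans _ _ (C * expR k)); last first.
    rewrite ler_peMr ?mulr_ge0 ?expR_ge0 ?(ltW C0)// -expR0 ler_expR.
    by rewrite !mulr_ge0 ?addr_ge0 ?sqr_ge0 ?ltW.
  rewrite (le_trans (F1 _ _))// ler_pM2l// ler_expR -[leRHS]mulr1 ler_pM2l//.
  apply: (@le_trans _ _ (u ^+ 2 + v ^+ 2)).
    by rewrite lerD2r ler_piMl ?sqr_ge0// expr_le1 ?ltW.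
  by rewrite -r2E exprn_ile1// ltW.
pose th := atan (v / u).
have cth : expR (ln r) * cos th = u.
  rewrite lnK ?posrE// cos_atan.
  have -> : 1 + (v / u) ^+ 2 = (r / u) ^+ 2.
    by rewrite !expr_div_n r2E; field; rewrite gt_eqF.
  rewrite sqrtr_sqr gtr0_norm ?divr_gt0// invf_div mulrCA divff ?mulr1//.
  by rewrite gt_eqF.
have sth : expR (ln r) * sin th = v.
  have c1 : cos th != 0.
    by apply/eqP => c1; move: cth; rewrite c1 mulr0 => /eqP; rewrite lt_eqF.
  have : tan th = v / u by rewrite atanK.
  rewrite /tan => /(congr1 (fun x => x * cos th)); rewrite divfK// => ->.
  by rewrite mulrCA cth divfK// gt_eqF.
have thin : th1 <= th <= th2.
  apply/andP; split.
    by rewrite le_atan// ler_pdivlMr// ltW.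
  have -> : th2 = atan rho^-1.
    rewrite -[th2]tanK.
      congr atan; rewrite /tan /th2 addrC sinDpihalf cosDpihalf sinN cosN opprK.
      by rewrite -[in RHS](atanK rho) /tan -/th1 invf_div.
    rewrite in_itv/=; have := th1_gt0; have := th1_lt; have := pi_gt0 R.
    by rewrite /th2 => ? ? ?; apply/andP; split; lra.
  by rewrite le_atan// ler_pdivrMr// mulrC ler_pdivlMr// mulrC ltW.
have lr0 : 0 <= ln r by rewrite ln_ge0// ltW.
have := sector_bound_polar lr0 thin; rewrite cth sth => h.
rewrite (le_trans h)// ler_pM2l ?mulr_gt0 ?expR_gt0// ler_expR.
rewrite -subr_ge0 (_ : _ - _ = k * rho * (u - v) ^+ 2); last by ring.
by rewrite mulr_ge0 ?sqr_ge0// mulr_ge0// ltW.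
Qed.

End PhragmenLindelof.

(** The other quadrants are rotated onto the first one: a quarter turn exchanges the two hypotheses,
    a half turn preserves each. *)
Lemma phragmen_lindelof {R : realType} (F : R[i] -> R[i]) (rho k C : R) :
  0 < rho -> rho < 1 -> 0 < k -> 0 < C -> (forall w, taylor2 F w) ->
  (forall u v : R, cmod (F (u +i* v)) <= C * expR (k * (rho ^+ 2 * u ^+ 2 + v ^+ 2))) ->
  (forall u v : R, cmod (F (u +i* v)) <= C * expR (k * (u ^+ 2 + rho ^+ 2 * v ^+ 2))) ->
  forall z, cmod (F z) <= C * expR k * expR (k * rho * cmod z ^+ 2).
Proof.
move=> rho0 rho1 k0 C0 TF F1 F2 [u v]; rewrite cmod_sqr/=.
have Tm (c : R[i]) w : taylor2 (fun z => F (c * z)) w.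
  apply: (taylor2_comp (TF _)); apply: taylor2M.
    exact: taylor2_cst.
  exact: taylor2_id.
have [u0|u0] := leP 0 u; have [v0|v0] := leP 0 v.
- exact: (sector_bound rho0 rho1 k0 C0 TF F1 F2).
- have E a b : (- 'i%C * (a +i* b))%C = b +i* (- a) :> R[i].
    by apply: complex_ext => /=; ring.
  have := @sector_bound _ (fun z => F (- 'i%C * z)) rho k C rho0 rho1 k0 C0 (Tm _) _ _ (- v) u.
  rewrite E opprK sqrrN [v ^+ 2 + _]addrC oppr_ge0 (ltW v0) u0; apply => // a b.
    by rewrite E addrC -[a ^+ 2]sqrrN F2.
  by rewrite E addrC -[a ^+ 2]sqrrN F1.
- have E a b : ('i%C * (a +i* b))%C = (- b) +i* a :> R[i].
    by apply: complex_ext => /=; ring.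
  have := @sector_bound _ (fun z => F ('i%C * z)) rho k C rho0 rho1 k0 C0 (Tm _) _ _ v (- u).
  rewrite E opprK sqrrN [v ^+ 2 + _]addrC oppr_ge0 (ltW u0) v0; apply => // a b.
    by rewrite E addrC -[b ^+ 2]sqrrN F2.
  by rewrite E addrC -[b ^+ 2]sqrrN F1.
- have E a b : (-1 * (a +i* b))%C = (- a) +i* (- b) :> R[i].
    by apply: complex_ext => /=; ring.
  have := @sector_bound _ (fun z => F (-1 * z)) rho k C rho0 rho1 k0 C0 (Tm _) _ _ (- u) (- v).
  rewrite E !opprK !sqrrN !oppr_ge0 (ltW u0) (ltW v0); apply => // a b.
    by rewrite E -[a ^+ 2]sqrrN -[b ^+ 2]sqrrN F1.
  by rewrite E -[a ^+ 2]sqrrN -[b ^+ 2]sqrrN F2.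
Qed.

(** * Complex-valued integrals *)

Section ComplexMeasurable.
Context {R : realType} d (T : measurableType d).
Implicit Types (f g : T -> R[i]).

Definition cmeasurable f : Prop :=
  measurable_fun [set: T] (fun x => complex.Re (f x)) /\
  measurable_fun [set: T] (fun x => complex.Im (f x)).

Lemma cmeasurableD f g : cmeasurable f -> cmeasurable g ->
  cmeasurable (fun x => f x + g x).
Proof.
move=> [fR fI] [gR gI]; split.
  by under eq_fun do rewrite ReD; exact: measurable_funD.
by under eq_fun do rewrite ImD; exact: measurable_funD.
Qed.

Lemma cmeasurableM f g : cmeasurable f -> cmeasurable g ->
  cmeasurable (fun x => f x * g x).
Proof.
move=> [fR fI] [gR gI]; split.
  by under eq_fun do rewrite ReM; apply: measurable_funB; exact: measurable_funM.
by under eq_fun do rewrite ImM; apply: measurable_funD; exact: measurable_funM.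
Qed.

Lemma cmeasurable_cst (a : R[i]) : cmeasurable (fun=> a).
Proof. by split; exact: measurable_cst. Qed.

Lemma cmeasurable_sum (I : Type) (r : seq I) (f : I -> T -> R[i]) :
  (forall i, cmeasurable (f i)) -> cmeasurable (fun x => \sum_(i <- r) f i x).
Proof.
move=> mf; elim: r => [|i r IH].
  by under eq_fun do rewrite big_nil; exact: cmeasurable_cst.
by under eq_fun do rewrite big_cons; exact: cmeasurableD.
Qed.

Lemma measurable_cmod f : cmeasurable f -> measurable_fun [set: T] (fun x => cmod (f x)).
Proof.
move=> [fR fI]; under eq_fun do rewrite cmodE.
apply: (@measurableT_comp _ _ _ _ _ _ (@Num.sqrt R) _
  (fun x => complex.Re (f x) ^+ 2 + complex.Im (f x) ^+ 2)).
  by apply: continuous_measurable_fun; exact: sqrt_continuous.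
by apply: measurable_funD; exact: measurable_funX.
Qed.

End ComplexMeasurable.

Section RealIntegral.
Context {R : realType} d (T : measurableType d) (mu : {measure set T -> \bar R}).

Lemma ae_imply (P Q : T -> Prop) : {ae mu, forall x, P x} ->
  (forall x, P x -> Q x) -> {ae mu, forall x, Q x}.
Proof. by move=> hP PQ; apply: filterS hP. Qed.

Lemma integral_dominated (h g : T -> R) : measurable_fun [set: T] h ->
  (forall x, 0 <= g x) -> mu.-integrable [set: T] (EFin \o g) ->
  {ae mu, forall x, `|h x| <= g x} ->
  mu.-integrable [set: T] (EFin \o h) /\
  `|(\int[mu]_x h x)%R| <= (\int[mu]_x g x)%R.
Proof.
move=> mh g0 ig hg.
have mg := measurable_int mu ig.
have le : (\int[mu]_x `|(h x)%:E| <= \int[mu]_x (g x)%:E)%E.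
  apply: ae_ge0_le_integral => //.
  - by apply: measurableT_comp => //; exact/measurable_EFinP.
  - by move=> x _; rewrite lee_fin.
  - by apply: (ae_imply hg) => x hx _; rewrite lee_fin.
have gfin : (\int[mu]_x (g x)%:E < +oo)%E.
  have /integrableP[_] := ig; apply: le_lt_trans.
  rewrite le_eqVlt; apply/orP; left; apply/eqP; apply: eq_integral => x _ /=.
  by rewrite ger0_norm.
have ih : mu.-integrable [set: T] (EFin \o h).
  apply/integrableP; split; first exact/measurable_EFinP.
  exact: le_lt_trans le gfin.
split => //; rewrite -lee_fin EFin_normr_Rintegral//.
rewrite (le_trans (le_abse_integral _ _ _))//; first exact/measurable_EFinP.
rewrite (le_trans le)// /Rintegral fineK//.
by rewrite ge0_fin_numE// integral_ge0// => x _; rewrite lee_fin.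
Qed.

End RealIntegral.

Section ComplexIntegral.
Context {R : realType}.
Local Notation mu := (@lebesgue_measure R).
Implicit Types (f g : R -> R[i]).

Definition cintegrable f : Prop :=
  mu.-integrable [set: R] (EFin \o (fun x => complex.Re (f x))) /\
  mu.-integrable [set: R] (EFin \o (fun x => complex.Im (f x))).

(** Real and imaginary parts are bounded separately, whence the factor 2, which only enters
    multiplicative constants. *)
Lemma cintegral_dominated f (g : R -> R) : cmeasurable f ->
  (forall x, 0 <= g x) -> mu.-integrable [set: R] (EFin \o g) ->
  {ae mu, forall x, cmod (f x) <= g x} ->
  cintegrable f /\ cmod (cintegral f) <= 2 * (\int[mu]_x g x)%R.
Proof.
move=> [mR mI] g0 ig fg.
have [iR bR] : mu.-integrable [set: R] (EFin \o (fun x => complex.Re (f x))) /\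
  `|(\int[mu]_x complex.Re (f x))%R| <= (\int[mu]_x g x)%R.
  apply: integral_dominated => //.
  exact: (ae_imply fg (fun x => le_trans (Re_le_cmod (f x)))).
have [iI bI] : mu.-integrable [set: R] (EFin \o (fun x => complex.Im (f x))) /\
  `|(\int[mu]_x complex.Im (f x))%R| <= (\int[mu]_x g x)%R.
  apply: integral_dominated => //.
  exact: (ae_imply fg (fun x => le_trans (Im_le_cmod (f x)))).
split => //; rewrite (le_trans (cmod_le_ReIm _))// mulr_natl mulr2n.
exact: lerD.
Qed.

Lemma eq_cintegral f g : f =1 g -> cintegral f = cintegral g.
Proof. by move=> /funext ->. Qed.

Lemma cintegralD f g : cintegrable f -> cintegrable g ->
  cintegral (fun x => f x + g x) = cintegral f + cintegral g.
Proof.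
move=> [fR fI] [gR gI]; apply: complex_ext => /=.
  rewrite -RintegralD//; apply: eq_Rintegral => x _; exact: ReD.
rewrite -RintegralD//; apply: eq_Rintegral => x _; exact: ImD.
Qed.

Lemma cintegrableD f g : cintegrable f -> cintegrable g ->
  cintegrable (fun x => f x + g x).
Proof.
move=> [fR fI] [gR gI]; split.
  rewrite [X in mu.-integrable _ X](_ : _ = ((fun x => (complex.Re (f x))%:E) \+ (fun x => (complex.Re (g x))%:E))%E).
    exact: integrableD.
  by apply/funext => x /=; rewrite ReD.
rewrite [X in mu.-integrable _ X](_ : _ = ((fun x => (complex.Im (f x))%:E) \+ (fun x => (complex.Im (g x))%:E))%E).
  exact: integrableD.
by apply/funext => x /=; rewrite ImD.
Qed.

Lemma cintegrableZ a f : cintegrable f -> cintegrable (fun x => a * f x).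
Proof.
have lin (p q : R) (u v : R -> R) : mu.-integrable [set: R] (EFin \o u) ->
   mu.-integrable [set: R] (EFin \o v) ->
   mu.-integrable [set: R] (EFin \o (fun x => p * u x + q * v x)).
  move=> iu iv.
  rewrite [X in mu.-integrable _ X](_ : _ = ((fun x => p%:E * (u x)%:E) \+ (fun x => q%:E * (v x)%:E))%E)//.
  by apply: integrableD => //; exact: integrableZl.
move=> [fR fI]; split.
  have := lin (complex.Re a) (- complex.Im a) _ _ fR fI.
  by congr (mu.-integrable _ _); apply/funext => x /=; rewrite ReM mulNr.
have := lin (complex.Re a) (complex.Im a) _ _ fI fR.
by congr (mu.-integrable _ _); apply/funext => x /=; rewrite ImM.
Qed.

Lemma cintegralZ a f : cintegrable f ->
  cintegral (fun x => a * f x) = a * cintegral f.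
Proof.
have lin (p q : R) (u v : R -> R) : mu.-integrable [set: R] (EFin \o u) ->
   mu.-integrable [set: R] (EFin \o v) ->
   (\int[mu]_x (p * u x + q * v x) = p * (\int[mu]_x u x) + q * (\int[mu]_x v x))%R.
  move=> iu iv; rewrite -!RintegralZl// -RintegralD//.
    exact: (integrableZl _ _ iu).
  exact: (integrableZl _ _ iv).
move=> [fR fI]; apply: complex_ext; rewrite ?ReM ?ImM/=.
  rewrite -mulNr -lin//; apply: eq_Rintegral => x _; by rewrite ReM mulNr.
by rewrite -lin//; apply: eq_Rintegral => x _; rewrite ImM.
Qed.

Lemma cintegrable0 : cintegrable (fun=> 0).
Proof. by split; exact: integrable0. Qed.

Lemma cintegral_sum (N : nat) (f : nat -> R -> R[i]) :
  (forall n, cintegrable (f n)) ->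
  cintegrable (fun x => \sum_(n < N) f n x) /\
  cintegral (fun x => \sum_(n < N) f n x) = \sum_(n < N) cintegral (f n).
Proof.
move=> fi; elim: N => [|N [IH1 IH2]].
  split; first by under eq_fun do rewrite big_ord0; exact: cintegrable0.
  rewrite big_ord0; under eq_cintegral do rewrite big_ord0.
  by apply: complex_ext => /=; rewrite Rintegral_cst// mul0r.
split.
  by under eq_fun do rewrite big_ord_recr/=; exact: cintegrableD.
rewrite big_ord_recr/= -IH2 -cintegralD//.
by apply: eq_cintegral => x; rewrite big_ord_recr.
Qed.

Lemma cintegral_cvg (f_ : nat -> R -> R[i]) f (g : R -> R) :
  (forall n, cmeasurable (f_ n)) -> cmeasurable f ->
  (forall x, ccvg (f_ ^~ x) (f x)) ->
  mu.-integrable [set: R] (EFin \o g) ->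
  (forall n x, cmod (f_ n x) <= g x) ->
  ccvg (fun n => cintegral (f_ n)) (cintegral f).
Proof.
move=> mf_ mf ff ig fg.
have key (h_ : nat -> R -> R) (h : R -> R) :
    (forall n, measurable_fun [set: R] (h_ n)) -> measurable_fun [set: R] h ->
    (forall x, h_ ^~ x @ \oo --> h x) -> (forall n x, `|h_ n x| <= g x) ->
    (fun n => (\int[mu]_x h_ n x)%R) @ \oo --> (\int[mu]_x h x)%R.
  move=> mh_ mh hh hg.
  have [||||ih _ cv] := @dominated_convergence _ _ _ mu [set: R] measurableT
    (fun n x => (h_ n x)%:E) (fun x => (h x)%:E) (EFin \o g) _ _ _ ig.
  - by move=> n; apply/measurable_EFinP; exact: mh_.
  - exact/measurable_EFinP.
  - by apply: aeW => x _; apply: cvg_EFin (hh x); exact: nearW.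
  - by apply: aeW => x n _; rewrite lee_fin.
  by apply: fine_cvg; rewrite /Rintegral fineK//; exact: integrable_fin_num.
apply: ccvg_ReIm => /=; apply: key.
- by move=> n; have [] := mf_ n.
- by have [] := mf.
- by move=> x; exact: ccvg_Re.
- by move=> n x; exact: le_trans (Re_le_cmod _) (fg n x).
- by move=> n; have [] := mf_ n.
- by have [] := mf.
- by move=> x; exact: ccvg_Im.
- by move=> n x; exact: le_trans (Im_le_cmod _) (fg n x).
Qed.

End ComplexIntegral.

(** * Real Gaussian integrals and vanishing integrals of derivatives *)

Section GaussIntegral.
Context {R : realType}.
Local Notation mu := (@lebesgue_measure R).

Lemma gauss_shift (b m : R) : 0 < b ->
  mu.-integrable [set: R] (EFin \o (fun v => expR (- (b * (v - m) ^+ 2)))) /\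
  (\int[mu]_v expR (- (b * (v - m) ^+ 2)))%R = Num.sqrt (pi / b).
Proof.
(* The standard deviation for which the normal density has exponent - b (v - m)^2. *)
move=> b0; pose s := Num.sqrt (2 * b)^-1.
have b20 : 0 < (2 * b)^-1 by rewrite invr_gt0 mulr_gt0.
have s0 : s != 0 by rewrite gt_eqF// sqrtr_gt0.
have s2 : s ^+ 2 = (2 * b)^-1 by rewrite sqr_sqrtr// ltW.
have pk : normal_peak s != 0 by rewrite gt_eqF// normal_peak_gt0.
have E v : normal_pdf m s v = normal_peak s * expR (- (b * (v - m) ^+ 2)).
  rewrite normal_pdfE//; congr (_ * expR _); rewrite s2.
  by rewrite -mulr_natr; field; rewrite gt_eqF.
have ip := @integrable_normal_pdf R m s.
have ig : mu.-integrable [set: R] (EFin \o (fun v => expR (- (b * (v - m) ^+ 2)))).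
  have := integrableZl measurableT (normal_peak s)^-1 ip.
  congr (mu.-integrable _ _); apply/funext => v /=.
  by rewrite E -EFinM mulrA mulVf// mul1r.
split => //; have := @integral_normal_pdf R m s.
under eq_integral do rewrite E EFinM.
rewrite integralZl// => h.
have : normal_peak s * (\int[mu]_v expR (- (b * (v - m) ^+ 2)))%R = 1.
  apply: EFin_inj; rewrite EFinM -h; congr (_ * _)%E.
  by rewrite /Rintegral fineK//; exact: integrable_fin_num.
move=> /(congr1 (fun x => (normal_peak s)^-1 * x)).
rewrite mulrA mulVf// mul1r mulr1 => ->; rewrite invrK s2; congr Num.sqrt.
by rewrite -mulr_natr; field; rewrite gt_eqF.
Qed.

Lemma integrable_gauss (b : R) : 0 < b ->
  mu.-integrable [set: R] (EFin \o (fun v => expR (- (b * v ^+ 2)))).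
Proof.
move=> b0; have [h _] := gauss_shift 0 b0.
by move: h; congr (mu.-integrable _ _); apply/funext => v /=; rewrite subr0.
Qed.

Lemma gauss_linear (b p : R) : 0 < b ->
  mu.-integrable [set: R] (EFin \o (fun v => expR (- (b * v ^+ 2) + p * v))) /\
  (\int[mu]_v expR (- (b * v ^+ 2) + p * v))%R =
    Num.sqrt (pi / b) * expR (p ^+ 2 / (4 * b)).
Proof.
move=> b0; have [ig eg] := gauss_shift (p / (2 * b)) b0.
have E v : expR (- (b * v ^+ 2) + p * v) =
    expR (p ^+ 2 / (4 * b)) * expR (- (b * (v - p / (2 * b)) ^+ 2)).
  by rewrite -expRD; congr expR; field; rewrite gt_eqF.
split.
  have := integrableZl measurableT (expR (p ^+ 2 / (4 * b))) ig.
  by congr (mu.-integrable _ _); apply/funext => v /=; rewrite E.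
under eq_Rintegral do rewrite E.
by rewrite RintegralZl// eg mulrC.
Qed.

(** Integration by parts on the line, the source of all Gaussian recurrences below: the fundamental
    theorem on [-n, n], then dominated convergence. *)
Lemma integral_derivative_eq0 (h dh : R -> R) :
  (forall x : R, is_derive x 1 h (dh x)) -> continuous dh ->
  mu.-integrable [set: R] (EFin \o dh) ->
  (fun n => h n%:R) @ \oo --> (0 : R) -> (fun n => h (- n%:R)) @ \oo --> (0 : R) ->
  (\int[mu]_x dh x)%R = 0.
Proof.
move=> hd cd id h1 h2.
have ch : continuous h.
  by move=> x; apply/differentiable_continuous/derivable1_diffP; case: (hd x).
have mdh : measurable_fun [set: R] dh by exact: continuous_measurable_fun.
pose f_ (n : nat) x := ((dh \_ (`[- n%:R, n%:R] : set R)) x)%:E.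
have fint (n : nat) : (\int[mu]_x f_ n x = (h n%:R - h (- n%:R))%:E)%E.
  rewrite (_ : f_ n = (EFin \o dh) \_ `[- n%:R, n%:R]); last first.
    by apply/funext => x; rewrite /f_ !patchE; case: ifP.
  rewrite -integral_mkcond/=.
  (* The fundamental theorem is used on nondegenerate intervals, so n = 0 is treated apart. *)
  case: n => [|n]; first by rewrite oppr0 set_itv1 integral_set1 subrr.
  rewrite (@continuous_FTC2 _ dh h) ?EFinB//.
  - by rewrite (@lt_trans _ _ 0)// oppr_lt0.
  - exact: continuous_subspaceT.
  - split; first by move=> x _; case: (hd x).
      by apply: cvg_at_right_filter; exact: ch.
    by apply: cvg_at_left_filter; exact: ch.
  - by move=> x _; rewrite derive1E derive_val.
have [||||_ _ cv] := @dominated_convergence _ _ _ mu [set: R] measurableT f_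
  (EFin \o dh) (fun x => `|(dh x)%:E|)%E _ _ _ (integrable_abse id).
- move=> n; apply/measurable_EFinP.
  apply/(measurable_restrictT _ _).1 => //.
  exact: measurable_funS mdh.
- exact/measurable_EFinP.
- apply: aeW => x _; apply: cvg_near_cst.
  near=> n; rewrite /f_ patchE mem_set//= in_itv/= -ler_norml.
  near: n; exact: nbhs_infty_ger.
- apply: aeW => x n _; rewrite /f_ patchE; case: ifPn => _ //.
  by rewrite abse0 abse_ge0.
have cvI : (fun n : nat => (h n%:R - h (- n%:R))%:E) @ \oo --> (\int[mu]_x (dh x)%:E)%E.
  by under eq_fun do rewrite -fint.
have cv0 : (fun n : nat => (h n%:R - h (- n%:R))%:E) @ \oo --> 0%:E.
  apply: cvg_EFin; first exact: nearW.
  by rewrite -[X in _ --> X](subrr 0); exact: cvgB.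
by rewrite /Rintegral -(cvg_lim _ cvI)// (cvg_lim _ cv0).
Unshelve. all: by end_near.
Qed.

End GaussIntegral.

(** * Gaussian integrals *)

Section GaussDominated.
Context {R : realType}.
Local Notation mu := (@lebesgue_measure R).
Implicit Types (f g : R -> R[i]).

Definition ccontinuous f : Prop :=
  continuous (fun x : R => complex.Re (f x)) /\ continuous (fun x : R => complex.Im (f x)).

(** A class that contains the Gaussian kernels, is stable under sums and polynomial factors, and
    guarantees both integrability and vanishing boundary terms. *)
Definition gdominated f : Prop := ccontinuous f /\ exists K b : R, [/\ 0 <= K, 0 < b &
  forall v, cmod (f v) <= K * expR (- (b * v ^+ 2))].

Lemma ccontinuousD f g : ccontinuous f -> ccontinuous g -> ccontinuous (fun x => f x + g x).
Proof.
move=> [fR fI] [gR gI]; split => x.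
  by under eq_fun do rewrite ReD; apply: cvgD; [exact: fR|exact: gR].
by under eq_fun do rewrite ImD; apply: cvgD; [exact: fI|exact: gI].
Qed.

Lemma ccontinuousM f g : ccontinuous f -> ccontinuous g -> ccontinuous (fun x => f x * g x).
Proof.
move=> [fR fI] [gR gI]; split => x.
  under eq_fun do rewrite ReM.
  by apply: cvgB; apply: cvgM; (exact: fR || exact: gR || exact: fI || exact: gI).
under eq_fun do rewrite ImM.
by apply: cvgD; apply: cvgM; (exact: fR || exact: gR || exact: fI || exact: gI).
Qed.

Lemma ccontinuous_cst (a : R[i]) : ccontinuous (fun=> a).
Proof. by split => x; exact: cvg_cst. Qed.

Lemma ccontinuous_real (h : R -> R) : continuous h -> ccontinuous (fun x => (h x)%:C).
Proof. by move=> ch; split => // x; exact: cvg_cst. Qed.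

Lemma ccontinuous_cexp f : ccontinuous f -> ccontinuous (fun x => cexp (f x)).
Proof.
move=> [fR fI]; apply: ccontinuousM.
  apply: ccontinuous_real => x; apply: (continuous_comp (fR x)); exact: continuous_expR.
split => x /=.
  by apply: (continuous_comp (fI x)); exact: continuous_cos.
by apply: (continuous_comp (fI x)); exact: continuous_sin.
Qed.

Lemma ccontinuous_measurable f : ccontinuous f -> cmeasurable f.
Proof. by move=> [fR fI]; split; exact: continuous_measurable_fun. Qed.

Lemma gdominated_integrable f : gdominated f -> cintegrable f.
Proof.
move=> [cf [K [b [K0 b0 fK]]]].
have ig : mu.-integrable [set: R] (EFin \o (fun v => K * expR (- (b * v ^+ 2)))).
  have := integrableZl measurableT K (integrable_gauss b0).
  by congr (mu.-integrable _ _); apply/funext.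
have [||] := @cintegral_dominated R f _ (ccontinuous_measurable cf) _ ig.
- by move=> x; rewrite mulr_ge0 ?expR_ge0.
- by apply: aeW => v; exact: fK.
- by [].
Qed.

Lemma gdominatedD f g : gdominated f -> gdominated g -> gdominated (fun x => f x + g x).
Proof.
move=> [cf [K [b [K0 b0 fK]]]] [cg [L [b' [L0 b0' gL]]]].
split; first exact: ccontinuousD.
exists (K + L), (Num.min b b'); split; rewrite ?addr_ge0 ?lt_min ?b0//.
move=> v; rewrite (le_trans (cmodD _ _))// mulrDl lerD//.
  rewrite (le_trans (fK v))// ler_wpM2l// ler_expR lerN2 ler_wpM2r ?sqr_ge0//.
  by rewrite ge_min lexx.
rewrite (le_trans (gL v))// ler_wpM2l// ler_expR lerN2 ler_wpM2r ?sqr_ge0//.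
by rewrite ge_min lexx orbT.
Qed.

Lemma gdominatedZ a f : gdominated f -> gdominated (fun x => a * f x).
Proof.
move=> [cf [K [b [K0 b0 fK]]]]; split.
  by apply: ccontinuousM => //; exact: ccontinuous_cst.
exists (cmod a * K), b; split => //; first by rewrite mulr_ge0 ?cmod_ge0.
by move=> v; rewrite cmodM -mulrA ler_wpM2l ?cmod_ge0.
Qed.

(** Half of the exponent pays for the factor: |v| <= (1 + 2/b) exp(b v^2 / 2), from 1 + y <= exp
    y. *)
Lemma gdominatedMx f : gdominated f -> gdominated (fun x => x%:C * f x).
Proof.
move=> [cf [K [b [K0 b0 fK]]]]; split.
  by apply: ccontinuousM => //; apply: ccontinuous_real => x; exact: cvg_id.
exists ((1 + 2 / b) * K), (b / 2); split.
- by rewrite mulr_ge0// addr_ge0// divr_ge0// ltW.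
- by rewrite divr_gt0.
move=> v; rewrite cmodM cmod_real.
have h : `|v| <= (1 + 2 / b) * expR (b / 2 * v ^+ 2).
  have := expR_ge1Dx (b / 2 * v ^+ 2) => e1.
  have c1 : 0 <= 1 + 2 / b by rewrite addr_ge0// divr_ge0// ltW.
  rewrite (le_trans _ (ler_wpM2l c1 e1))//.
  have -> : (1 + 2 / b) * (1 + b / 2 * v ^+ 2) = 1 + 2 / b + b / 2 * v ^+ 2 + v ^+ 2.
    by field; rewrite gt_eqF.
  have : 0 <= 2 / b by rewrite divr_ge0// ltW.
  have : 0 <= b / 2 * v ^+ 2 by rewrite mulr_ge0 ?sqr_ge0// divr_ge0// ltW.
  have : 0 <= (`|v| - 1) ^+ 2 by rewrite sqr_ge0.
  rewrite sqrrB1 real_normK ?num_real// -mulr_natr => p1 p2 p3.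
  by have := sqr_ge0 v; lra.
rewrite (le_trans (ler_pM _ _ h (fK v))) ?cmod_ge0//.
have -> : (1 + 2 / b) * expR (b / 2 * v ^+ 2) * (K * expR (- (b * v ^+ 2))) =
   (1 + 2 / b) * K * (expR (b / 2 * v ^+ 2) * expR (- (b * v ^+ 2))) by ring.
rewrite -expRD ler_wpM2l//; last by rewrite ler_expR; lra.
by rewrite mulr_ge0// addr_ge0// divr_ge0// ltW.
Qed.

Lemma gdominated_affine (a c : R[i]) f : gdominated f ->
  gdominated (fun x => (a + c * x%:C) * f x).
Proof.
move=> gf; have := gdominatedD (gdominatedZ a gf) (gdominatedZ c (gdominatedMx gf)).
by congr gdominated; apply/funext => x; ring.
Qed.

Lemma eq_gdominated f g : f =1 g -> gdominated f -> gdominated g.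
Proof. by move=> /funext ->. Qed.

(** Every kernel of the proof is an instance, so that one integral formula and one derivative serve
    for the Bargmann transform, its Fourier form and its inversion. *)
Definition cgauss (b : R) (w c : R[i]) (v : R) : R[i] :=
  cexp ((- (b * v ^+ 2))%:C + w * v%:C + c).

Lemma cmod_cgauss b w c v : cmod (cgauss b w c v) =
  expR (- (b * v ^+ 2) + complex.Re w * v + complex.Re c).
Proof. by rewrite /cgauss cmod_cexp !ReD ReM/= mulr0 subr0. Qed.

Lemma gdominated_cgauss b w c : 0 < b -> gdominated (cgauss b w c).
Proof.
move=> b0; split.
  apply: ccontinuous_cexp; apply: ccontinuousD; last exact: ccontinuous_cst.
  apply: ccontinuousD.
    apply: ccontinuous_real => x; apply: cvgN; apply: cvgMr.
    exact: exprn_continuous.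
  apply: ccontinuousM; first exact: ccontinuous_cst.
  by apply: ccontinuous_real => x; exact: cvg_id.
exists (expR (complex.Re w ^+ 2 / (2 * b) + complex.Re c)), (b / 2); split.
- exact: expR_ge0.
- by rewrite divr_gt0.
move=> v; rewrite cmod_cgauss -expRD ler_expR -subr_ge0.
rewrite [leRHS](_ : _ = b / 2 * (v - complex.Re w / b) ^+ 2).
  by rewrite mulr_ge0 ?sqr_ge0// divr_ge0// ltW.
by field; rewrite gt_eqF.
Qed.

Lemma gdominated_cvg0 f (u : nat -> R) : gdominated f ->
  (forall n, `|u n| = n%:R) -> ccvg (fun n => f (u n)) 0.
Proof.
move=> [_ [K [b [K0 b0 fK]]]] un.
apply: (@ccvg_squeeze _ _ _ (fun n => K * expR (- b) ^+ n)).
  move=> n; rewrite subr0 (le_trans (fK _))// ler_wpM2l// -expRM_natl ler_expR.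
  rewrite -[u n ^+ 2]real_normK ?num_real// un mulrN lerN2 mulrC ler_wpM2l ?(ltW b0)//.
  by rewrite -natrX ler_nat; case: n => // n; rewrite expnS expn1 leq_pmulr.
rewrite -[X in _ --> X](mulr0 K); apply: cvgMr; apply: cvg_expr.
by rewrite ger0_norm ?expR_ge0// -expR0 ltr_expR oppr_lt0.
Qed.

Definition is_cderive f (x : R) (l : R[i]) : Prop :=
  is_derive x 1 (fun y => complex.Re (f y)) (complex.Re l) /\
  is_derive x 1 (fun y => complex.Im (f y)) (complex.Im l).

Lemma is_cderive_eq f x l m : is_cderive f x l -> l = m -> is_cderive f x m.
Proof. by move=> h <-. Qed.

Lemma is_cderiveM f g x l m : is_cderive f x l -> is_cderive g x m ->
  is_cderive (fun y => f y * g y) x (l * g x + f x * m).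
Proof.
move=> [fR fI] [gR gI]; split.
  under eq_fun do rewrite ReM.
  by apply: is_derive_eq; rewrite /GRing.scale/= ReD !ReM; ring.
under eq_fun do rewrite ImM.
by apply: is_derive_eq; rewrite /GRing.scale/= ImD !ImM; ring.
Qed.

Lemma is_cderive_affine (a c : R[i]) x : is_cderive (fun y => a + c * y%:C) x c.
Proof.
split.
  under eq_fun do rewrite ReD ReM/= mulr0 subr0.
  by apply: is_derive_eq; rewrite /GRing.scale/=; ring.
under eq_fun do rewrite ImD ImM/= mulr0 add0r.
by apply: is_derive_eq; rewrite /GRing.scale/=; ring.
Qed.

Lemma is_cderive_cgauss b w c x :
  is_cderive (cgauss b w c) x ((w - (2 * b * x)%:C) * cgauss b w c x).
Proof.
have E v : cgauss b w c v =
    (expR (- (b * v ^+ 2) + complex.Re w * v + complex.Re c))%:C *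
    expi (complex.Im w * v + complex.Im c).
  rewrite /cgauss /cexp !ReD !ImD ReM ImM /= mulr0 subr0 add0r.
  by congr (_ * expi _); ring.
rewrite E (_ : cgauss b w c = fun v => (expR (- (b * v ^+ 2) + complex.Re w * v + complex.Re c))%:C *
    expi (complex.Im w * v + complex.Im c)); last by apply/funext.
split.
  under eq_fun do rewrite ReM/= mul0r subr0.
  apply: is_derive_eq; rewrite /GRing.scale/= !ReM ReD ReN ImD ImM ImN/=; ring.
under eq_fun do rewrite ImM/= mul0r addr0.
by apply: is_derive_eq; rewrite /GRing.scale/= !ImM ReD ReN ImD ReM ImN/=; ring.
Qed.

Lemma cintegral_derivative_eq0 f f' : (forall x, is_cderive f x (f' x)) ->
  gdominated f -> gdominated f' -> cintegral f' = 0.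
Proof.
move=> df gf gf'; have [iR iI] := gdominated_integrable gf'.
have [cR cI] := gf'.1.
have c1 : ccvg (fun n => f n%:R) 0 by apply: gdominated_cvg0 => // n; rewrite ger0_norm.
have c2 : ccvg (fun n => f (- n%:R)) 0.
  by apply: gdominated_cvg0 => // n; rewrite normrN ger0_norm.
apply: complex_ext => /=.
  apply: (integral_derivative_eq0 (fun x => (df x).1)) => //.
    exact: (ccvg_Re c1).
  exact: (ccvg_Re c2).
apply: (integral_derivative_eq0 (fun x => (df x).2)) => //.
  exact: (ccvg_Im c1).
exact: (ccvg_Im c2).
Qed.

End GaussDominated.

Section GaussFourier.
Context {R : realType}.
Local Notation mu := (@lebesgue_measure R).

Lemma integrable_gaussX (b m : R) (h : R -> R) : 0 < b ->
  measurable_fun [set: R] h -> (forall v, `|h v| <= 1 + (v - m) ^+ 2) ->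
  mu.-integrable [set: R] (EFin \o (fun v => expR (- (b * (v - m) ^+ 2)) * h v)).
Proof.
move=> b0 mh hh.
have b20 : 0 < b / 2 by rewrite divr_gt0.
have [ig _] := gauss_shift m b20.
have ig2 := integrableZl measurableT (1 + 2 / b) ig.
have mg : measurable_fun [set: R] (fun v => expR (- (b * (v - m) ^+ 2))).
  have [/measurable_int/measurable_EFinP]:= gauss_shift m b0; by [].
have c0 : 0 <= 1 + 2 / b by rewrite addr_ge0// divr_ge0// ltW.
have [] := @integral_dominated R _ _ mu (fun v => expR (- (b * (v - m) ^+ 2)) * h v)
  (fun v => (1 + 2 / b) * expR (- (b / 2 * (v - m) ^+ 2))) _ _ _ _ => //.
- exact: measurable_funM.
- by move=> v; rewrite mulr_ge0 ?expR_ge0.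
- apply: aeW => v; rewrite normrM ger0_norm ?expR_ge0//.
  have e1 := expR_ge1Dx (b / 2 * (v - m) ^+ 2).
  rewrite (le_trans (ler_wpM2l (expR_ge0 _) (hh v)))//.
  have -> : expR (- (b * (v - m) ^+ 2)) = expR (- (b / 2 * (v - m) ^+ 2)) * expR (- (b / 2 * (v - m) ^+ 2)).
    by rewrite -expRD; congr expR; field.
  rewrite -[leLHS]mulrA [leRHS]mulrC ler_wpM2l ?expR_ge0// mulrC expRN ler_pdivrMr ?expR_gt0//.
  rewrite (le_trans _ (ler_wpM2l c0 e1))//.
  have -> : (1 + 2 / b) * (1 + b / 2 * (v - m) ^+ 2) = 1 + 2 / b + b / 2 * (v - m) ^+ 2 + (v - m) ^+ 2.
    by field; rewrite gt_eqF.
  have : 0 <= 2 / b by rewrite divr_ge0// ltW.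
  have : 0 <= b / 2 * (v - m) ^+ 2 by rewrite mulr_ge0 ?sqr_ge0// divr_ge0// ltW.
  by lra.
Qed.

(* As a function of [y] the integral solves the linear equation [A' = - y / (2 b) A]. *)
Lemma gauss_cos (b m c y : R) : 0 < b ->
  (\int[mu]_v (expR (- (b * (v - m) ^+ 2)) * cos (y * (v - m) + c)))%R =
  Num.sqrt (pi / b) * cos c * expR (- (y ^+ 2 / (4 * b))).
Proof.
move=> b0.
pose A (t : R) := (\int[mu]_v (expR (- (b * (v - m) ^+ 2)) * cos (t * (v - m) + c)))%R.
have mlin (t : R) : continuous (fun v : R => t * (v - m) + c).
  move=> v; apply: cvgD; last exact: cvg_cst.
  by apply: cvgMr; apply: cvgB; [exact: cvg_id|exact: cvg_cst].
have ccos t : continuous (fun v : R => cos (t * (v - m) + c)).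
  by move=> v; apply: (continuous_comp (mlin t v)); exact: continuous_cos.
have csin t : continuous (fun v : R => sin (t * (v - m) + c)).
  by move=> v; apply: (continuous_comp (mlin t v)); exact: continuous_sin.
have cg : continuous (fun v : R => expR (- (b * (v - m) ^+ 2))).
  move=> v; apply: continuous_comp; last exact: continuous_expR.
  apply: cvgN; apply: cvgMr; apply: (@continuous_comp _ _ _ (fun v => v - m) (fun x => x ^+ 2)).
    by apply: cvgB; [exact: cvg_id|exact: cvg_cst].
  exact: exprn_continuous.
have cvm : continuous (fun v : R => v - m).
  by move=> v; apply: cvgB; [exact: cvg_id|exact: cvg_cst].
have icos t : mu.-integrable [set: R] (EFin \o (fun v => expR (- (b * (v - m) ^+ 2)) * cos (t * (v - m) + c))).
  apply: integrable_gaussX => //; first exact: continuous_measurable_fun.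
  by move=> v; rewrite (le_trans (cos_max _))// lerDl sqr_ge0.
have ivsin t : mu.-integrable [set: R] (EFin \o (fun v => expR (- (b * (v - m) ^+ 2)) * ((v - m) * sin (t * (v - m) + c)))).
  apply: integrable_gaussX => //.
    by apply: measurable_funM; exact: continuous_measurable_fun.
  move=> v; rewrite normrM -[leRHS]mul1r mulrC ler_pM ?sin_max//.
  rewrite -[(v - m) ^+ 2]real_normK ?num_real//.
  have : 0 <= (`|v - m| - 1) ^+ 2 by rewrite sqr_ge0.
  by rewrite sqrrB1 -mulr_natr => ?; have := sqr_ge0 (`|v - m|); lra.
(* Integration by parts with primitive exp(- b (v - m)^2) sin (t (v - m) + c). *)
have ibp t : (\int[mu]_v (expR (- (b * (v - m) ^+ 2)) * ((v - m) * sin (t * (v - m) + c))))%R =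
    t / (2 * b) * A t.
  have : (\int[mu]_v (- (2 * b) * (expR (- (b * (v - m) ^+ 2)) * ((v - m) * sin (t * (v - m) + c))) +
     t * (expR (- (b * (v - m) ^+ 2)) * cos (t * (v - m) + c))))%R = 0.
    pose h (v : R) := expR (- (b * (v - m) ^+ 2)) * sin (t * (v - m) + c).
    have hlim (u : nat -> R) : (forall n, `|u n| = n%:R) -> (fun n => h (u n)) @ \oo --> (0 : R).
      move=> un; apply/norm_cvg0P.
      have gd := @gdominated_cgauss R b (2 * b * m)%:C (- (b * m ^+ 2))%:C b0.
      have := ccvg_cmod (gdominated_cvg0 gd un); rewrite cmod0 => lim0.
      apply: (squeeze_cvgr _ (cvg_cst 0) lim0); apply: nearW => n.
      rewrite cmod_cgauss; apply/andP; split; first exact: normr_ge0.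
      rewrite /h normrM ger0_norm ?expR_ge0//=.
      have -> : - (b * u n ^+ 2) + 2 * b * m * u n + - (b * m ^+ 2) = - (b * (u n - m) ^+ 2) by ring.
      by rewrite ler_piMr ?expR_ge0// sin_max.
    apply: (@integral_derivative_eq0 _ h).
    - by move=> x; rewrite /h; apply: is_derive_eq; rewrite /GRing.scale/=; ring.
    - move=> v; apply: cvgD; apply: cvgMr.
        by apply: cvgM; [exact: cg|apply: cvgM; [exact: cvm|exact: csin]].
      by apply: cvgM; [exact: cg|exact: ccos].
    - have := integrableD measurableT (integrableZl measurableT (- (2 * b)) (ivsin t))
        (integrableZl measurableT t (icos t)).
      by congr (mu.-integrable _ _); apply/funext.
    - by apply: hlim => n; rewrite ger0_norm.
    - by apply: hlim => n; rewrite normrN ger0_norm.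
  rewrite RintegralD//.
  - rewrite !RintegralZl// -/(A t).
    set I := (\int[mu]_v _)%R => h.
    have b2 : 2 * b != 0 by rewrite gt_eqF// mulr_gt0.
    apply: (mulfI b2); rewrite [RHS](_ : _ = t * A t); first lra.
    by field; rewrite gt_eqF.
  - exact: (integrableZl _ _ (ivsin t)).
  - exact: (integrableZl _ _ (icos t)).
have dA (t : R) : is_derive t 1 A (- (t / (2 * b)) * A t).
  pose f (s v : R) := expR (- (b * (v - m) ^+ 2)) * cos (s * (v - m) + c).
  (* A majorant of the derivative that does not depend on the parameter. *)
  pose G v := expR (- (b * (v - m) ^+ 2)) * `|v - m|.
  have fE (s v : R) : is_derive s 1 (fun s' => f s' v) (- (expR (- (b * (v - m) ^+ 2)) * ((v - m) * sin (s * (v - m) + c)))).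
    by rewrite /f; apply: is_derive_eq; rewrite /GRing.scale/=; ring.
  have fD (s v : R) : 'D_1 (fun s' => f s' v) s =
      - (expR (- (b * (v - m) ^+ 2)) * ((v - m) * sin (s * (v - m) + c))).
    by case: (fE s v).
  have iG : mu.-integrable [set: R] (EFin \o G).
    apply: integrable_gaussX => //.
      by apply: continuous_measurable_fun => v; apply: cvg_norm; exact: cvm.
    move=> v; rewrite normr_id -[(v - m) ^+ 2]real_normK ?num_real//.
    have : 0 <= (`|v - m| - 1) ^+ 2 by rewrite sqr_ge0.
    by rewrite sqrrB1 -mulr_natr => ?; have := sqr_ge0 (`|v - m|); lra.
  have Gub (s v : R) : ((t - 1 < s < t + 1)%R) -> [set: R] v -> `|'D_1 (fun s' => f s' v) s| <= G v.
    move=> _ _; rewrite fD normrN normrM ger0_norm ?expR_ge0//.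
    by rewrite ler_wpM2l ?expR_ge0// normrM ler_piMr// sin_max.
  have tin : [set` `]t - 1, t + 1[] t by rewrite /= in_itv/= ltrBlDr ltrDl ltr01.
  have der : derivable A t 1.
    apply: (@derivable_under_integral R _ _ mu f [set: R] measurableT t (t - 1) (t + 1) tin _ _ G _ iG).
    - by move=> s _; exact: icos.
    - by move=> s v _ _; case: (fE s v).
    - by move=> v; rewrite mulr_ge0 ?expR_ge0.
    - move=> s v; rewrite /= in_itv/= => sin _; rewrite /partial1of2 derive1E; exact: Gub.
  apply: DeriveDef => //; rewrite -derive1E.
  rewrite (@differentiation_under_integral R _ _ mu f [set: R] measurableT t (t - 1) (t + 1) tin _ _ G _ iG).
  - rewrite mulNr -ibp -[RHS]mulN1r -RintegralZl//; apply: eq_Rintegral => v _.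
    by rewrite /partial1of2 derive1E fD mulN1r.
  - by move=> s _; exact: icos.
  - by move=> s v _ _; case: (fE s v).
  - by move=> v; rewrite mulr_ge0 ?expR_ge0.
  - move=> s v; rewrite /= in_itv/= => sin _; rewrite /partial1of2 derive1E; exact: Gub.
(* With the integrating factor, g has derivative zero and its value is read at t = 0. *)
pose g (t : R) := A t * expR (t ^+ 2 / (4 * b)).
have dg (x : R) : is_derive x 1 g 0.
  rewrite /g; apply: is_derive_eq; rewrite /GRing.scale/=.
  by field; rewrite gt_eqF.
have cst : g y = g 0 by exact: is_derive_0_is_cst.
move: cst; rewrite /g expr0n/= mul0r expR0 mulr1.
have -> : A 0 = Num.sqrt (pi / b) * cos c.
  have [ig eg] := gauss_shift m b0.
  rewrite /A; under eq_Rintegral do rewrite mul0r add0r mulrC.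
  by rewrite RintegralZl// eg mulrC.
by move=> <-; rewrite -mulrA -expRD subrr expR0 mulr1.
Qed.

(** Only the real part of w is absorbed by completing the square; the imaginary part remains a
    frequency, handled by [gauss_cos], and no contour is moved. *)
Lemma cintegral_cgauss (b : R) (w c : R[i]) : 0 < b ->
  cintegral (cgauss b w c) = (Num.sqrt (pi / b))%:C * cexp (w ^+ 2 / (4 * b)%:C + c).
Proof.
move=> b0; case: w => p q; case: c => c d.
pose m := p / (2 * b).
have E v : cgauss b (p +i* q) (c +i* d) v = (expR (p ^+ 2 / (4 * b) + c) * expR (- (b * (v - m) ^+ 2)))%:C *
   expi (q * (v - m) + (q * m + d)).
  rewrite /cgauss /cexp -expRD /=; congr ((expR _)%:C * expi _).
    by rewrite /m; field; rewrite gt_eqF.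
  by rewrite /m; ring.
have i1 (e : R) : mu.-integrable [set: R] (EFin \o (fun v => expR (- (b * (v - m) ^+ 2)) * cos (q * (v - m) + e))).
  apply: integrable_gaussX => //.
    apply: continuous_measurable_fun => v; apply: continuous_comp; last exact: continuous_cos.
    apply: cvgD; last exact: cvg_cst.
    by apply: cvgMr; apply: cvgB; [exact: cvg_id|exact: cvg_cst].
  by move=> v; rewrite (le_trans (cos_max _))// lerDl sqr_ge0.
rewrite /cintegral.
under eq_Rintegral do rewrite E ReM/= mul0r subr0 -mulrA.
rewrite RintegralZl// gauss_cos//.
(* The sine is the cosine with its phase lowered by pi/2, so the same formula gives the imaginary
   part. *)
under [in X in _ +i* X]eq_Rintegral do rewrite E ImM/= mul0r addr0 -mulrA -cosBpihalf -addrA.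
rewrite RintegralZl// gauss_cos// cosBpihalf.
have b4 : 4 * b != 0 by rewrite gt_eqF// mulr_gt0.
have -> : (p +i* q) ^+ 2 / (4 * b)%:C + (c +i* d) =
    (p ^+ 2 / (4 * b) + c + - (q ^+ 2 / (4 * b))) +i* (q * m + d).
  rewrite -fmorphV expr2 /=; apply: complex_ext; rewrite ?ReD ?ImD ?ReM ?ImM/=.
    by field; rewrite gt_eqF.
  by rewrite /m; field; rewrite gt_eqF.
by rewrite /cexp/= !expRD; apply: complex_ext; rewrite /= !(mul0r, subr0, add0r, addr0); ring.
Qed.

End GaussFourier.

(** * Hermite polynomials *)

Section Hermite.
Context {R : realType}.
Local Notation mu := (@lebesgue_measure R).

(** The recursion is the one obtained by differentiating (-1)^n H_n(x) exp(- x^2) once. *)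
Fixpoint herm (n : nat) : {poly R} :=
  if n is m.+1 then 2%:R *: ('X * herm m) - (herm m)^`() else 1.

Lemma deriv_herm n : (herm n.+1)^`() = (2 * n.+1%:R) *: herm n.
Proof.
elim: n => [|n IH].
  have -> : herm 1 = 2%:R *: 'X by rewrite /= -polyC1 derivC subr0 mulr1.
  by rewrite derivZ derivX mulr1.
rewrite [herm n.+2]/= -/(herm n.+1) derivB derivZ derivM derivX mul1r IH.
rewrite derivZ -scalerAr -[in RHS]natr1.
have -> : herm n.+1 = 2%:R *: ('X * herm n) - (herm n)^`() by [].
rewrite !(scalerDr, scalerBr, scalerN, scalerA).
rewrite -!mul_polyC; ring.
Qed.

Lemma herm_rec n : herm n.+2 = 2%:R *: ('X * herm n.+1) - (2 * n.+1%:R) *: herm n.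
Proof. by rewrite -deriv_herm. Qed.

Lemma is_derive_horner (p : {poly R}) (x : R) : is_derive x 1 (horner p) p^`().[x].
Proof.
by apply: DeriveDef; [exact: derivable_horner|rewrite derivE derive1E].
Qed.

Lemma hermite_polyE n (x : R) : hermite_poly n x = (herm n).[x].
Proof.
have E m : derive1n m (fun y : R => expR (- y ^+ 2)) =
    fun y => (-1) ^+ m * (herm m).[y] * expR (- y ^+ 2).
  elim: m => [|m IH].
    by rewrite derive1n0; apply/funext => y; rewrite expr0 hornerC !mul1r.
  rewrite derive1nS IH; apply/funext => y; rewrite derive1E.
  suff : is_derive y 1 (fun y : R => (-1) ^+ m * (herm m).[y] * expR (- y ^+ 2))
      ((-1) ^+ m.+1 * (herm m.+1).[y] * expR (- y ^+ 2)) by case.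
  have hp := is_derive_horner (herm m) y.
  apply: is_derive_eq; rewrite /GRing.scale/= !(hornerD, hornerN, hornerZ, hornerM, hornerX).
  by rewrite [(-1) ^+ m.+1]exprS; ring.
rewrite /hermite_poly E.
have e1 : expR (x ^+ 2) * expR (- x ^+ 2) = 1 by rewrite -expRD subrr expR0.
have e2 : (-1) ^+ n * (-1) ^+ n = 1 :> R by rewrite -expr2 sqrr_sign.
rewrite [LHS](_ : _ = ((-1) ^+ n * (-1) ^+ n) * (expR (x ^+ 2) * expR (- x ^+ 2)) * (herm n).[x]).
  by rewrite e1 e2 !mul1r.
by ring.
Qed.

Local Notation s := (Num.sqrt (2 * pi) : R).

Let s_gt0 : 0 < s.
Proof. by rewrite sqrtr_gt0 mulr_gt0// pi_gt0. Qed.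

Let s2 : s ^+ 2 = 2 * pi.
Proof. by rewrite sqr_sqrtr// mulr_ge0// pi_ge0. Qed.

Lemma gdominated_poly (p : {poly R}) (r : R) f : gdominated f ->
  gdominated (fun x => (p.[r * x])%:C * f x).
Proof.
elim/poly_ind: p f => [|p a IH] f gf.
  apply: eq_gdominated (gdominatedZ 0 gf) => x.
  by rewrite horner0.
have := gdominatedD (gdominatedZ r%:C (gdominatedMx (IH _ gf))) (gdominatedZ a%:C gf).
apply: eq_gdominated => x; rewrite hornerD hornerM hornerX hornerC.
by rewrite !(rmorphD, rmorphM)/=; ring.
Qed.

Lemma is_cderive_poly (p : {poly R}) (r x : R) :
  is_cderive (fun y => (p.[r * y])%:C) x (r * p^`().[r * x])%:C.
Proof.
split => /=; last by apply: is_derive_eq.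
have hp := is_derive_horner p (r * x).
have hr : is_derive x 1 (fun y : R => r * y) r.
  by apply: is_derive_eq; rewrite /GRing.scale/= mulr1.
by rewrite mulrC; exact: (is_derive1_comp hp hr).
Qed.

(** By s^2 = 2 pi, the derivative of H_n(s x) E is s (s z) H_n(s x) E - s H_(n+1)(s x) E. Its
    integral vanishes, so raising the degree by one multiplies the integral by s z. *)
Lemma cintegral_herm (z c : R[i]) n :
  cintegral (fun x => ((herm n).[s * x])%:C * cgauss (2 * pi) (2 * pi%:C * z) c x) =
  (s%:C * z) ^+ n * cintegral (cgauss (2 * pi) (2 * pi%:C * z) c).
Proof.
have b0 : 0 < 2 * pi :> R by rewrite mulr_gt0// pi_gt0.
set E := cgauss _ _ _.
have gE : gdominated E by exact: gdominated_cgauss.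
elim: n => [|n IH].
  rewrite expr0 mul1r; apply: eq_cintegral => x.
  by rewrite hornerC mul1r.
rewrite exprS -mulrA -IH.
have gq m := gdominated_poly (herm m) s gE.
have gi m := gdominated_integrable (gq m).
pose h' x := s%:C * (s%:C * z) * (((herm n).[s * x])%:C * E x) +
   - s%:C * (((herm n.+1).[s * x])%:C * E x).
have : cintegral h' = 0.
  apply: (@cintegral_derivative_eq0 _ (fun x => ((herm n).[s * x])%:C * E x)) => //.
    move=> x; apply: is_cderive_eq (is_cderiveM (is_cderive_poly _ _ _) (is_cderive_cgauss _ _ _ _)) _.
    rewrite /h' /= -/E !(hornerD, hornerN, hornerZ, hornerM, hornerX).
    have -> : 2 * (2 * pi) * x = 2 * s ^+ 2 * x by rewrite s2.
    have -> : 2 * pi%:C * z = s%:C ^+ 2 * z.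
      by rewrite -rmorphXn/= s2 rmorphM/= rmorph_nat.
    rewrite !(rmorphD, rmorphN, rmorphM, rmorphXn, rmorph_nat)/=.
    by ring.
  by apply: gdominatedD; exact: gdominatedZ.
rewrite cintegralD; [|exact: cintegrableZ|exact: cintegrableZ].
rewrite !cintegralZ// mulNr => /eqP; rewrite subr_eq0 -mulrA => /eqP.
move/mulfI => -> //; apply/eqP => /(congr1 (@complex.Re R))/= h.
by have := s_gt0; rewrite h ltxx.
Qed.

(* [z = u + i v] runs over a vertical line; every power of [z] turns into a Hermite polynomial
   in [x], whatever the abscissa [u]. *)
Definition bkernel (u x : R) : R -> R[i] :=
  cgauss (pi / 2) (0 +i* (pi * (u - 2 * x))) (pi / 2 * u ^+ 2 - 2 * pi * x * u)%:C.

(** With z = u + i v the kernel is exp(pi z^2 / 2 - 2 pi x z); completing the square in v makes u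
    disappear, as moving the contour would. *)
Lemma bkernel0 (u x : R) :
  cintegral (bkernel u x) = (Num.sqrt 2 * expR (- (2 * pi * x ^+ 2)))%:C.
Proof.
have p0 := pi_gt0 R.
rewrite cintegral_cgauss ?divr_gt0// [RHS]rmorphM/=; congr (_ * _).
  by rewrite invf_div mulrCA divff ?mulr1// gt_eqF.
rewrite -cexp_real; congr cexp.
rewrite -fmorphV expr2; apply: complex_ext; rewrite ?ReD ?ImD ?ReM ?ImM/=; last by ring.
move: (@pi R) p0 => P P0.
by field; rewrite gt_eqF.
Qed.

Let line (u v : R) : R[i] := u%:C + 'i%C * v%:C.

Lemma gdominated_line (u x : R) n : gdominated (fun v => line u v ^+ n * bkernel u x v).
Proof.
have p0 := pi_gt0 R; elim: n => [|n IH].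
  apply: eq_gdominated (gdominated_cgauss _ _ (_ : 0 < pi / 2)); last by rewrite divr_gt0.
  by move=> v; rewrite expr0 mul1r.
apply: eq_gdominated (gdominated_affine u%:C 'i%C IH) => v.
by rewrite exprS mulrA.
Qed.

Lemma is_cderive_line u n (v : R) :
  is_cderive (fun y => line u y ^+ n.+1) v ('i%C * n.+1%:R * line u v ^+ n).
Proof.
elim: n => [|n IH].
  apply: is_cderive_eq (is_cderive_affine u%:C 'i%C v) _.
  by rewrite expr0 !mulr1.
have E : (fun y => line u y ^+ n.+2) = (fun y => line u y * line u y ^+ n.+1).
  by apply/funext => y; rewrite exprS.
rewrite E; apply: is_cderive_eq (is_cderiveM (is_cderive_affine u%:C 'i%C v) IH) _.
rewrite -/(line u v) -[n.+2%:R]natr1 !exprS; ring.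
Qed.

Let J (u x : R) n := cintegral (fun v => line u v ^+ n * bkernel u x v).

Let bk_deriv u x v : is_cderive (bkernel u x) v
  (('i%C * (pi%:C * line u v - 2 * pi%:C * x%:C)) * bkernel u x v).
Proof.
apply: is_cderive_eq (is_cderive_cgauss _ _ _ _) _; congr (_ * _).
by apply: complex_ext; rewrite /line !(ReM, ImM, ReD, ImD, ReN, ImN)/=; field.
Qed.

Let J_integrable u x n := gdominated_integrable (gdominated_line u x n).

Let i_neq0 : 'i%C != 0 :> R[i].
Proof. by apply/eqP => /(congr1 (@complex.Im R))/= /eqP; rewrite oner_eq0. Qed.

Let J1 u x : pi%:C * J u x 1 = 2 * pi%:C * x%:C * J u x 0.
Proof.
pose h' v := 'i%C * pi%:C * (line u v ^+ 1 * bkernel u x v) +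
  - 'i%C * (2 * pi%:C * x%:C) * (line u v ^+ 0 * bkernel u x v).
have : cintegral h' = 0.
  apply: (@cintegral_derivative_eq0 _ (bkernel u x)).
  - move=> v; apply: is_cderive_eq (bk_deriv _ _ _) _.
    by rewrite /h' expr1 expr0; ring.
  - by apply: eq_gdominated (gdominated_line u x 0) => v; rewrite expr0 mul1r.
  - by apply: gdominatedD; apply: gdominatedZ; exact: gdominated_line.
rewrite cintegralD; [|exact: cintegrableZ|exact: cintegrableZ].
rewrite (cintegralZ _ (J_integrable u x 0)) (cintegralZ _ (J_integrable u x 1)) -/(J u x 0) -/(J u x 1) => h.
apply: (mulfI i_neq0); apply/eqP; rewrite -subr_eq0 -h; apply/eqP; ring.
Qed.

(** Integration of the derivative of z^(n+1) times the kernel. After scaling by s^n this is the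
    three-term recurrence of the Hermite polynomials. *)
Let J_rec u x n : pi%:C * J u x n.+2 =
  2 * pi%:C * x%:C * J u x n.+1 - n.+1%:R * J u x n.
Proof.
pose h' v := 'i%C * pi%:C * (line u v ^+ n.+2 * bkernel u x v) +
  (- 'i%C * (2 * pi%:C * x%:C) * (line u v ^+ n.+1 * bkernel u x v) +
   'i%C * n.+1%:R * (line u v ^+ n * bkernel u x v)).
have : cintegral h' = 0.
  apply: (@cintegral_derivative_eq0 _ (fun v => line u v ^+ n.+1 * bkernel u x v)).
  - move=> v; apply: is_cderive_eq (is_cderiveM (is_cderive_line _ _ _) (bk_deriv _ _ _)) _.
    by rewrite /h' !exprS; ring.
  - exact: gdominated_line.
  - apply: gdominatedD; first by apply: gdominatedZ; exact: gdominated_line.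
    by apply: gdominatedD; apply: gdominatedZ; exact: gdominated_line.
rewrite cintegralD; [|exact: cintegrableZ|apply: cintegrableD; exact: cintegrableZ].
rewrite cintegralD; [|exact: cintegrableZ|exact: cintegrableZ].
rewrite !cintegralZ// -!/(J _ _ _) => h; apply: (mulfI i_neq0).
apply/eqP; rewrite -subr_eq0 -h; apply/eqP; ring.
Qed.

Lemma cintegral_bkernel (u x : R) n :
  s%:C ^+ n * cintegral (fun v => (u%:C + 'i%C * v%:C) ^+ n * bkernel u x v) =
  ((herm n).[s * x])%:C * cintegral (bkernel u x).
Proof.
have p0 : pi%:C != 0 :> R[i].
  by apply/eqP => /(congr1 (@complex.Re R))/= /eqP; rewrite gt_eqF// pi_gt0.
have s2C : s%:C ^+ 2 = 2 * pi%:C :> R[i] by rewrite -rmorphXn s2 rmorphM/= rmorph_nat.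
have J0 : J u x 0 = cintegral (bkernel u x).
  by apply: eq_cintegral => v; rewrite expr0 mul1r.
rewrite -J0 -/(J u x n).
(* The recurrence has two steps, so consecutive indices are proved together. *)
suff [] : (s%:C ^+ n * J u x n = ((herm n).[s * x])%:C * J u x 0) /\
    (s%:C ^+ n.+1 * J u x n.+1 = ((herm n.+1).[s * x])%:C * J u x 0) by [].
elim: n => [|n [IH1 IH2]].
  split; first by rewrite hornerC.
  apply: (mulfI p0); rewrite expr1 mulrCA J1 /= -polyC1 derivC subr0 mulr1.
  by rewrite hornerZ hornerX !rmorphM/= rmorph_nat; ring.
split => //; apply: (mulfI p0); rewrite mulrCA J_rec.
have -> : ((herm n.+2).[s * x])%:C = 2 * (s%:C * x%:C) * ((herm n.+1).[s * x])%:C -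
    2 * n.+1%:R * ((herm n).[s * x])%:C.
  rewrite herm_rec hornerD hornerN 2!hornerZ hornerM hornerX.
  move: (herm n.+1).[_] (herm n).[_] => p q.
  by rewrite rmorphB !rmorphM !rmorph_nat/=; ring.
rewrite [RHS](_ : _ = 2 * pi%:C * (s%:C * x%:C * (((herm n.+1).[s * x])%:C * J u x 0) -
    n.+1%:R * (((herm n).[s * x])%:C * J u x 0))); last by ring.
by rewrite -IH1 -IH2 -s2C !exprS expr0; ring.
Qed.

End Hermite.

(** * Fubini and convergence in the mean *)

Section CFubini.
Context {R : realType}.
Local Notation mu := (@lebesgue_measure R).

(** The product majorant makes h integrable on the plane and each of its sections integrable; the
    latter identifies the real inner integrals with the extended ones. *)
Lemma Rintegral_Fubini (h : R * R -> R) (A B : R -> R) :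
  measurable_fun [set: R * R] h ->
  (forall x, 0 <= A x) -> (forall y, 0 <= B y) ->
  mu.-integrable [set: R] (EFin \o A) -> mu.-integrable [set: R] (EFin \o B) ->
  (forall x y, `|h (x, y)| <= A x * B y) ->
  measurable_fun [set: R] (fun y => (\int[mu]_x h (x, y))%R) /\
  (\int[mu]_x (\int[mu]_y h (x, y)))%R = (\int[mu]_y (\int[mu]_x h (x, y)))%R.
Proof.
move=> mh A0 B0 iA iB hAB.
have mEh : measurable_fun [set: R * R] (EFin \o h) by exact/measurable_EFinP.
have mA : measurable_fun [set: R] A by have /measurable_EFinP := measurable_int mu iA.
have mB : measurable_fun [set: R] B by have /measurable_EFinP := measurable_int mu iB.
have sx x : mu.-integrable [set: R] (EFin \o (fun y => h (x, y))).
  have [] := @integral_dominated R _ _ mu (fun y => h (x, y)) (fun y => A x * B y) _ _ _ _ => //.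
  - exact: measurableT_comp mh (measurable_pair1 x).
  - by move=> y; rewrite mulr_ge0.
  - exact: (integrableZl measurableT (A x) iB).
  - by apply: aeW => y; exact: hAB.
have sy y : mu.-integrable [set: R] (EFin \o (fun x => h (x, y))).
  have [] := @integral_dominated R _ _ mu (fun x => h (x, y)) (fun x => B y * A x) _ _ _ _ => //.
  - exact: measurableT_comp mh (measurable_pair2 y).
  - by move=> x; rewrite mulr_ge0.
  - exact: (integrableZl measurableT (B y) iA).
  - by apply: aeW => x; rewrite mulrC; exact: hAB.
have ih : (mu \x mu)%E.-integrable [set: R * R] (EFin \o h).
  apply/(integrable12ltyP mu mu mEh).
  apply: (@le_lt_trans _ _ (\int[mu]_x ((\int[mu]_y B y)%R%:E * (A x)%:E))%E).
    apply: ge0_le_integral => //.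
    - by move=> x _; exact: integral_ge0.
    - have h0 p : (0 <= (abse \o (EFin \o h)) p)%E by exact: abse_ge0.
      have mah : measurable_fun [set: R * R] (abse \o (EFin \o h)) by exact: measurableT_comp.
      have hF := @measurable_fun_fubini_tonelli_F _ _ _ _ R mu _ mah h0.
      exact: hF.
    - by apply/measurable_EFinP; apply: measurable_funM.
    move=> x _; rewrite -EFinM mulrC EFinM.
    rewrite (_ : (\int[mu]_y B y)%R%:E = \int[mu]_y (B y)%:E)%E; last first.
      by rewrite /Rintegral fineK//; exact: integrable_fin_num.
    rewrite -ge0_integralZl_EFin//; [|by move=> y _; rewrite lee_fin|exact/measurable_EFinP].
    apply: ge0_le_integral => //.
    - apply: measurableT_comp => //; apply/measurable_EFinP.
      exact: measurableT_comp mh (measurable_pair1 x).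
    - by apply/measurable_EFinP; exact: measurable_funM.
    - by move=> y _; rewrite /= lee_fin.
  have := integrableZl measurableT (\int[mu]_y B y)%R iA.
  move=> /integrableP[_]; apply: le_lt_trans.
  rewrite le_eqVlt; apply/orP; left; apply/eqP; apply: eq_integral => x _ /=.
  by rewrite ger0_norm// mulr_ge0// Rintegral_ge0.
have Ey y : (\int[mu]_x (h (x, y))%:E = (\int[mu]_x h (x, y))%:E)%E.
  by rewrite /Rintegral fineK//; exact: integrable_fin_num (sy y).
have Ex x : (\int[mu]_y (h (x, y))%:E = (\int[mu]_y h (x, y))%:E)%E.
  by rewrite /Rintegral fineK//; exact: integrable_fin_num (sx x).
split.
  apply/measurable_EFinP; have := measurable_fubini_G ih.
  by congr (measurable_fun _ _); apply/funext => y; rewrite /fubini_G /= Ey.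
rewrite /Rintegral; congr fine.
have E1 : (\int[mu]_x \int[mu]_y (EFin \o h) (x, y) =
    \int[mu]_x (\int[mu]_y h (x, y))%R%:E)%E.
  by apply: eq_integral => x _; exact: Ex.
have E2 : (\int[mu]_y \int[mu]_x (EFin \o h) (x, y) =
    \int[mu]_y (\int[mu]_x h (x, y))%R%:E)%E.
  by apply: eq_integral => y _; exact: Ey.
by rewrite -E1 -E2; exact: Fubini ih.
Qed.

Lemma cintegral_Fubini (h : R * R -> R[i]) (A B : R -> R) :
  cmeasurable h ->
  (forall x, 0 <= A x) -> (forall y, 0 <= B y) ->
  mu.-integrable [set: R] (EFin \o A) -> mu.-integrable [set: R] (EFin \o B) ->
  (forall x y, cmod (h (x, y)) <= A x * B y) ->
  cmeasurable (fun y => cintegral (fun x => h (x, y))) /\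
  cintegral (fun x => cintegral (fun y => h (x, y))) =
  cintegral (fun y => cintegral (fun x => h (x, y))).
Proof.
move=> [mR mI] A0 B0 iA iB hAB.
have [m1 e1] := Rintegral_Fubini mR A0 B0 iA iB
  (fun x y => le_trans (Re_le_cmod _) (hAB x y)).
have [m2 e2] := Rintegral_Fubini mI A0 B0 iA iB
  (fun x y => le_trans (Im_le_cmod _) (hAB x y)).
by split; [split|apply: complex_ext].
Qed.

End CFubini.

Section L2.
Context {R : realType}.
Local Notation mu := (@lebesgue_measure R).

Lemma cintegrable_cmod (f : R -> R[i]) : cmeasurable f -> cintegrable f ->
  mu.-integrable [set: R] (EFin \o (fun x => cmod (f x))).
Proof.
move=> mf [fR fI].
have ig : mu.-integrable [set: R] (EFin \o (fun x => `|complex.Re (f x)| + `|complex.Im (f x)|)).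
  have := integrableD measurableT (integrable_abse fR) (integrable_abse fI).
  by congr (mu.-integrable _ _); apply/funext.
have [] := @integral_dominated R _ _ mu (fun x => cmod (f x)) _ (measurable_cmod mf) _ ig _ => //.
by apply: aeW => x; rewrite ger0_norm ?cmod_ge0// cmod_le_ReIm.
Qed.

Lemma gdominated_L2norm (k : R -> R[i]) : gdominated k -> (L2norm k < +oo)%E.
Proof.
move=> gk; rewrite /L2norm unlock; apply: poweR_lty.
have gkk : gdominated (fun x => k x * k x).
  have [ck [K [b [K0 b0 kK]]]] := gk.
  split; first exact: ccontinuousM.
  exists (K * K), b; split => //; first by rewrite mulr_ge0.
  move=> v; rewrite cmodM.
  rewrite (le_trans (ler_pM (cmod_ge0 _) (cmod_ge0 _) (kK v) (kK v)))//.
  have -> : K * expR (- (b * v ^+ 2)) * (K * expR (- (b * v ^+ 2))) =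
    K * K * (expR (- (b * v ^+ 2)) * expR (- (b * v ^+ 2))) by ring.
  rewrite ler_wpM2l ?mulr_ge0// ler_piMr ?expR_ge0// -[leRHS]expR0 ler_expR.
  by rewrite oppr_le0 mulr_ge0 ?sqr_ge0// ltW.
have := cintegrable_cmod (ccontinuous_measurable gkk.1) (gdominated_integrable gkk).
move=> /integrableP[_]; apply: le_lt_trans.
rewrite le_eqVlt; apply/orP; left; apply/eqP; apply: eq_integral => x _ /=.
by rewrite powR_mulrn// cmodM normrM expr2.
Qed.

(** Hoelder's inequality with exponents 2 and 2, the Gaussian kernel k being in L^2. *)
Lemma cintegral_L2_cvg (f : R -> R[i]) (S : nat -> R -> R[i]) (k : R -> R[i]) :
  cmeasurable f -> (forall n, cmeasurable (S n)) -> gdominated k ->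
  cintegrable (fun x => f x * k x) ->
  (forall n, cintegrable (fun x => S n x * k x)) ->
  L2norm (fun x => f x - S N x) @[N --> \oo] --> 0%E ->
  ccvg (fun n => cintegral (fun x => S n x * k x)) (cintegral (fun x => f x * k x)).
Proof.
move=> mf mS gk ifk iSk L2.
have mk := ccontinuous_measurable gk.1.
have md n : cmeasurable (fun x => f x - S n x).
  have := cmeasurableD mf (cmeasurableM (cmeasurable_cst _ (-1)) (mS n)).
  by congr cmeasurable; apply/funext => x; rewrite mulN1r.
have idk n : cintegrable (fun x => (f x - S n x) * k x).
  have := cintegrableD ifk (cintegrableZ (-1) (iSk n)).
  by congr cintegrable; apply/funext => x; ring.
have mdk n := cmeasurableM (md n) mk.
have icm n := cintegrable_cmod (mdk n) (idk n).
pose M := fine (L2norm k).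
have kM : L2norm k = M%:E by rewrite fineK// ge0_fin_numE ?Lnorm_ge0// gdominated_L2norm.
have bnd n : ((cmod (cintegral (fun x => S n x * k x)%R - cintegral (fun x => f x * k x)%R)%R)%:E <=
    2%:E * (L2norm (fun x => f x - S n x)%R * L2norm k))%E.
  have -> : cintegral (fun x => S n x * k x) - cintegral (fun x => f x * k x) =
     - cintegral (fun x => (f x - S n x) * k x).
    have -> : (fun x => (f x - S n x) * k x) = (fun x => f x * k x + -1 * (S n x * k x)).
      by apply/funext => x; ring.
    by rewrite cintegralD ?cintegralZ//; [ring|exact: cintegrableZ].
  rewrite cmodN.
  have [||_ b1] := @cintegral_dominated R _ _ (mdk n) _ (icm n).
  - by move=> x; exact: cmod_ge0.
  - by apply: aeW => x.
  rewrite (@le_trans _ _ (2 * (\int[mu]_x cmod ((f x - S n x) * k x)))%:E)//.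
  rewrite EFinM lee_wpmul2l// /Rintegral fineK; last exact: integrable_fin_num (icm n).
  have := @hoelder _ _ R mu (fun x => cmod (f x - S n x)) (fun x => cmod (k x)) 2 2
    (measurable_cmod (md n)) (measurable_cmod mk) (ltr0n _ 2) (ltr0n _ 2) _.
  have half : 2^-1 + 2^-1 = 1 :> R by field.
  move=> /(_ half); apply: le_trans; rewrite Lnorm1.
  rewrite le_eqVlt; apply/orP; left; apply/eqP; apply: eq_integral => x _ /=.
  by rewrite -cmodM ger0_norm ?cmod_ge0.
have lim0 : (2%:E * (L2norm (fun x => f x - S N x)%R * L2norm k))%E @[N --> \oo] --> 0%:E.
  rewrite kM; under eq_fun do rewrite (muleC (L2norm _)) muleA -EFinM.
  have -> : 0%:E = ((2 * M)%:E * 0)%E :> \bar R by rewrite mule0.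
  exact: cvgeZl.
have lim1 : (fun N => fine (2%:E * (L2norm (fun x => f x - S N x)%R * L2norm k))%E) @ \oo --> (0 : R).
  exact: fine_cvg lim0.
(* [fine] sends an infinite norm to 0, so the comparison is restricted to large N, where convergence
   to 0 makes the norms finite. *)
have fin : \forall N \near \oo, (2%:E * (L2norm (fun x => f x - S N x)%R * L2norm k))%E \is a fin_num.
  by have [] := (fine_cvgP _ _).1 lim0.
rewrite /ccvg; apply: (squeeze_cvgr _ (cvg_cst 0) lim1).
near=> n.
have fn : (2%:E * (L2norm (fun x => f x - S n x)%R * L2norm k))%E \is a fin_num.
  by near: n; exact: fin.
by rewrite cmod_ge0/= -lee_fin fineK//; exact: bnd.
Unshelve. all: by end_near.
Qed.

End L2.

(** * The Bargmann transform *)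

Section Bargmann.
Context {R : realType}.
Local Notation mu := (@lebesgue_measure R).
Local Notation s := (Num.sqrt (2 * pi) : R).

Lemma tanhE (x : R) : tanh x = (1 - expR (- (2 * x))) / (1 + expR (- (2 * x))).
Proof.
have -> : - (2 * x) = - x - x by ring.
rewrite /tanh expRD !expRN; have := expR_gt0 x; move: (expR x) => e e0.
field; rewrite !gt_eqF//= ?addr_gt0 ?mulr_gt0 ?invr_gt0// ?exprn_gt0//.
Qed.

Definition bargmann_kernel (z : R[i]) : R -> R[i] :=
  cgauss pi (2 * pi%:C * z) (- (pi%:C * z ^+ 2 / 2)).

(** The factor sqrt 2 normalizes the transform so that its Taylor coefficients are exactly
    [bargmann_coef]. *)
Definition bargmann (f : R -> R[i]) (z : R[i]) : R[i] :=
  (Num.sqrt 2)%:C * cintegral (fun x => f x * bargmann_kernel z x).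

Definition hermite_norm (n : nat) : R :=
  Num.sqrt (2 ^+ n * Num.sqrt pi * (n`!)%:R).

Definition bargmann_coef (c : nat -> R[i]) (n : nat) : R[i] :=
  c n * (s ^+ n / hermite_norm n)%:C.

Lemma scaled_hermiteE n (x : R) : scaled_hermite n x =
  ((hermite_norm n)^-1)%:C * ((expR (- (pi * x ^+ 2)))%:C * ((herm n).[s * x])%:C).
Proof.
rewrite /scaled_hermite /hermite_fun hermite_polyE -!rmorphM/=; congr (_%:C).
rewrite mulrC; congr (_ * (expR (- _) * _)).
by rewrite exprMn sqr_sqrtr ?mulr_ge0 ?pi_ge0//; field.
Qed.

(** The Gaussian of h_n and that of the kernel combine into exp(- 2 pi x^2). Completing the square
    then gives pi z^2 / 2, which cancels the last term of the kernel, so that a pure monomial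
    remains. *)
Lemma gdominated_hermite_kernel n (z : R[i]) :
  gdominated (fun x => scaled_hermite n x * bargmann_kernel z x) /\
  cintegral (fun x => scaled_hermite n x * bargmann_kernel z x) =
  (Num.sqrt 2)^-1%:C * ((s ^+ n / hermite_norm n)%:C * z ^+ n).
Proof.
have p0 := pi_gt0 R.
have b0 : 0 < 2 * pi :> R by rewrite mulr_gt0.
pose G := cgauss (2 * pi) (2 * pi%:C * z) (- (pi%:C * z ^+ 2 / 2)).
have E x : scaled_hermite n x * bargmann_kernel z x =
    ((hermite_norm n)^-1)%:C * (((herm n).[s * x])%:C * G x).
  have GE : G x = (expR (- (pi * x ^+ 2)))%:C * bargmann_kernel z x.
    rewrite -cexp_real /bargmann_kernel /G /cgauss -cexpD; congr cexp.
    rewrite !addrA -rmorphD/=; congr (_%:C + _ + _); ring.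
  by rewrite GE scaled_hermiteE; ring.
have gG := gdominated_poly (herm n) s (gdominated_cgauss (2 * pi%:C * z) (- (pi%:C * z ^+ 2 / 2)) b0).
split; first by apply: eq_gdominated (gdominatedZ _ gG) => x; rewrite E.
rewrite (eq_cintegral E) cintegralZ; last exact: gdominated_integrable.
rewrite cintegral_herm cintegral_cgauss// exprMn.
have -> : pi / (2 * pi) = 2^-1 :> R by rewrite invfM mulrCA divff ?mulr1// gt_eqF.
have -> : (2 * pi%:C * z) ^+ 2 / (4 * (2 * pi))%:C + - (pi%:C * z ^+ 2 / 2) = 0.
  have pC : pi%:C != 0 :> R[i].
    by apply/eqP => /(congr1 (@complex.Re R))/= /eqP; rewrite gt_eqF.
  rewrite !rmorphM/= !rmorph_nat.
  by move: (pi%:C) pC => P P0; field.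
rewrite cexp0 mulr1 sqrtrV// rmorphM rmorphXn/=; ring.
Qed.

Lemma bargmann_psum (c : nat -> R[i]) N (z : R[i]) :
  cintegrable (fun x => (\sum_(n < N) c n * scaled_hermite n x) * bargmann_kernel z x) /\
  cintegral (fun x => (\sum_(n < N) c n * scaled_hermite n x) * bargmann_kernel z x) =
  (Num.sqrt 2)^-1%:C * psum (bargmann_coef c) N z.
Proof.
pose t n x := c n * (scaled_hermite n x * bargmann_kernel z x).
have ti n : cintegrable (t n).
  apply: cintegrableZ; apply: gdominated_integrable.
  exact: (gdominated_hermite_kernel n z).1.
have E : (fun x => (\sum_(n < N) c n * scaled_hermite n x) * bargmann_kernel z x) =
    (fun x => \sum_(n < N) t n x).
  by apply/funext => x; rewrite mulr_suml; apply: eq_bigr => n _; rewrite /t mulrA.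
rewrite E; have [h1 ->] := cintegral_sum N ti; split => //.
rewrite /psum mulr_sumr; apply: eq_bigr => n _.
rewrite cintegralZ; last exact: gdominated_integrable (gdominated_hermite_kernel n z).1.
rewrite (gdominated_hermite_kernel n z).2 /bargmann_coef; ring.
Qed.

Lemma cmeasurable_scaled_hermite n : cmeasurable (@scaled_hermite R n).
Proof.
split; last exact: measurable_cst.
apply: continuous_measurable_fun.
have -> : (fun x : R => complex.Re (scaled_hermite n x)) =
    (fun x => (hermite_norm n)^-1 * (expR (- (pi * x ^+ 2)) * (herm n).[s * x])).
  by apply/funext => x; rewrite scaled_hermiteE -!rmorphM.
have ce : continuous (fun x : R => expR (- (pi * x ^+ 2))).
  move=> x; apply: continuous_comp; last exact: continuous_expR.
  by apply: cvgN; apply: cvgMr; exact: exprn_continuous.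
have ch : continuous (fun x : R => (herm n).[s * x]).
  move=> x; apply: (@continuous_comp _ _ _ (fun x => s * x) (horner (herm n))).
    by apply: cvgMr; exact: cvg_id.
  exact: continuous_horner.
by move=> x; apply: cvgMr; apply: cvgM; [exact: ce|exact: ch].
Qed.

(** Shared by both bounds on F: applied to f, and to its Fourier transform after
    [bargmann_fourier]. *)
Lemma gauss_pairing_bound (h : R -> R[i]) (C0 a : R) (w d : R[i]) :
  0 < C0 -> 0 < a -> cmeasurable (fun x => h x * cgauss pi w d x) ->
  {ae mu, forall x, cmod (h x) <= C0 * expR (- (a * pi * `|x| ^+ 2))} ->
  cintegrable (fun x => h x * cgauss pi w d x) /\
  cmod (cintegral (fun x => h x * cgauss pi w d x)) <=
  2 * (C0 * Num.sqrt (pi / ((1 + a) * pi))) *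
    expR (complex.Re d + complex.Re w ^+ 2 / (4 * ((1 + a) * pi))).
Proof.
move=> C0_gt0 a0 mh hb; have p0 := pi_gt0 R.
have b0 : 0 < (1 + a) * pi by rewrite mulr_gt0// addr_gt0.
have [ig eg] := gauss_linear (complex.Re w) b0.
pose g x := C0 * expR (complex.Re d) * expR (- ((1 + a) * pi * x ^+ 2) + complex.Re w * x).
have hg : {ae mu, forall x, cmod (h x * cgauss pi w d x) <= g x}.
  apply: (ae_imply hb) => x hx; rewrite cmodM cmod_cgauss.
  rewrite (le_trans (ler_wpM2r (expR_ge0 _) hx))// /g -!mulrA -!expRD.
  rewrite ler_pM2l// ler_expR real_normK ?num_real//.
  by rewrite le_eqVlt; apply/orP; left; apply/eqP; ring.
have ig' : mu.-integrable [set: R] (EFin \o g).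
  have := integrableZl measurableT (C0 * expR (complex.Re d)) ig.
  by congr (mu.-integrable _ _); apply/funext.
have g0 x : 0 <= g x by rewrite mulr_ge0 ?expR_ge0// mulr_ge0 ?expR_ge0// ltW.
have [h1 h2] := cintegral_dominated mh g0 ig' hg; split => //.
rewrite (le_trans h2)// /g RintegralZl// eg expRD le_eqVlt; apply/orP; left; apply/eqP.
by ring.
Qed.

End Bargmann.

(** * Growth of the Bargmann transform *)

Section BargmannBounds.
Context {R : realType}.
Local Notation mu := (@lebesgue_measure R).
Variables (f : R -> R[i]) (C0 rho : R).
Hypotheses (C0_gt0 : 0 < C0) (rho0 : 0 < rho) (rho1 : rho < 1).
Let a := (1 - rho ^+ 2) / (1 + rho ^+ 2).
Hypothesis mf : cmeasurable f.
Hypothesis fb : {ae mu, forall x, cmod (f x) <= C0 * expR (- (a * pi * `|x| ^+ 2))}.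
Hypothesis fhb : {ae mu, forall xi, cmod (fourier f xi) <= C0 * expR (- (a * pi * `|xi| ^+ 2))}.

Let a_gt0 : 0 < a.
Proof.
apply: divr_gt0; first by rewrite subr_gt0 exprn_ilt1// ltW.
by rewrite addr_gt0// exprn_gt0.
Qed.

Let one_a : 1 + a = 2 / (1 + rho ^+ 2).
Proof. by rewrite /a; field; rewrite gt_eqF// addr_gt0// exprn_gt0. Qed.

Let C1 := Num.sqrt 2 * (2 * (C0 * Num.sqrt (pi / ((1 + a) * pi)))).

Lemma bargmann_const_gt0 : 0 < C1.
Proof.
have p0 := pi_gt0 R.
have c0 : 0 < pi / ((1 + a) * pi) by rewrite divr_gt0// mulr_gt0// addr_gt0 ?a_gt0.
by rewrite /C1; do 3 (apply: mulr_gt0 => //); rewrite sqrtr_gt0.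
Qed.

Let kernel_measurable w d : cmeasurable (fun x => f x * cgauss pi w d x).
Proof.
apply: cmeasurableM => //; apply: ccontinuous_measurable.
exact: (gdominated_cgauss w d (pi_gt0 R)).1.
Qed.

Lemma cintegrable_bargmann z : cintegrable (fun x => f x * bargmann_kernel z x).
Proof. exact: (gauss_pairing_bound C0_gt0 a_gt0 (kernel_measurable _ _) fb).1. Qed.

(** The pairing contributes pi u^2 / (1 + a) = pi/2 (1 + rho^2) u^2, and the factor exp(- pi z^2 /
    2) removes pi/2 (u^2 - v^2). *)
Lemma bargmann_bound1 (u v : R) : cmod (bargmann f (u +i* v)) <=
  C1 * expR (pi / 2 * (rho ^+ 2 * u ^+ 2 + v ^+ 2)).
Proof.
have p0 := pi_gt0 R.
rewrite cmodM cmod_pos ?sqrtr_ge0// /C1 -[leRHS]mulrA ler_wpM2l ?sqrtr_ge0//.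
have := (gauss_pairing_bound C0_gt0 a_gt0
  (kernel_measurable (2 * pi%:C * (u +i* v)) (- (pi%:C * (u +i* v) ^+ 2 / 2))) fb).2.
move=> /le_trans; apply; rewrite le_eqVlt; apply/orP; left; apply/eqP.
congr (_ * expR _); rewrite one_a expr2.
have r2 : 1 + rho ^+ 2 != 0 by rewrite gt_eqF// addr_gt0// exprn_gt0.
have -> : complex.Re (2 * pi%:C * (u +i* v)) = 2 * pi * u.
  by rewrite !(ReM, ImM)/=; ring.
have -> : complex.Re (- (pi%:C * ((u +i* v) * (u +i* v)) / 2)) = - (pi * (u * u - v * v) / 2).
  have -> : (2 : R[i])^-1 = (2^-1)%:C by rewrite fmorphV rmorph_nat.
  by rewrite !(ReN, ReM, ImM)/=; ring.
by move: (@pi R) p0 => P P0; field; rewrite r2 gt_eqF.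
Qed.

Let fourier_kernel (z : R[i]) : R -> R[i] := cgauss pi (2 * pi%:C * ('i%C * z)) 0.

(** The Gaussian is its own Fourier transform: integrating exp(- 2 pi i x xi) against
    [fourier_kernel] gives exp(- pi (z - x)^2), and Fubini moves the transform onto f. Fubini also
    supplies the measurability needed to bound the result. *)
Lemma bargmann_fourier z :
  cmeasurable (fun xi => fourier f xi * fourier_kernel z xi) /\
  bargmann f z = (Num.sqrt 2)%:C * (cexp (pi%:C * z ^+ 2 / 2) *
    cintegral (fun xi => fourier f xi * fourier_kernel z xi)).
Proof.
have p0 := pi_gt0 R.
have gg : gdominated (fourier_kernel z) by exact: gdominated_cgauss.
have mg := ccontinuous_measurable gg.1.
have if1 : cintegrable f /\ mu.-integrable [set: R] (EFin \o (fun x => cmod (f x))).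
  have ig := integrableZl measurableT C0 (integrable_gauss (mulr_gt0 a_gt0 p0)).
  have g0 x : 0 <= C0 * expR (- (a * pi * x ^+ 2)) by rewrite mulr_ge0 ?expR_ge0// ltW.
  have fb' : {ae mu, forall x, cmod (f x) <= C0 * expR (- (a * pi * x ^+ 2))}.
    by apply: (ae_imply fb) => x; rewrite real_normK ?num_real.
  have [h _] := cintegral_dominated mf g0 ig fb'; split => //.
  exact: cintegrable_cmod.
have [if0 ifc] := if1.
pose h (p : R * R) : R[i] := f p.1 * expi (- (2 * pi * p.1 * p.2)) * fourier_kernel z p.2.
have mh : cmeasurable h.
  apply: cmeasurableM; first apply: cmeasurableM.
  - by split; [exact: measurableT_comp mf.1 measurable_fst|exact: measurableT_comp mf.2 measurable_fst].
  - have mm : measurable_fun [set: R * R] (fun p : R * R => - (2 * pi * p.1 * p.2)).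
      apply: measurableT_comp => //; apply: measurable_funM; last exact: measurable_snd.
      by apply: measurable_funM; [exact: measurable_cst|exact: measurable_fst].
    split => /=.
      apply: (measurableT_comp _ mm); apply: continuous_measurable_fun; exact: continuous_cos.
    apply: (measurableT_comp _ mm); apply: continuous_measurable_fun; exact: continuous_sin.
  - by split; [exact: measurableT_comp mg.1 measurable_snd|exact: measurableT_comp mg.2 measurable_snd].
have ei (x xi : R) : cmod (expi (- (2 * pi * x * xi))) = 1 by exact: cmod_expi.
(* The product majorant is an equality, the oscillating factor having modulus 1. *)
have [m1 e1] := @cintegral_Fubini R h (fun x => cmod (f x)) (fun xi => cmod (fourier_kernel z xi)) mh
  (fun x => cmod_ge0 _) (fun x => cmod_ge0 _) ifc
  (cintegrable_cmod mg (gdominated_integrable gg))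
  (fun x xi => eq_ind_r (fun r => r <= _)
    (lexx _) (etrans (cmodM _ _) (congr1 (fun r => r * _) (etrans (cmodM _ _)
      (etrans (congr1 (fun r => _ * r) (ei x xi)) (mulr1 _)))))).
have inner xi : cintegral (fun x => h (x, xi)) = fourier f xi * fourier_kernel z xi.
  rewrite /fourier mulrC -cintegralZ.
    by apply: eq_cintegral => x; rewrite /h/= mulrC.
  have mfe : cmeasurable (fun x => f x * expi (- (2 * pi * x * xi))).
    apply: cmeasurableM; first exact: mf.
    have mm : measurable_fun [set: R] (fun x : R => - (2 * pi * x * xi)).
      apply: continuous_measurable_fun => x; apply: cvgN; apply: cvgMl; apply: cvgMr.
      exact: cvg_id.
    split => /=.
      apply: (measurableT_comp _ mm); apply: continuous_measurable_fun; exact: continuous_cos.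
    apply: (measurableT_comp _ mm); apply: continuous_measurable_fun; exact: continuous_sin.
  have [||//] := cintegral_dominated mfe _ ifc.
    by move=> x; exact: cmod_ge0.
  by apply: aeW => x; rewrite cmodM cmod_expi mulr1.
have outer x : cexp (pi%:C * z ^+ 2 / 2) * cintegral (fun xi => h (x, xi)) = f x * bargmann_kernel z x.
  have -> : (fun xi => h (x, xi)) = (fun xi => f x * cgauss pi (2 * pi%:C * ('i%C * (z - x%:C))) 0 xi).
    apply/funext => xi; rewrite /h/= -mulrA; congr (_ * _).
    have -> : expi (- (2 * pi * x * xi)) = cexp ('i%C * (- (2 * pi * x * xi))%:C).
      have -> : 'i%C * (- (2 * pi * x * xi))%:C = 0 +i* (- (2 * pi * x * xi)) :> R[i].
        by apply: complex_ext; rewrite ?ReM ?ImM/=; ring.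
      by rewrite /cexp expR0 mul1r.
    rewrite /fourier_kernel /cgauss -cexpD; congr cexp.
    have -> : (- (2 * pi * x * xi))%:C = - (2 * pi%:C * x%:C * xi%:C) :> R[i].
      by rewrite rmorphN !rmorphM rmorph_nat.
    move: (pi%:C) ((- (pi * xi ^+ 2))%:C) => P Q; ring.
  rewrite cintegralZ; last by apply: gdominated_integrable; exact: gdominated_cgauss.
  set W := 2 * pi%:C * ('i%C * (z - x%:C)).
  have -> : cintegral (cgauss pi W 0) = cexp (W ^+ 2 / (4 * pi)%:C + 0).
    have pp : pi / pi = 1 :> R by exact: (divff (lt0r_neq0 p0)).
    rewrite (cintegral_cgauss W 0 p0) pp sqrtr1.
    exact: mul1r.
  rewrite mulrCA.
  rewrite -cexpD.
  rewrite /bargmann_kernel /cgauss; congr (_ * cexp _).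
  have pC : pi%:C != 0 :> R[i].
    apply/eqP => /(congr1 (@complex.Re R))/= pi0.
    by move: (lt0r_neq0 p0); rewrite pi0 eqxx.
  have i2 : 'i%C ^+ 2 = -1 :> R[i] by exact: sqr_i.
  have -> : W ^+ 2 = - 4 * pi%:C ^+ 2 * (z - x%:C) ^+ 2.
    by rewrite /W !exprMn i2; ring.
  have -> : (- (pi * x ^+ 2))%:C = - (pi%:C * x%:C ^+ 2) :> R[i].
    by rewrite rmorphN [X in - X]rmorphM rmorphXn.
  have -> : (4 * pi)%:C = 4 * pi%:C :> R[i] by rewrite rmorphM rmorph_nat.
  by move: (pi%:C) pC => P P0; field.
split.
  by move: m1; congr cmeasurable; apply/funext => xi; exact: inner.
rewrite /bargmann; congr (_ * _).
rewrite -(eq_cintegral outer) cintegralZ.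
  by rewrite e1; congr (_ * _); apply: eq_cintegral => xi; exact: inner.
have iF := cintegrableZ (cexp (- (pi%:C * z ^+ 2 / 2))) (cintegrable_bargmann z).
move: iF; congr cintegrable; apply/funext => x.
by rewrite -outer mulrA -cexpD addNr cexp0 mul1r.
Qed.

(** The linear coefficient now contains i z, whose real part is - v, and the prefactor is exp(pi z^2
    / 2) with the opposite sign; so u and v trade places. *)
Lemma bargmann_bound2 (u v : R) : cmod (bargmann f (u +i* v)) <=
  C1 * expR (pi / 2 * (u ^+ 2 + rho ^+ 2 * v ^+ 2)).
Proof.
have p0 := pi_gt0 R.
have [mF ->] := bargmann_fourier (u +i* v).
rewrite cmodM cmod_pos ?sqrtr_ge0// /C1 -[leRHS]mulrA ler_wpM2l ?sqrtr_ge0//.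
have := (gauss_pairing_bound C0_gt0 a_gt0 mF fhb).2.
rewrite cmodM cmod_cexp => h.
rewrite (le_trans (ler_wpM2l (expR_ge0 _) h))// mulrCA -expRD.
rewrite le_eqVlt; apply/orP; left; apply/eqP.
congr (_ * expR _); rewrite one_a expr2.
have r2 : 1 + rho ^+ 2 != 0 by rewrite gt_eqF// addr_gt0// exprn_gt0.
have -> : complex.Re (2 * pi%:C * ('i%C * (u +i* v))) = - (2 * pi * v).
  by rewrite !(ReM, ImM)/=; ring.
have -> : complex.Re (pi%:C * ((u +i* v) * (u +i* v)) / 2) = pi * (u * u - v * v) / 2.
  have -> : (2 : R[i])^-1 = (2^-1)%:C by rewrite fmorphV rmorph_nat.
  by rewrite !(ReN, ReM, ImM)/=; ring.
by move: (@pi R) p0 => P P0 /=; field; rewrite r2 gt_eqF.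
Qed.

End BargmannBounds.

(** * The oscillator *)

Section Inversion.
Context {R : realType}.
Local Notation mu := (@lebesgue_measure R).
Local Notation s := (Num.sqrt (2 * pi) : R).

Let line (u v : R) : R[i] := u%:C + 'i%C * v%:C.

Let cmod_line (u v : R) : cmod (line u v) ^+ 2 = u ^+ 2 + v ^+ 2.
Proof. by rewrite cmod_sqr /line !(ReD, ImD, ReM, ImM)/=; ring. Qed.

(** Since exp(2 (2n + 1) pi i t) = exp(2 pi i t) exp(4 pi i t)^n, the evolution rotates z by 4 pi t
    up to a global phase. The abscissa u is arbitrary. *)
Lemma oscillator_seriesE (c : nat -> R[i]) (x t u : R) N :
  oscillator_series c x t N =
  expi (2 * pi * t) * (expR (pi * x ^+ 2) / Num.sqrt 2)%:C *
  cintegral (fun v => psum (bargmann_coef c) N (expi (4 * pi * t) * (u%:C + 'i%C * v%:C)) *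
     bkernel u x v).
Proof.
pose J n := cintegral (fun v => line u v ^+ n * bkernel u x v).
have Ji n : cintegrable (fun v => line u v ^+ n * bkernel u x v).
  exact: gdominated_integrable (gdominated_line u x n).
pose w n := bargmann_coef c n * expi (4 * pi * t) ^+ n.
have -> : cintegral (fun v => psum (bargmann_coef c) N (expi (4 * pi * t) * line u v) * bkernel u x v) =
    \sum_(n < N) w n * J n.
  have E v : psum (bargmann_coef c) N (expi (4 * pi * t) * line u v) * bkernel u x v =
      \sum_(n < N) w n * (line u v ^+ n * bkernel u x v).
    rewrite /psum mulr_suml; apply: eq_bigr => n _.
    by rewrite exprMn /w; ring.
  rewrite (eq_cintegral E).
  have [_ ->] := cintegral_sum N (fun n => cintegrableZ (w n) (Ji n)).
  by apply: eq_bigr => n _; rewrite cintegralZ.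
rewrite /oscillator_series /series/= big_mkord mulr_sumr; apply: eq_bigr => n _.
have HJ := cintegral_bkernel u x n; rewrite -/(J n) bkernel0 in HJ.
have e0 : expR (pi * x ^+ 2) * expR (- (2 * pi * x ^+ 2)) = expR (- (pi * x ^+ 2)).
  by rewrite -expRD; congr expR; ring.
have s20 : Num.sqrt 2 != 0 :> R by rewrite gt_eqF// sqrtr_gt0.
have HH : (expR (- (pi * x ^+ 2)))%:C * ((herm n).[s * x])%:C =
   (expR (pi * x ^+ 2) / Num.sqrt 2)%:C * (s%:C ^+ n * J n).
  have -> : expR (- (pi * x ^+ 2)) =
      expR (pi * x ^+ 2) / Num.sqrt 2 * (Num.sqrt 2 * expR (- (2 * pi * x ^+ 2))).
    by rewrite -e0; move: (Num.sqrt 2) s20 => q q0; field.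
  by rewrite HJ rmorphM/=; ring.
rewrite /oscillator_term scaled_hermiteE HH /w /bargmann_coef.
have -> : expi (2 * (2 * n%:R + 1) * pi * t) = expi (2 * pi * t) * expi (4 * pi * t) ^+ n :> R[i].
  by rewrite expiX -expiD; congr expi; ring.
rewrite (rmorphM _ (s ^+ n)) rmorphXn/=; ring.
Qed.

Variables (c : nat -> R[i]) (F : R[i] -> R[i]) (C rho : R).
Hypotheses (C0 : 0 < C) (rho0 : 0 < rho) (rho1 : rho < 1).
Hypothesis cF : forall z, ccvg (psum (bargmann_coef c) ^~ z) (F z).
Hypothesis FC : forall z, cmod (F z) <= C * expR (pi / 2 * rho * cmod z ^+ 2).

(** Two majorants are used: a lossy one for the partial sums, which only serves dominated
    convergence, and the sharp one for F, which gives the estimate. *)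
Lemma oscillator_bound (x t : R) : exists2 L : R[i],
  ccvg (oscillator_series c x t) L &
  cmod L <= 2 * C * Num.sqrt (pi / (pi / 2 * (1 - rho))) / Num.sqrt 2 *
    expR (- ((1 - rho) / (1 + rho) * pi * x ^+ 2)).
Proof.
have p0 := pi_gt0 R.
have r1 : 0 < 1 + rho by rewrite addr_gt0.
(* the abscissa minimizing the exponent of the final bound *)
pose u := 2 * x / (1 + rho).
pose zeta : R[i] := expi (4 * pi * t).
have czeta v : cmod (zeta * line u v) ^+ 2 = u ^+ 2 + v ^+ 2.
  by rewrite cmodM cmod_expi mul1r cmod_line.
(* Both lam > 1, for Cauchy's estimate, and rho lam^2 < 1, for integrability against the decay exp(-
   pi/2 v^2) of the kernel, are needed; this choice gives rho lam^2 = 2 rho / (1 + rho). *)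
pose lam := Num.sqrt (2 / (1 + rho)).
have lam2 : lam ^+ 2 = 2 / (1 + rho) by rewrite sqr_sqrtr// divr_ge0// ltW.
have lam1 : 1 < lam.
  have l2 : 1 < 2 / (1 + rho) by rewrite ltr_pdivlMr// mul1r; have := rho1; move: (rho) => r; lra.
  by rewrite -(@ltr_pXn2r _ 2) ?nnegrE ?sqrtr_ge0// lam2 expr1n.
pose sg := rho * lam ^+ 2.
have sg1 : sg < 1.
  by rewrite /sg lam2 mulrA ltr_pdivrMr// mul1r; have := rho1; move: (rho) => r; lra.
(* Used with r = [sg] for the partial sums and with r = rho for the limit. *)
have kb (r : R) v : expR (pi / 2 * r * (u ^+ 2 + v ^+ 2)) * cmod (bkernel u x v) =
    expR (pi / 2 * (1 + r) * u ^+ 2 - 2 * pi * x * u) * expR (- (pi / 2 * (1 - r) * v ^+ 2)).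
  by rewrite cmod_cgauss -!expRD/=; congr expR; ring.
have mline n : cmeasurable (fun v => psum (bargmann_coef c) n (zeta * line u v)).
  have cl : ccontinuous (line u).
    apply: ccontinuousD; first exact: ccontinuous_cst.
    apply: ccontinuousM; first exact: ccontinuous_cst.
    by apply: ccontinuous_real => y; exact: cvg_id.
  have ml := ccontinuous_measurable (ccontinuousM (ccontinuous_cst zeta) cl).
  apply: cmeasurable_sum => i; apply: cmeasurableM; first exact: cmeasurable_cst.
  elim: (i : nat) => [|m IH].
    by under eq_fun do rewrite expr0; exact: cmeasurable_cst.
  by under eq_fun do rewrite exprS; exact: cmeasurableM.
have mFl : cmeasurable (fun v => F (zeta * line u v)).
  split.
    apply: (measurable_fun_cvg (h := fun n v => complex.Re (psum (bargmann_coef c) n (zeta * line u v)))).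
      by move=> m; exact: (mline m).1.
    by move=> v _; exact: (ccvg_Re (cF _)).
  apply: (measurable_fun_cvg (h := fun n v => complex.Im (psum (bargmann_coef c) n (zeta * line u v)))).
    by move=> m; exact: (mline m).2.
  by move=> v _; exact: (ccvg_Im (cF _)).
have mbk : cmeasurable (bkernel u x).
  apply: ccontinuous_measurable; have p20 : 0 < pi / 2 :> R by rewrite divr_gt0.
  exact: (gdominated_cgauss _ _ p20).1.
have igauss (r D : R) : r < 1 -> mu.-integrable [set: R] (EFin \o (fun v =>
    D * (expR (pi / 2 * (1 + r) * u ^+ 2 - 2 * pi * x * u) * expR (- (pi / 2 * (1 - r) * v ^+ 2))))).
  move=> r1'; have b0 : 0 < pi / 2 * (1 - r) by rewrite mulr_gt0 ?divr_gt0// subr_gt0.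
  have := integrableZl measurableT (D * expR (pi / 2 * (1 + r) * u ^+ 2 - 2 * pi * x * u)) (integrable_gauss b0).
  by congr (mu.-integrable _ _); apply/funext => v /=; rewrite -!EFinM mulrA.
have lim : ccvg (fun n => cintegral (fun v => psum (bargmann_coef c) n (zeta * line u v) * bkernel u x v))
    (cintegral (fun v => F (zeta * line u v) * bkernel u x v)).
  apply: (cintegral_cvg _ _ _ (igauss sg (C / (1 - lam^-1)) sg1)).
  - by move=> n; exact: cmeasurableM.
  - exact: cmeasurableM.
  - move=> v; have := ccvgZ (bkernel u x v) (cF (zeta * line u v)).
    rewrite [bkernel u x v * _]mulrC; set S := fun n => _.
    rewrite (_ : S = fun n => psum (bargmann_coef c) n (zeta * line u v) * bkernel u x v)//.
    by apply/funext => n; rewrite /S mulrC.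
  - move=> n v; rewrite cmodM -kb mulrA ler_wpM2r ?cmod_ge0//.
    rewrite /psum (le_trans (cmod_sum _ _ _))//.
    under eq_bigr do rewrite cmodM cmodX.
    have := sum_cmod_gaussian lam1 cF FC n (zeta * line u v).
    by rewrite czeta /sg mulrA.
exists (expi (2 * pi * t) * (expR (pi * x ^+ 2) / Num.sqrt 2)%:C *
    cintegral (fun v => F (zeta * line u v) * bkernel u x v)).
  have -> : oscillator_series c x t = (fun n => expi (2 * pi * t) * (expR (pi * x ^+ 2) / Num.sqrt 2)%:C *
    cintegral (fun v => psum (bargmann_coef c) n (zeta * line u v) * bkernel u x v)).
    by apply/funext => N; rewrite (oscillator_seriesE c x t u).
  exact: ccvgZ.
have g0 v : 0 <= C * (expR (pi / 2 * (1 + rho) * u ^+ 2 - 2 * pi * x * u) * expR (- (pi / 2 * (1 - rho) * v ^+ 2))).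
  by rewrite mulr_ge0 ?(ltW C0)// mulr_ge0 ?expR_ge0.
have dom v : cmod (F (zeta * line u v) * bkernel u x v) <=
   C * (expR (pi / 2 * (1 + rho) * u ^+ 2 - 2 * pi * x * u) * expR (- (pi / 2 * (1 - rho) * v ^+ 2))).
  by rewrite cmodM -kb mulrA ler_wpM2r ?cmod_ge0// -(czeta v).
have [||_ bnd] := cintegral_dominated (cmeasurableM mFl mbk) _ (igauss rho C rho1).
- exact: g0.
- by apply: aeW => v; exact: dom.
have b0 : 0 < pi / 2 * (1 - rho) by rewrite mulr_gt0 ?divr_gt0// subr_gt0.
have eI : (\int[mu]_v (C * (expR (pi / 2 * (1 + rho) * u ^+ 2 - 2 * pi * x * u) *
     expR (- (pi / 2 * (1 - rho) * v ^+ 2)))))%R =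
   C * expR (pi / 2 * (1 + rho) * u ^+ 2 - 2 * pi * x * u) * Num.sqrt (pi / (pi / 2 * (1 - rho))).
  under eq_Rintegral do rewrite mulrA.
  rewrite RintegralZl//; last exact: integrable_gauss.
  have [_] := gauss_shift 0 b0; under eq_Rintegral do rewrite subr0.
  by move=> ->.
rewrite eI in bnd.
rewrite 2!cmodM cmod_expi mul1r cmod_pos ?divr_ge0 ?expR_ge0 ?sqrtr_ge0//.
rewrite (le_trans (ler_wpM2l _ bnd)) ?divr_ge0 ?expR_ge0 ?sqrtr_ge0//.
(* At the chosen abscissa the exponent is - 2 pi x^2 / (1 + rho), to which the prefactor adds pi
   x^2. *)
have -> : expR (- ((1 - rho) / (1 + rho) * pi * x ^+ 2)) =
    expR (pi * x ^+ 2) * expR (pi / 2 * (1 + rho) * u ^+ 2 - 2 * pi * x * u).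
  by rewrite -expRD; congr expR; rewrite /u; move: (@pi R) => P; field; rewrite gt_eqF.
by rewrite le_eqVlt; apply/orP; left; apply/eqP; ring.
Qed.

End Inversion.

Theorem theorem1 (R : realType) (alpha : R) (f : R -> R[i])
    (c : nat -> R[i]) :
  0 < alpha ->
  E_infty (tanh (2 * alpha)) f ->
  hermite_expansion f c ->
  exists C : R, 0 < C /\ forall x t : R,
    cvgn (oscillator_series c x t) /\
    cmod (oscillator_sol c x t) <=
      C * expR (- (tanh alpha * pi * `|x| ^+ 2)).
Proof.
move=> alpha0 [[mR mI _] [C0 [C0_gt0 fb fhb]]] fc.
have p0 := pi_gt0 R.
pose rho := expR (- (2 * alpha)).
have rho0 : 0 < rho by exact: expR_gt0.
have rho1 : rho < 1 by rewrite -[ltRHS]expR0 ltr_expR oppr_lt0 mulr_gt0.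
have tanh2 : tanh (2 * alpha) = (1 - rho ^+ 2) / (1 + rho ^+ 2).
  have -> : rho ^+ 2 = expR (- (2 * (2 * alpha))).
    by rewrite -expRM_natl; congr expR; ring.
  exact: tanhE.
rewrite tanh2 in fb fhb.
have mf : cmeasurable f by [].
have s20 : Num.sqrt 2 != 0 :> R by rewrite gt_eqF// sqrtr_gt0.
(* L^2 convergence of the expansion becomes pointwise convergence of the power series of the
   transform. *)
have cF z : ccvg (psum (bargmann_coef c) ^~ z) (bargmann f z).
  have gk : gdominated (bargmann_kernel z) by exact: gdominated_cgauss.
  have := @cintegral_L2_cvg R f (fun N x => \sum_(n < N) c n * scaled_hermite n x)
    (bargmann_kernel z) mf _ gk (cintegrable_bargmann C0_gt0 rho0 rho1 mf fb z)
    (fun N => (bargmann_psum c N z).1) fc.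
  move=> /(_ (fun N => cmeasurable_sum _ (fun n => cmeasurableM (cmeasurable_cst _ _) (cmeasurable_scaled_hermite _)))).
  move=> /(ccvgZ (Num.sqrt 2)%:C); congr ccvg; apply/funext => N.
  by rewrite (bargmann_psum c N z).2 mulrA -rmorphM divff// mul1r.
have k0 : 0 < pi / 2 :> R by rewrite divr_gt0.
have C1_gt0 := bargmann_const_gt0 C0_gt0 rho0 rho1.
(* Here k = pi/2, so the constant becomes C1 exp(pi/2), named [C2] below. *)
have FC := phragmen_lindelof rho0 rho1 k0 C1_gt0 (fun w => taylor2_psum w cF)
  (bargmann_bound1 C0_gt0 rho0 rho1 mf fb) (bargmann_bound2 C0_gt0 rho0 rho1 mf fb fhb).
have C2_gt0 := mulr_gt0 C1_gt0 (expR_gt0 (pi / 2)).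
have osc := oscillator_bound C2_gt0 rho0 rho1 cF FC.
set C2 := _ * expR (pi / 2) in C2_gt0 osc.
have tanh1 : tanh alpha = (1 - rho) / (1 + rho) by exact: tanhE.
exists (2 * C2 * Num.sqrt (pi / (pi / 2 * (1 - rho))) / Num.sqrt 2); split.
  have h : 0 < Num.sqrt (pi / (pi / 2 * (1 - rho))).
    by rewrite sqrtr_gt0 divr_gt0// mulr_gt0// subr_gt0.
  by rewrite divr_gt0 ?sqrtr_gt0// mulr_gt0// mulr_gt0.
move=> x t; have [L cL bL] := osc x t.
have cvL := ccvg_cvg cL.
split; first by apply/cvg_ex; exists L.
rewrite /oscillator_sol (cvg_lim _ cvL); last exact: norm_hausdorff.
by rewrite real_normK ?num_real// tanh1.
Qed.
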